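(* Let $A,B\ge0$ and $t>1$. For each $n$ let $\alpha=\alpha_n>-1$, $\beta=\beta_n>-1$ and $N=N_n\in\mathbb N$ be such that, as $n\to\infty$, $\alpha/n\to A$, $\beta/n\to B$, $N/n\to t$. Let $(x_1,\dots,x_n)$ be drawn from the Hahn ensemble of size $n$ with parameters $\alpha,\beta,N$. Then for any real-valued $f\in C^1([0,1])$, the scaled linear statistic $X_f^{(n)}=\sum_{j=1}^nf(x_j/N)$ satisfies $$X_f^{(n)}-\mathbb EX_f^{(n)}\to N\Big(0,\sum_{k\ge1}k|\hat f_k|^2\Big)\quad\text{as }n\to\infty$$ in distribution, where $\hat f_k=\frac1{2\pi}\int_0^{2\pi}f(2a\cos\theta+b)e^{-ik\theta}\,d\theta$ for $k\ge1$ and $$a=\frac{\sqrt{(t-1)(1+A+B)(1+A)(1+A+B+t)(1+B)}}{t(2+A+B)^2},\qquad b=\frac{(t-1)(1+A+B)(1+A)+(1+A+B+t)(1+B)}{t(2+A+B)^2}.$$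
   Context: For $\alpha,\beta>-1$ and $N\in\mathbb N$, the Hahn weight is $w_N^{(\alpha,\beta)}(x)=\binom{\alpha+x}{x}\binom{\beta+N-x}{N-x}$ on the nodes $x=0,1,\dots,N$. The Hahn ensemble of size $n\le N+1$ is the discrete orthogonal polynomial ensemble for this weight: the probability measure on $\{0,\dots,N\}^n$ proportional to $\prod_{1\le i<j\le n}(x_i-x_j)^2\prod_{i=1}^nw_N^{(\alpha,\beta)}(x_i)$. *)

(* Defs.v *)
From Stdlib Require Import Reals List Factorial.
From Coquelicot Require Import Coquelicot.
Import ListNotations.
Open Scope R_scope.

Fixpoint falling (z : R) (k : nat) : R :=
  match k with O => 1 | S j => falling z j * (z - INR j) end.
Definition gbinom (z : R) (k : nat) : R := falling z k / INR (fact k).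

Definition hahn_weight (N : nat) (alpha beta : R) (x : nat) : R :=
  gbinom (alpha + INR x) x * gbinom (beta + INR (N - x)) (N - x).

Fixpoint sum_config (n N : nat) (F : list nat -> R) : R :=
  match n with
  | O => F []
  | S m => fold_right Rplus 0
             (map (fun x => sum_config m N (fun l => F (x :: l))) (seq 0 (S N)))
  end.

Fixpoint vdm_sq (l : list nat) : R :=
  match l with
  | [] => 1
  | x :: r => fold_right Rmult 1 (map (fun y => (INR x - INR y) ^ 2) r) * vdm_sq r
  end.

Definition hahn_density (N : nat) (alpha beta : R) (l : list nat) : R :=
  vdm_sq l * fold_right Rmult 1 (map (hahn_weight N alpha beta) l).

Definition hahn_expect (n N : nat) (alpha beta : R) (F : list nat -> R) : R :=
  sum_config n N (fun l => hahn_density N alpha beta l * F l)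
  / sum_config n N (hahn_density N alpha beta).

Definition lin_stat (f : R -> R) (N : nat) (l : list nat) : R :=
  fold_right Rplus 0 (map (fun x => f (INR x / INR N)) l).

Definition in01 (x : R) : Prop := 0 <= x <= 1.
Definition C1_on_01 (f : R -> R) : Prop :=
  exists f' : R -> R,
    (forall x, in01 x ->
       filterlim (fun h => (f (x + h) - f x) / h)
                 (within (fun h => h <> 0 /\ in01 (x + h)) (locally 0))
                 (locally (f' x))) /\
    (forall x, in01 x -> filterlim f' (within in01 (locally x)) (locally (f' x))).

Definition a_par (A B t : R) : R :=
  sqrt ((t - 1) * (1 + A + B) * (1 + A) * (1 + A + B + t) * (1 + B))
  / (t * (2 + A + B) ^ 2).
Definition b_par (A B t : R) : R :=
  ((t - 1) * (1 + A + B) * (1 + A) + (1 + A + B + t) * (1 + B))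
  / (t * (2 + A + B) ^ 2).

Definition fhat_re (f : R -> R) (a b : R) (k : nat) : R :=
  / (2 * PI) * RInt (fun th => f (2 * a * cos th + b) * cos (INR k * th)) 0 (2 * PI).
Definition fhat_im (f : R -> R) (a b : R) (k : nat) : R :=
  - / (2 * PI) * RInt (fun th => f (2 * a * cos th + b) * sin (INR k * th)) 0 (2 * PI).
Definition fhat_abs2 (f : R -> R) (a b : R) (k : nat) : R :=
  fhat_re f a b k ^ 2 + fhat_im f a b k ^ 2.

(* the summand k |hat f_k|^2, indexed from k = 1 (term m is k = m+1) *)
Definition var_term (f : R -> R) (a b : R) (m : nat) : R :=
  INR (S m) * fhat_abs2 f a b (S m).

(* integrand for E[g(Z)] with Z ~ N(0, v) : g(sqrt v z) * standard normal density *)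
Definition gauss_integrand (v : R) (g : R -> R) (z : R) : R :=
  g (sqrt v * z) * (exp (- z ^ 2 / 2) / sqrt (2 * PI)).

(* Main.v *)
(** Deform the Hahn weight to w(x) exp(s f(x)). By Heine's formula the moment generating function
    of the linear statistic is a product of norms of the deformed monic orthogonal polynomials p_j,
    and the second derivative in s of its logarithm is the variance
    [1/2 sum_(x,y) (f(x) - f(y))^2 K(x,y)^2 W(x) W(y)], K being the Christoffel-Darboux kernel.
    It is at most Lip(f)^2 and, for polynomial f, it is a function of finitely many recurrence
    coefficients with index near n. These coefficients solve the Toda equations in s, so a Gronwall
    argument carries their limits from s = 0 to all s in [0, 1]; at s = 0 they are explicit, because
    the Hahn difference operator is self-adjoint and bidiagonal on falling factorials. Hence the
    logarithm of the centered moment generating function tends to sigma^2 / 2, where sigma^2 is read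
    off from the Toeplitz operator with symbol f(2 a cos th + b). The Lipschitz bound extends this
    from polynomials to C^1 functions, and applied to all multiples of f it gives convergence in
    distribution. *)

Require Import Defs.
From Stdlib Require Import Reals Arith List Factorial Classical FunctionalExtensionality Psatz.
From Coquelicot Require Import Coquelicot.
From mathcomp Require all_boot all_order all_fingroup all_algebra Rstruct.
Open Scope R_scope.

(** * Finite sums *)

(** The variance is integrated twice over s, so it must be controlled under every deformed weight
    with s in [0, 1], and these are no longer Hahn weights. Three facts replace explicit formulas.
    The nodes are rescaled to [0, 1], which keeps the recurrence coefficients up to index N in
    [0, 1] for any positive weight. The Toda right-hand sides contain differences of two matrix
    entries on one diagonal; such differences vanish in the Toeplitz regime, so constant limits are
    stationary and the errors obey a linear inequality. Each equation sees only boundedly many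
    neighbours, so information near index n suffices. The Lipschitz bound needs no asymptotics: the
    double-sum form compares f with the coordinate function, whose variance is the single
    coefficient a_n. Weak convergence is deduced from generating functions at real arguments alone.
    The class of functions whose expectations converge starts with exponentials and is enlarged to
    products with x (difference quotients in the exponent), to products with sines (Taylor sums, the
    error absorbed by exponentials), and finally to all bounded continuous functions, which are
    close to polynomials in a sine of long period. *)

Fixpoint bsum (n : nat) (F : nat -> R) : R :=
  match n with O => 0 | S m => bsum m F + F m end.

Lemma bsum_ext n F G : (forall i, (i < n)%nat -> F i = G i) -> bsum n F = bsum n G.
Proof.
  induction n as [|n IH]; intros H; simpl; [reflexivity|].
  rewrite IH; [|intros i Hi; apply H; lia]. rewrite H; [reflexivity|lia].
Qed.

Lemma bsum_plus n F G : bsum n (fun i => F i + G i) = bsum n F + bsum n G.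
Proof. induction n as [|n IH]; simpl; [ring|rewrite IH; ring]. Qed.

Lemma bsum_minus n F G : bsum n (fun i => F i - G i) = bsum n F - bsum n G.
Proof. induction n as [|n IH]; simpl; [ring|rewrite IH; ring]. Qed.

Lemma bsum_scal n c F : bsum n (fun i => c * F i) = c * bsum n F.
Proof. induction n as [|n IH]; simpl; [ring|rewrite IH; ring]. Qed.

Lemma bsum_zero n F : (forall i, (i < n)%nat -> F i = 0) -> bsum n F = 0.
Proof.
  induction n as [|n IH]; intros H; simpl; [reflexivity|].
  rewrite IH; [|intros i Hi; apply H; lia]. rewrite H; [ring|lia].
Qed.

Lemma bsum_swap n m (F : nat -> nat -> R) :
  bsum n (fun i => bsum m (fun j => F i j)) = bsum m (fun j => bsum n (fun i => F i j)).
Proof.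
  induction n as [|n IH]; simpl.
  - symmetry; apply bsum_zero; reflexivity.
  - rewrite IH, <- bsum_plus. reflexivity.
Qed.

Lemma bsum_single n k F :
  (k < n)%nat -> (forall i, (i < n)%nat -> i <> k -> F i = 0) -> bsum n F = F k.
Proof.
  induction n as [|n IH]; intros Hk H; simpl; [lia|].
  destruct (Nat.eq_dec k n) as [->|Hne].
  - rewrite bsum_zero; [ring|]. intros i Hi; apply H; lia.
  - rewrite IH; [|lia|intros i Hi; apply H; lia]. rewrite (H n); [ring|lia|lia].
Qed.

Lemma bsum_le n F G : (forall i, (i < n)%nat -> F i <= G i) -> bsum n F <= bsum n G.
Proof.
  induction n as [|n IH]; intros H; simpl; [lra|].
  assert (bsum n F <= bsum n G) by (apply IH; intros i Hi; apply H; lia).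
  assert (F n <= G n) by (apply H; lia). lra.
Qed.

Lemma bsum_nonneg n F : (forall i, (i < n)%nat -> 0 <= F i) -> 0 <= bsum n F.
Proof.
  intros H. rewrite <- (bsum_zero n (fun _ => 0)) by reflexivity. now apply bsum_le.
Qed.

Lemma bsum_ge_term n F k :
  (forall i, (i < n)%nat -> 0 <= F i) -> (k < n)%nat -> F k <= bsum n F.
Proof.
  induction n as [|n IH]; intros H Hk; simpl; [lia|].
  destruct (Nat.eq_dec k n) as [->|Hne].
  - assert (0 <= bsum n F) by (apply bsum_nonneg; intros i Hi; apply H; lia). lra.
  - assert (F k <= bsum n F) by (apply IH; [intros i Hi; apply H; lia|lia]).
    assert (0 <= F n) by (apply H; lia). lra.
Qed.

Lemma bsum_Rabs n F : Rabs (bsum n F) <= bsum n (fun i => Rabs (F i)).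
Proof.
  induction n as [|n IH]; simpl; [rewrite Rabs_R0; lra|].
  eapply Rle_trans; [apply Rabs_triang|lra].
Qed.

Lemma bsum_const n c : bsum n (fun _ => c) = INR n * c.
Proof. induction n as [|n IH]; [simpl; ring|]. rewrite S_INR; simpl. rewrite IH; ring. Qed.

Lemma bsum_mult n m F G :
  bsum n F * bsum m G = bsum n (fun i => bsum m (fun j => F i * G j)).
Proof.
  symmetry. rewrite (bsum_ext n _ (fun i => bsum m G * F i)).
  - rewrite bsum_scal; ring.
  - intros i _. rewrite bsum_scal; ring.
Qed.

Lemma bsum_widen n m F :
  (n <= m)%nat -> (forall i, (n <= i < m)%nat -> F i = 0) -> bsum m F = bsum n F.
Proof.
  induction m as [|m IH]; intros Hnm H.
  - replace n with O by lia; reflexivity.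
  - destruct (Nat.eq_dec n (S m)) as [->|Hne]; [reflexivity|].
    simpl. rewrite H by lia. rewrite IH; [ring|lia|]. intros i Hi; apply H; lia.
Qed.

Lemma bsum_split n m F : bsum (n + m) F = bsum n F + bsum m (fun i => F (n + i)%nat).
Proof.
  induction m as [|m IH]; [rewrite Nat.add_0_r; simpl; ring|].
  rewrite Nat.add_succ_r; simpl. rewrite IH; ring.
Qed.

Lemma bsum_S_l n F : bsum (S n) F = F O + bsum n (fun i => F (S i)).
Proof. change (S n) with (1 + n)%nat. rewrite bsum_split; simpl; ring. Qed.

Lemma bsum_rev n F : bsum n F = bsum n (fun i => F (n - 1 - i)%nat).
Proof.
  induction n as [|n IH]; [reflexivity|].
  rewrite (bsum_S_l n (fun i => F (S n - 1 - i)%nat)). simpl bsum at 1. rewrite IH.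
  replace (S n - 1 - 0)%nat with n by lia. rewrite Rplus_comm. f_equal.
  apply bsum_ext; intros i Hi. f_equal; lia.
Qed.

Lemma is_derive_bsum n (F : nat -> R -> R) (dF : nat -> R) s :
  (forall i, (i < n)%nat -> is_derive (F i) s (dF i)) ->
  is_derive (fun u => bsum n (fun i => F i u)) s (bsum n dF).
Proof.
  induction n as [|n IH]; intros H; simpl.
  - apply @is_derive_const.
  - apply @is_derive_plus; [apply IH; intros i Hi; apply H; lia|apply H; lia].
Qed.

(** * Orthogonal polynomials on the nodes *)

Section OrthogonalPolynomials.

Variable N : nat.
Variable nd : nat -> R.

Definition ip (W u v : nat -> R) : R := bsum (S N) (fun i => W i * (u i * v i)).

(* Stieltjes' procedure: the pair (p_j, p_{j-1}), with p_{-1} = 0. *)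
Fixpoint stieltjes (W : nat -> R) (j : nat) : (nat -> R) * (nat -> R) :=
  match j with
  | O => (fun _ => 1, fun _ => 0)
  | S k =>
      let p := fst (stieltjes W k) in
      let q := snd (stieltjes W k) in
      (fun i => (nd i - ip W (fun i => nd i * p i) p / ip W p p) * p i
                - ip W p p / ip W q q * q i, p)
  end.
Definition op W j := fst (stieltjes W j).
Definition hn W j := ip W (op W j) (op W j).
Definition bc W j := ip W (fun i => nd i * op W j i) (op W j) / hn W j.
(** The value [0] at index 0 makes the three-term recurrence hold there too, with [pred 0 = 0]
    standing in for the missing index -1. *)
Definition ac W j := match j with O => 0 | S k => hn W (S k) / hn W k end.

Lemma hn_def W j : hn W j = ip W (op W j) (op W j).
Proof. reflexivity. Qed.

Lemma bc_def W j : bc W j = ip W (fun i => nd i * op W j i) (op W j) / hn W j.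
Proof. reflexivity. Qed.

Lemma op_S W j i :
  op W (S j) i = (nd i - bc W j) * op W j i - ac W j * op W (pred j) i.
Proof.
  destruct j as [|j].
  - unfold op, bc, ac, hn, op; simpl. ring.
  - reflexivity.
Qed.

Lemma nd_op W j i :
  nd i * op W j i = op W (S j) i + bc W j * op W j i + ac W j * op W (pred j) i.
Proof. rewrite op_S; ring. Qed.

Lemma ip_def W u v : ip W u v = bsum (S N) (fun i => W i * (u i * v i)).
Proof. reflexivity. Qed.

Lemma ip_sym W u v : ip W u v = ip W v u.
Proof. apply bsum_ext; intros i _; ring. Qed.

Lemma ip_ext W u u' v v' :
  (forall i, (i <= N)%nat -> u i = u' i) -> (forall i, (i <= N)%nat -> v i = v' i) ->
  ip W u v = ip W u' v'.
Proof. intros H1 H2; apply bsum_ext; intros i Hi; rewrite H1, H2 by lia; ring. Qed.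

Lemma ip_lin3 W u1 u2 u3 a1 a2 a3 v :
  ip W (fun i => a1 * u1 i + a2 * u2 i + a3 * u3 i) v
  = a1 * ip W u1 v + a2 * ip W u2 v + a3 * ip W u3 v.
Proof.
  unfold ip. rewrite <- !bsum_scal, <- !bsum_plus. apply bsum_ext; intros i _; ring.
Qed.

Lemma ip_bsum W n c (u : nat -> nat -> R) v :
  ip W (fun i => bsum n (fun k => c k * u k i)) v = bsum n (fun k => c k * ip W (u k) v).
Proof.
  unfold ip.
  rewrite (bsum_ext (S N) _ (fun i => bsum n (fun k => c k * (W i * (u k i * v i))))).
  - rewrite bsum_swap. apply bsum_ext; intros k _. now rewrite bsum_scal.
  - intros i _. rewrite (Rmult_comm _ (v i)), <- Rmult_assoc, <- bsum_scal.
    apply bsum_ext; intros k _; ring.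
Qed.

Lemma ip_nd W u v : ip W (fun i => nd i * u i) v = ip W u (fun i => nd i * v i).
Proof. apply bsum_ext; intros i _; ring. Qed.

Lemma ip_op_nd W j v :
  ip W (fun i => nd i * op W j i) v
  = ip W (op W (S j)) v + bc W j * ip W (op W j) v + ac W j * ip W (op W (pred j)) v.
Proof.
  rewrite <- (Rmult_1_l (ip W (op W (S j)) v)), <- ip_lin3.
  apply ip_ext; intros i _; [rewrite nd_op; ring|reflexivity].
Qed.

(** Iterated forward differences read the degree of a polynomial off its values on equally spaced
    nodes. They serve to show that [op W j] cannot vanish on all of 0, ..., N. *)
Fixpoint fd (m : nat) (u : nat -> R) (i : nat) : R :=
  match m with O => u i | S k => fd k u (S i) - fd k u i end.

Lemma fd_lin2 m u v a b i :
  fd m (fun i => a * u i + b * v i) i = a * fd m u i + b * fd m v i.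
Proof. revert i; induction m as [|m IH]; intros i; simpl; [ring|rewrite !IH; ring]. Qed.

Lemma fd_ext m u v : (forall i, u i = v i) -> forall i, fd m u i = fd m v i.
Proof. intros H; induction m as [|m IH]; intros i; simpl; [apply H|now rewrite !IH]. Qed.

Lemma fd_local m u i : (forall k, (i <= k <= i + m)%nat -> u k = 0) -> fd m u i = 0.
Proof.
  revert i; induction m as [|m IH]; intros i H; simpl; [apply H; lia|].
  rewrite !IH; [ring| |]; intros k Hk; apply H; lia.
Qed.

Variable c : R.
Hypothesis c_pos : 0 < c.
Hypothesis nd_lin : forall i, nd i = c * INR i.

(** Leibniz rule for differences; only two terms survive because the factor [nd] is linear and its
    second difference is zero. *)
Lemma fd_nd m u i :
  fd (S m) (fun i => nd i * u i) i = nd i * fd (S m) u i + INR (S m) * c * fd m u (S i).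
Proof.
  revert i; induction m as [|m IH]; intros i.
  - simpl. rewrite !nd_lin, S_INR. ring.
  - change (fd (S (S m)) (fun i => nd i * u i) i)
      with (fd (S m) (fun i => nd i * u i) (S i) - fd (S m) (fun i => nd i * u i) i).
    rewrite !IH. rewrite !nd_lin, !S_INR. simpl. ring.
Qed.

(** Expresses that p_j is monic of degree j in [nd i = c * i]: only the leading term survives j
    differences. Strong induction, since the recurrence reaches back two steps. *)
Lemma fd_op W j :
  (forall m i, (j < m)%nat -> fd m (op W j) i = 0) /\
  (forall i, fd j (op W j) i = c ^ j * INR (fact j)).
Proof.
  induction j as [j IH] using (well_founded_induction lt_wf).
  destruct j as [|j].
  - split.
    + intros m i Hm. destruct m as [|m]; [lia|]. revert i. clear Hm.
      induction m as [|m IHm]; intros i; [unfold op; simpl; ring|].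
      change (fd (S (S m)) (op W 0) i) with (fd (S m) (op W 0) (S i) - fd (S m) (op W 0) i).
      rewrite !IHm; ring.
    + intros i; unfold op; simpl; ring.
  - assert (E : forall m i, fd (S m) (op W (S j)) i
        = nd i * fd (S m) (op W j) i + INR (S m) * c * fd m (op W j) (S i)
          - bc W j * fd (S m) (op W j) i - ac W j * fd (S m) (op W (pred j)) i).
    { intros m i.
      rewrite (fd_ext _ (op W (S j)) (fun i => 1 * (1 * (nd i * op W j i) + - bc W j * op W j i)
                                        + - ac W j * op W (pred j) i)).
      - rewrite fd_lin2, fd_lin2, fd_nd. ring.
      - intros k. rewrite op_S; ring. }
    destruct (IH j) as [H1 H2]; [lia|].
    destruct (IH (pred j)) as [H3 _]; [lia|].
    split.
    + intros m i Hm. destruct m as [|m]; [lia|].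
      rewrite E, !H1, H3 by lia. ring.
    + intros i. rewrite E, H2, H1, H3 by lia. rewrite fact_simpl, mult_INR. simpl (c ^ S j). ring.
Qed.

Section PositiveWeight.

Variable W : nat -> R.
Hypothesis W_pos : forall i, (i <= N)%nat -> 0 < W i.

Lemma ip_pos u k : (k <= N)%nat -> u k <> 0 -> 0 < ip W u u.
Proof.
  intros Hk Hu. apply Rlt_le_trans with (W k * (u k * u k)).
  - apply Rmult_lt_0_compat; [now apply W_pos|]. apply Rlt_0_sqr, Hu.
  - apply (bsum_ge_term (S N) (fun i => W i * (u i * u i))); [|lia].
    intros i Hi. apply Rmult_le_pos; [left; apply W_pos; lia|apply Rle_0_sqr].
Qed.

(** If p_j vanished on all nodes, so would its j-th difference at 0, which uses the nodes 0, ..., j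
    only; but that difference is [c ^ j * INR (fact j)]. *)
Lemma hn_pos j : (j <= N)%nat -> 0 < hn W j.
Proof.
  intros Hj.
  destruct (classic (exists k, (k <= N)%nat /\ op W j k <> 0)) as [[k [Hk Hu]]|Hno].
  - now apply ip_pos with k.
  - exfalso. destruct (fd_op W j) as [_ H]. specialize (H O).
    rewrite fd_local in H.
    + assert (0 < c ^ j * INR (fact j)); [|lra].
      apply Rmult_lt_0_compat; [now apply pow_lt|apply INR_fact_lt_0].
    + intros k Hk. destruct (Req_dec (op W j k) 0) as [E|E]; [exact E|].
      exfalso; apply Hno; exists k; split; [lia|exact E].
Qed.

(** In the step to j + 1, the case k = j is the choice of [bc], k = j - 1 is the choice of [ac], and
    for smaller k the factor [nd] is moved onto p_k, whose degree stays below j. The index may reach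
    [S N] since only norms of index at most N are divided by. *)
Lemma op_orth_lt j k : (k < j)%nat -> (j <= S N)%nat -> ip W (op W j) (op W k) = 0.
Proof.
  revert k. induction j as [j IH] using (well_founded_induction lt_wf).
  intros k Hk Hj. destruct j as [|j]; [lia|].
  assert (hj : 0 < hn W j) by (apply hn_pos; lia).
  assert (E : ip W (op W (S j)) (op W k) = ip W (fun i => nd i * op W j i) (op W k)
     - bc W j * ip W (op W j) (op W k) - ac W j * ip W (op W (pred j)) (op W k))
    by (rewrite ip_op_nd; ring).
  rewrite E. clear E.
  destruct (Nat.eq_dec k j) as [->|Hkj].
  - unfold bc at 1. fold (hn W j).
    destruct j as [|j].
    + simpl ac. field. lra.
    + simpl pred. rewrite (ip_sym W (op W j)), (IH (S j)) by lia. field. lra.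
  - rewrite ip_nd, ip_sym, ip_op_nd.
    assert (O1 : ip W (op W j) (op W k) = 0) by (apply IH; lia).
    assert (O2 : ip W (op W k) (op W j) = 0) by (rewrite ip_sym; exact O1).
    assert (O3 : ip W (op W (pred k)) (op W j) = 0) by (rewrite ip_sym; apply IH; lia).
    rewrite O1, O2, O3.
    destruct j as [|j]; [lia|]. simpl pred. simpl ac.
    destruct (Nat.eq_dec k j) as [->|Hkj'].
    + fold (hn W (S j)). fold (hn W j). field.
      apply Rgt_not_eq, hn_pos; lia.
    + rewrite (ip_sym W (op W (S k))), (IH (S j)), (IH j) by lia. ring.
Qed.

Lemma op_orth j k : j <> k -> (j <= S N)%nat -> (k <= S N)%nat -> ip W (op W j) (op W k) = 0.
Proof.
  intros Hjk Hj Hk. destruct (Nat.lt_ge_cases k j) as [H|H].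
  - now apply op_orth_lt.
  - rewrite ip_sym; apply op_orth_lt; lia.
Qed.

Lemma ac_pos j : (0 < j <= N)%nat -> 0 < ac W j.
Proof.
  intros Hj. destruct j as [|j]; [lia|]. simpl.
  apply Rdiv_lt_0_compat; apply hn_pos; lia.
Qed.

End PositiveWeight.

End OrthogonalPolynomials.

(** * Exponential deformation of the weight *)

(** Passes from the increments [vinc], organised by the larger index, to the full square in
    [varK_sum]. *)
Lemma bsum_triangle n (S : nat -> nat -> R) :
  (forall j k, S j k = S k j) ->
  bsum n (fun j => 2 * bsum j (S j) + S j j) = bsum n (fun j => bsum n (S j)).
Proof.
  intros HS. induction n as [|n IH]; [reflexivity|].
  simpl. rewrite IH, bsum_plus.
  replace (bsum n (S n)) with (bsum n (fun j => S j n)); [ring|].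
  apply bsum_ext; intros j _; apply HS.
Qed.

Lemma is_derive_recurrence (x s : R) (b p a q : R -> R) :
  ex_derive b s -> ex_derive p s -> ex_derive a s -> ex_derive q s ->
  is_derive (fun s => (x - b s) * p s - a s * q s) s
    ((x - b s) * Derive p s - Derive b s * p s - a s * Derive q s - Derive a s * q s).
Proof.
  intros; auto_derive; [repeat split; auto|].
  change (Derive (fun u => b u)) with (Derive b). change (Derive (fun u => p u)) with (Derive p).
  change (Derive (fun u => a u)) with (Derive a). change (Derive (fun u => q u)) with (Derive q).
  ring.
Qed.

Section Deformation.

Variable N : nat.
Variable nd : nat -> R.
Variable c : R.
Hypothesis c_pos : 0 < c.
Hypothesis nd_lin : forall i, nd i = c * INR i.

Notation ip := (ip N).
Notation op := (op N nd).
Notation hn := (hn N nd).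
Notation bc := (bc N nd).
Notation ac := (ac N nd).

(** The polynomials of degree below j, given by expansions in p_0, ..., p_{j-1} so that coefficients
    are extracted by orthogonality. *)
Definition inspan (W : nat -> R) (j : nat) (u : nat -> R) : Prop :=
  exists a : nat -> R, forall i, u i = bsum j (fun k => a k * op W k i).

Lemma inspan_lin W j u v a b :
  inspan W j u -> inspan W j v -> inspan W j (fun i => a * u i + b * v i).
Proof.
  intros [x Hx] [y Hy]. exists (fun k => a * x k + b * y k). intros i.
  rewrite Hx, Hy, <- !bsum_scal, <- bsum_plus. apply bsum_ext; intros k _; ring.
Qed.

Lemma inspan_ext W j u v : (forall i, u i = v i) -> inspan W j u -> inspan W j v.
Proof. intros H [x Hx]; exists x; intros i; now rewrite <- H. Qed.

Lemma inspan_op W j k : (k < j)%nat -> inspan W j (op W k).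
Proof.
  intros Hk. exists (fun i => if Nat.eqb i k then 1 else 0). intros i.
  rewrite (bsum_single j k); [rewrite Nat.eqb_refl; ring|exact Hk|].
  intros m _ Hm. apply Nat.eqb_neq in Hm. rewrite Hm; ring.
Qed.

Lemma inspan_widen W j k u : (j <= k)%nat -> inspan W j u -> inspan W k u.
Proof.
  intros Hjk [x Hx]. exists (fun i => if Nat.ltb i j then x i else 0). intros i.
  rewrite Hx, (bsum_widen j k).
  - apply bsum_ext; intros m Hm. apply Nat.ltb_lt in Hm. now rewrite Hm.
  - exact Hjk.
  - intros m [Hm _]. apply Nat.ltb_ge in Hm. rewrite Hm; ring.
Qed.

Lemma inspan_zero W j : inspan W j (fun _ => 0).
Proof. exists (fun _ => 0). intros i. symmetry; apply bsum_zero; intros; ring. Qed.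

Lemma inspan_bsum W j m (a : nat -> R) (u : nat -> nat -> R) :
  (forall k, (k < m)%nat -> inspan W j (u k)) ->
  inspan W j (fun i => bsum m (fun k => a k * u k i)).
Proof.
  induction m as [|m IH]; intros H; [apply inspan_zero|].
  apply inspan_ext with (fun i => 1 * bsum m (fun k => a k * u k i) + a m * u m i).
  - intros i; simpl; ring.
  - apply inspan_lin; [apply IH; intros k Hk; apply H; lia|apply H; lia].
Qed.

Lemma inspan_nd W j u : inspan W j u -> inspan W (S j) (fun i => nd i * u i).
Proof.
  intros [x Hx].
  apply inspan_ext with (fun i => bsum j (fun k => x k * (nd i * op W k i))).
  - intros i. rewrite Hx, <- bsum_scal. apply bsum_ext; intros k _; ring.
  - apply (inspan_bsum W (S j) j x (fun k i => nd i * op W k i)). intros k Hk.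
    apply inspan_ext with (fun i => 1 * (1 * op W (S k) i + bc W k * op W k i)
                                    + ac W k * op W (pred k) i).
    + intros i. rewrite nd_op; ring.
    + apply inspan_lin; [apply inspan_lin|]; apply inspan_op; lia.
Qed.

Lemma ip_inspan W j u k :
  (forall i, (i <= N)%nat -> 0 < W i) ->
  inspan W j u -> (j <= k <= S N)%nat -> ip W u (op W k) = 0.
Proof.
  intros HW [x Hx] Hk.
  rewrite (ip_ext N W u (fun i => bsum j (fun m => x m * op W m i)) (op W k) (op W k)); auto.
  rewrite ip_bsum. apply bsum_zero; intros m Hm.
  rewrite (op_orth N nd c c_pos nd_lin W HW m k) by lia. ring.
Qed.

Lemma inspan_coeff W j u :
  (forall i, (i <= N)%nat -> 0 < W i) -> (j <= S N)%nat ->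
  inspan W j u ->
  forall i, u i = bsum j (fun k => ip W u (op W k) / hn W k * op W k i).
Proof.
  intros HW Hj [x Hx] i. rewrite Hx. apply bsum_ext; intros k Hk. f_equal.
  rewrite (ip_ext N W u (fun i => bsum j (fun m => x m * op W m i)) (op W k) (op W k)); auto.
  rewrite ip_bsum, (bsum_single j k).
  - fold (hn W k). field. apply Rgt_not_eq, (hn_pos N nd c c_pos nd_lin W HW). lia.
  - exact Hk.
  - intros m Hm Hmk. rewrite (op_orth N nd c c_pos nd_lin W HW m k) by lia. ring.
Qed.

Definition phi (g W : nat -> R) j k := ip W (fun i => g i * op W j i) (op W k).
(** With P_n the orthogonal projection onto degrees below n, the trace of [P_n g^2 - P_n g P_n g]
    grows by this amount from n = j to n = j + 1. The factor 2 counts (j, k) and (k, j). *)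
Definition vinc (g W : nat -> R) j :=
  phi (fun i => g i * g i) W j j / hn W j
  - (2 * bsum j (fun k => phi g W j k ^ 2 / (hn W j * hn W k)) + phi g W j j ^ 2 / (hn W j * hn W j)).
(* The variance of the linear statistic of g in the ensemble of size n with weight W. *)
Definition varK (g W : nat -> R) n := bsum n (vinc g W).

Lemma phi_ip g W j k : phi g W j k = ip W (fun i => g i * op W j i) (op W k).
Proof. reflexivity. Qed.

Lemma phi_def g W j k : phi g W j k = bsum (S N) (fun i => W i * (g i * op W j i * op W k i)).
Proof. reflexivity. Qed.

Lemma phi_sym g W j k : phi g W j k = phi g W k j.
Proof. apply bsum_ext; intros i _; ring. Qed.

Variable w : nat -> R.
Hypothesis w_pos : forall i, (i <= N)%nat -> 0 < w i.
Variable f : nat -> R.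

Definition Wd (s : R) (i : nat) : R := w i * exp (s * f i).

Lemma Wd_pos s i : (i <= N)%nat -> 0 < Wd s i.
Proof. intros Hi. apply Rmult_lt_0_compat; [now apply w_pos|apply exp_pos]. Qed.

Lemma hn_Wd_pos s j : (j <= N)%nat -> 0 < hn (Wd s) j.
Proof. apply (hn_pos N nd c c_pos nd_lin (Wd s)). apply Wd_pos. Qed.

(** The derivative of the weight [w i * exp (s * f i)] is f times the weight, hence the first of the
    three terms. *)
Lemma is_derive_ip (u v : R -> nat -> R) (du dv : nat -> R) s :
  (forall i, is_derive (fun s => u s i) s (du i)) ->
  (forall i, is_derive (fun s => v s i) s (dv i)) ->
  is_derive (fun s => ip (Wd s) (u s) (v s)) s
    (ip (Wd s) (fun i => f i * u s i) (v s) + ip (Wd s) du (v s) + ip (Wd s) (u s) dv).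
Proof.
  intros Hu Hv.
  apply is_derive_ext with (fun s => bsum (S N) (fun i => Wd s i * (u s i * v s i)));
    [reflexivity|].
  rewrite !ip_def, <- !bsum_plus.
  apply (is_derive_bsum (S N) (fun i s => Wd s i * (u s i * v s i))).
  intros i Hi. unfold Wd.
  evar_last.
  - apply @is_derive_mult; [|apply @is_derive_mult; [apply Hu|apply Hv|intros; apply Rmult_comm]
                            |intros; apply Rmult_comm].
    apply (is_derive_scal (fun s => exp (s * f i))).
    apply (is_derive_comp exp (fun s => s * f i)); [apply is_derive_exp|].
    apply (is_derive_mult (fun s => s) (fun _ => f i)); [apply @is_derive_id|apply @is_derive_const|].
    intros; apply Rmult_comm.
  - unfold plus, mult, scal, zero, one; simpl. unfold mult; simpl. ring.
Qed.

Lemma ex_derive_ip (u v : R -> nat -> R) s :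
  (forall i, ex_derive (fun s => u s i) s) ->
  (forall i, ex_derive (fun s => v s i) s) ->
  ex_derive (fun s => ip (Wd s) (u s) (v s)) s.
Proof.
  intros Hu Hv. eexists.
  apply (is_derive_ip u v (fun i => Derive (fun s => u s i) s) (fun i => Derive (fun s => v s i) s));
  intros i; apply Derive_correct; auto.
Qed.

Lemma ex_derive_hn j s :
  (forall i, ex_derive (fun s => op (Wd s) j i) s) -> ex_derive (fun s => hn (Wd s) j) s.
Proof. intros H. apply (ex_derive_ip (fun s => op (Wd s) j) (fun s => op (Wd s) j)); auto. Qed.

Lemma ex_derive_bc j s : (j <= N)%nat ->
  (forall i, ex_derive (fun s => op (Wd s) j i) s) -> ex_derive (fun s => bc (Wd s) j) s.
Proof.
  intros Hj H. apply ex_derive_div.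
  - apply (ex_derive_ip (fun s i => nd i * op (Wd s) j i) (fun s => op (Wd s) j)); [|auto].
    intros i. apply ex_derive_scal, H.
  - now apply ex_derive_hn.
  - apply Rgt_not_eq, hn_Wd_pos, Hj.
Qed.

Lemma ex_derive_ac j s : (j <= N)%nat ->
  (forall i, ex_derive (fun s => op (Wd s) j i) s) ->
  (forall i, ex_derive (fun s => op (Wd s) (pred j) i) s) ->
  ex_derive (fun s => ac (Wd s) j) s.
Proof.
  intros Hj H H'. destruct j as [|j]; [exact (ex_derive_const 0 s)|].
  apply ex_derive_div; [now apply ex_derive_hn|now apply ex_derive_hn|].
  apply Rgt_not_eq, hn_Wd_pos; lia.
Qed.

(** The recurrence coefficients are quotients of inner products of polynomials already treated, with
    nonzero denominators, so differentiability climbs the recurrence. *)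
Lemma ex_derive_op j s i : (j <= S N)%nat -> ex_derive (fun s => op (Wd s) j i) s.
Proof.
  revert i. induction j as [j IH] using (well_founded_induction lt_wf). intros i Hj.
  destruct j as [|j]; [exact (ex_derive_const 1 s)|].
  apply ex_derive_ext with (fun s => (nd i - bc (Wd s) j) * op (Wd s) j i
                                     - ac (Wd s) j * op (Wd s) (pred j) i).
  - intros u. now rewrite op_S.
  - assert (H1 : forall i, ex_derive (fun s => op (Wd s) j i) s) by (intros; apply IH; lia).
    assert (H2 : forall i, ex_derive (fun s => op (Wd s) (pred j) i) s) by (intros; apply IH; lia).
    apply @ex_derive_minus; apply @ex_derive_mult; auto.
    + apply @ex_derive_minus; [apply ex_derive_const|apply ex_derive_bc; [lia|auto]].
    + apply ex_derive_ac; auto; lia.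
Qed.

Definition dop s j i := Derive (fun s => op (Wd s) j i) s.

Lemma is_derive_op s j i : (j <= S N)%nat -> is_derive (fun s => op (Wd s) j i) s (dop s j i).
Proof. intros Hj. now apply Derive_correct, ex_derive_op. Qed.

(** p_j is monic for every s, so its s-derivative loses the leading term. The proof differentiates
    the recurrence and counts degrees. *)
Lemma dop_inspan s j : (j <= S N)%nat -> inspan (Wd s) j (dop s j).
Proof.
  induction j as [j IH] using (well_founded_induction lt_wf). intros Hj.
  destruct j as [|j].
  - apply inspan_ext with (fun _ => 0); [|apply inspan_zero].
    intros i. unfold dop. symmetry. exact (Derive_const 1 s).
  - apply inspan_ext with (fun i =>
      1 * (1 * (nd i * dop s j i) + - bc (Wd s) j * dop s j i)
      + 1 * (1 * (- ac (Wd s) j * dop s (pred j) i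
                  + - Derive (fun s => bc (Wd s) j) s * op (Wd s) j i)
             + - Derive (fun s => ac (Wd s) j) s * op (Wd s) (pred j) i)).
    + intros i. symmetry. apply is_derive_unique.
      apply is_derive_ext with (fun s => (nd i - bc (Wd s) j) * op (Wd s) j i
                                     - ac (Wd s) j * op (Wd s) (pred j) i).
      { intros u. now rewrite op_S. }
      assert (H1 : forall i, ex_derive (fun s => op (Wd s) j i) s)
        by (intros; apply ex_derive_op; lia).
      assert (H2 : forall i, ex_derive (fun s => op (Wd s) (pred j) i) s)
        by (intros; apply ex_derive_op; lia).
      assert (H3 : ex_derive (fun s => bc (Wd s) j) s) by (apply ex_derive_bc; [lia|auto]).
      assert (H4 : ex_derive (fun s => ac (Wd s) j) s) by (apply ex_derive_ac; [lia|auto|auto]).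
      evar_last; [apply is_derive_recurrence; [exact H3|apply H1|exact H4|apply H2]|].
      unfold dop. change (AbsRing.sort R_AbsRing) with R. ring.
    + assert (D1 : inspan (Wd s) (S j) (dop s j))
        by (apply inspan_widen with j; [lia|apply IH; lia]).
      apply inspan_lin; apply inspan_lin.
      * apply inspan_nd, IH; lia.
      * exact D1.
      * apply inspan_lin; [|apply inspan_op; lia].
        apply inspan_widen with (pred j); [lia|apply IH; lia].
      * apply inspan_op; lia.
Qed.

Lemma ip_dop_ge s j k : (j <= k)%nat -> (k <= S N)%nat -> ip (Wd s) (dop s j) (op (Wd s) k) = 0.
Proof.
  intros H1 H2. apply ip_inspan with j; [apply Wd_pos| |lia].
  apply dop_inspan; lia.
Qed.

(** Differentiates the relation [<p_j, p_k> = 0] in s: the weight yields [phi f], while the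
    derivative of p_k has degree below k < j and drops out. *)
Lemma ip_dop_lt s j k : (k < j)%nat -> (j <= S N)%nat ->
  ip (Wd s) (dop s j) (op (Wd s) k) = - phi f (Wd s) j k.
Proof.
  intros Hk Hj.
  assert (Hk' : (k <= S N)%nat) by lia.
  assert (D := is_derive_ip (fun s => op (Wd s) j) (fun s => op (Wd s) k) (dop s j) (dop s k) s
                 (fun i => is_derive_op s j i Hj) (fun i => is_derive_op s k i Hk')).
  apply is_derive_unique in D.
  rewrite (Derive_ext _ (fun _ => 0)), Derive_const in D.
  - rewrite (ip_sym N _ (op (Wd s) j) (dop s k)), (ip_dop_ge s k j) in D by lia.
    fold (phi f (Wd s) j k) in D. lra.
  - intros u. apply (op_orth N nd c c_pos nd_lin); [apply Wd_pos|lia|lia|lia].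
Qed.

Lemma dop_eq s j i : (j <= S N)%nat ->
  dop s j i = bsum j (fun k => - (phi f (Wd s) j k / hn (Wd s) k) * op (Wd s) k i).
Proof.
  intros Hj.
  rewrite (inspan_coeff (Wd s) j (dop s j) (Wd_pos s) Hj (dop_inspan s j Hj)).
  apply bsum_ext; intros k Hk. rewrite ip_dop_lt by lia. unfold Rdiv; ring.
Qed.

Lemma ip_dop s j v : (j <= S N)%nat ->
  ip (Wd s) (dop s j) v
  = - bsum j (fun k => phi f (Wd s) j k / hn (Wd s) k * ip (Wd s) (op (Wd s) k) v).
Proof.
  intros Hj.
  rewrite (ip_ext N _ (dop s j)
    (fun i => bsum j (fun k => - (phi f (Wd s) j k / hn (Wd s) k) * op (Wd s) k i)) v v); auto.
  - rewrite ip_bsum. replace (- bsum j _) with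
      (-1 * bsum j (fun k => phi f (Wd s) j k / hn (Wd s) k * ip (Wd s) (op (Wd s) k) v)) by ring.
    rewrite <- bsum_scal. apply bsum_ext; intros; ring.
  - intros; now apply dop_eq.
Qed.

(** Only the weight contributes: the derivative of p_j has degree below j, hence is orthogonal to
    p_j. *)
Lemma is_derive_hn j s : (j <= N)%nat ->
  is_derive (fun s => hn (Wd s) j) s (phi f (Wd s) j j).
Proof.
  intros Hj.
  evar_last; [apply (is_derive_ip (fun s => op (Wd s) j) (fun s => op (Wd s) j) (dop s j) (dop s j));
              intros i; apply is_derive_op; lia|].
  rewrite (ip_sym N _ (op (Wd s) j) (dop s j)), ip_dop_ge by lia.
  unfold phi; ring.
Qed.

Lemma is_derive_phi_diag j s : (j <= N)%nat ->
  is_derive (fun s => phi f (Wd s) j j) s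
    (phi (fun i => f i * f i) (Wd s) j j
     - 2 * bsum j (fun k => phi f (Wd s) j k ^ 2 / hn (Wd s) k)).
Proof.
  intros Hj.
  evar_last.
  - apply (is_derive_ip (fun s i => f i * op (Wd s) j i) (fun s => op (Wd s) j)
             (fun i => f i * dop s j i) (dop s j)).
    + intros i. apply @is_derive_scal, is_derive_op; lia.
    + intros i; apply is_derive_op; lia.
  - assert (E : ip (Wd s) (fun i => f i * op (Wd s) j i) (dop s j)
                = - bsum j (fun k => phi f (Wd s) j k ^ 2 / hn (Wd s) k)).
    { rewrite ip_sym, ip_dop by lia. f_equal. apply bsum_ext; intros k _.
      rewrite ip_sym. fold (phi f (Wd s) j k). unfold Rdiv; ring. }
    replace (ip (Wd s) (fun i => f i * dop s j i) (op (Wd s) j))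
      with (ip (Wd s) (fun i => f i * op (Wd s) j i) (dop s j))
      by (apply bsum_ext; intros; ring).
    rewrite E.
    replace (phi (fun i => f i * f i) (Wd s) j j)
      with (ip (Wd s) (fun i => f i * (f i * op (Wd s) j i)) (op (Wd s) j))
      by (apply bsum_ext; intros; ring).
    ring.
Qed.

Lemma is_derive_ln_hn j s : (j <= N)%nat ->
  is_derive (fun s => ln (hn (Wd s) j)) s (phi f (Wd s) j j / hn (Wd s) j).
Proof.
  intros Hj. assert (H := hn_Wd_pos s j Hj).
  evar_last.
  - apply (is_derive_comp ln (fun s => hn (Wd s) j)); [|apply is_derive_hn, Hj].
    apply is_derive_ln, H.
  - unfold scal; simpl; unfold mult; simpl. field. lra.
Qed.

(** Summed over j < n, this identifies the second derivative of the logarithmic partition function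
    with [varK]. *)
Lemma is_derive_ln_hn2 j s : (j <= N)%nat ->
  is_derive (fun s => phi f (Wd s) j j / hn (Wd s) j) s (vinc f (Wd s) j).
Proof.
  intros Hj. assert (H := hn_Wd_pos s j Hj).
  evar_last.
  - apply is_derive_div; [apply is_derive_phi_diag, Hj|apply is_derive_hn, Hj|lra].
  - unfold vinc.
    replace (bsum j (fun k => phi f (Wd s) j k ^ 2 / (hn (Wd s) j * hn (Wd s) k)))
      with (/ hn (Wd s) j * bsum j (fun k => phi f (Wd s) j k ^ 2 / hn (Wd s) k)).
    + field. lra.
    + rewrite <- bsum_scal. apply bsum_ext; intros k Hk.
      field. split; [apply Rgt_not_eq, hn_Wd_pos; lia|lra].
Qed.

(** Toda equation. When f is the coordinate, [phi f W j j / hn W j] is [bc W j] and the right side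
    is a_{j+1} (b_{j+1} - b_j). *)
Lemma is_derive_ac j s : (S j <= N)%nat ->
  is_derive (fun s => ac (Wd s) (S j)) s
    (ac (Wd s) (S j) * (phi f (Wd s) (S j) (S j) / hn (Wd s) (S j)
                        - phi f (Wd s) j j / hn (Wd s) j)).
Proof.
  intros Hj. assert (H := hn_Wd_pos s j ltac:(lia)). assert (H' := hn_Wd_pos s (S j) Hj).
  evar_last.
  - unfold ac. apply is_derive_div; [apply is_derive_hn, Hj|apply is_derive_hn; lia|lra].
  - simpl. field. lra.
Qed.

(** The companion Toda equation; when f is the coordinate it reads b_{j+1}' = a_{j+2} - a_{j+1}. *)
Lemma is_derive_bc j s : (S j <= N)%nat ->
  is_derive (fun s => bc (Wd s) (S j)) s
    (phi f (Wd s) (S (S j)) (S j) / hn (Wd s) (S j) - phi f (Wd s) (S j) j / hn (Wd s) j).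
Proof.
  intros Hj. assert (H := hn_Wd_pos s j ltac:(lia)). assert (H' := hn_Wd_pos s (S j) Hj).
  evar_last.
  - unfold bc. apply is_derive_div; [|apply is_derive_hn, Hj|lra].
    apply (is_derive_ip (fun s i => nd i * op (Wd s) (S j) i) (fun s => op (Wd s) (S j))
             (fun i => nd i * dop s (S j) i) (dop s (S j))).
    + intros i. apply @is_derive_scal, is_derive_op; lia.
    + intros i; apply is_derive_op; lia.
  (* The derivative of p_{j+1} is expanded over p_k with k <= j. Only k = j pairs with
     [nd * p_{j+1}], because for k < j the product [nd * p_k] still has degree below j + 1. *)
  - assert (E : ip (Wd s) (fun i => nd i * op (Wd s) (S j) i) (dop s (S j))
                = - (phi f (Wd s) (S j) j / hn (Wd s) j * hn (Wd s) (S j))).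
    { rewrite ip_sym, ip_dop by lia. f_equal.
      assert (A : forall k, ip (Wd s) (op (Wd s) k) (fun i => nd i * op (Wd s) (S j) i)
         = ip (Wd s) (op (Wd s) (S k)) (op (Wd s) (S j))
           + bc (Wd s) k * ip (Wd s) (op (Wd s) k) (op (Wd s) (S j))
           + ac (Wd s) k * ip (Wd s) (op (Wd s) (pred k)) (op (Wd s) (S j))).
      { intros k. rewrite <- ip_nd. apply ip_op_nd. }
      assert (O : forall k, (k < S j)%nat -> ip (Wd s) (op (Wd s) k) (op (Wd s) (S j)) = 0).
      { intros k Hk. apply (op_orth N nd c c_pos nd_lin); [apply Wd_pos|lia|lia|lia]. }
      rewrite (bsum_single (S j) j).
      - rewrite A, (O j), (O (pred j)) by lia. fold (hn (Wd s) (S j)). ring.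
      - lia.
      - intros k Hk Hkj. rewrite A, (O k), (O (pred k)), (O (S k)) by lia. ring. }
    replace (ip (Wd s) (fun i => nd i * dop s (S j) i) (op (Wd s) (S j)))
      with (ip (Wd s) (fun i => nd i * op (Wd s) (S j) i) (dop s (S j)))
      by (apply bsum_ext; intros; ring).
    rewrite E.
    replace (ip (Wd s) (fun i => f i * (nd i * op (Wd s) (S j) i)) (op (Wd s) (S j)))
      with (ip (Wd s) (fun i => nd i * op (Wd s) (S j) i) (fun i => f i * op (Wd s) (S j) i))
      by (apply bsum_ext; intros; ring).
    rewrite ip_op_nd. simpl pred.
    rewrite !(ip_sym N (Wd s) _ (fun i => f i * op (Wd s) (S j) i)).
    fold (phi f (Wd s) (S j) (S (S j))) (phi f (Wd s) (S j) (S j)) (phi f (Wd s) (S j) j).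
    rewrite (phi_sym f (Wd s) (S (S j)) (S j)).
    unfold bc. simpl ac. field. lra.
Qed.

End Deformation.

(** * The variance functional *)

Lemma bsum_swap4 n m p q (T : nat -> nat -> nat -> nat -> R) :
  bsum n (fun x => bsum m (fun y => bsum p (fun j => bsum q (fun k => T x y j k))))
  = bsum p (fun j => bsum q (fun k => bsum n (fun x => bsum m (fun y => T x y j k)))).
Proof.
  rewrite (bsum_ext n _ (fun x => bsum p (fun j => bsum m (fun y => bsum q (fun k => T x y j k)))))
    by (intros; apply bsum_swap).
  rewrite bsum_swap. apply bsum_ext; intros j _.
  rewrite (bsum_ext n _ (fun x => bsum q (fun k => bsum m (fun y => T x y j k))))
    by (intros; apply bsum_swap).
  apply bsum_swap.
Qed.

Section Variance.

Variable N : nat.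
Variable nd : nat -> R.
Variable c : R.
Hypothesis c_pos : 0 < c.
Hypothesis nd_lin : forall i, nd i = c * INR i.
Variable W : nat -> R.
Hypothesis W_pos : forall i, (i <= N)%nat -> 0 < W i.

Notation ip := (ip N).
Notation op := (op N nd).
Notation hn := (hn N nd).
Notation bc := (bc N nd).
Notation ac := (ac N nd).
Notation phi := (phi N nd).
Notation varK := (varK N nd).

Lemma hn_W_pos j : (j <= N)%nat -> 0 < hn W j.
Proof. exact (hn_pos N nd c c_pos nd_lin W W_pos j). Qed.

Definition ker n x y := bsum n (fun j => op W j x * op W j y / hn W j).

(** Squaring the kernel separates x from y, so each pair (j, k) contributes a product of two matrix
    elements. *)
Lemma ker_quad n (A B : nat -> R) :
  bsum (S N) (fun x => bsum (S N) (fun y => A x * B y * ker n x y ^ 2 * W x * W y))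
  = bsum n (fun j => bsum n (fun k => phi A W j k * phi B W j k / (hn W j * hn W k))).
Proof.
  rewrite (bsum_ext (S N) _ (fun x => bsum (S N) (fun y => bsum n (fun j => bsum n (fun k =>
     (W x * (A x * op W j x * op W k x)) * (W y * (B y * op W j y * op W k y))
     * (/ hn W j * / hn W k)))))).
  - rewrite bsum_swap4. apply bsum_ext; intros j _. apply bsum_ext; intros k _.
    unfold Rdiv. rewrite Rinv_mult.
    rewrite (Rmult_comm (phi A W j k * phi B W j k)). rewrite !phi_def, bsum_mult, <- bsum_scal.
    apply bsum_ext; intros x _. rewrite <- bsum_scal.
    apply bsum_ext; intros y _. ring.
  - intros x _. apply bsum_ext; intros y _.
    replace (A x * B y * ker n x y ^ 2 * W x * W y)
      with ((A x * B y * W x * W y) * (ker n x y * ker n x y)) by ring.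
    unfold ker. rewrite bsum_mult, <- bsum_scal.
    apply bsum_ext; intros j _. rewrite <- bsum_scal. apply bsum_ext; intros k _.
    unfold Rdiv. ring.
Qed.

Lemma varK_sum g n :
  varK g W n = bsum n (fun j => phi (fun i => g i * g i) W j j / hn W j)
               - bsum n (fun j => bsum n (fun k => phi g W j k ^ 2 / (hn W j * hn W k))).
Proof.
  rewrite <- (bsum_triangle n (fun j k => phi g W j k ^ 2 / (hn W j * hn W k))).
  - rewrite <- bsum_minus. reflexivity.
  - intros j k. rewrite phi_sym, (Rmult_comm (hn W j)). reflexivity.
Qed.

(** On expanding [(g x - g y) ^ 2], each square gives the trace of g^2, because the constant
    function has a diagonal matrix, and the cross term is the double sum of [varK_sum]. In this form
    the variance is visibly nonnegative and monotone in the increments of g. *)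
Lemma varK_double g n : (n <= S N)%nat ->
  varK g W n = / 2 * bsum (S N) (fun x => bsum (S N) (fun y =>
                 (g x - g y) ^ 2 * ker n x y ^ 2 * W x * W y)).
Proof.
  intros Hn.
  rewrite (bsum_ext (S N) _ (fun x =>
      bsum (S N) (fun y => (g x * g x) * 1 * ker n x y ^ 2 * W x * W y)
      + bsum (S N) (fun y => 1 * (g y * g y) * ker n x y ^ 2 * W x * W y)
      - 2 * bsum (S N) (fun y => g x * g y * ker n x y ^ 2 * W x * W y))).
  2:{ intros x _. rewrite <- bsum_scal, <- bsum_plus, <- bsum_minus.
      apply bsum_ext; intros y _; ring. }
  rewrite bsum_minus, bsum_plus, bsum_scal.
  rewrite (ker_quad n (fun x => g x * g x) (fun _ => 1)),
          (ker_quad n (fun _ => 1) (fun y => g y * g y)), (ker_quad n g g).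
  assert (P1 : forall j k, phi (fun _ => 1) W j k = ip W (op W j) (op W k)).
  { intros j k; apply bsum_ext; intros; ring. }
  assert (D : forall j, (j < n)%nat ->
     bsum n (fun k => phi (fun x => g x * g x) W j k * phi (fun _ => 1) W j k / (hn W j * hn W k))
     = phi (fun x => g x * g x) W j j / hn W j).
  { intros j Hj. rewrite (bsum_single n j).
    - rewrite P1. fold (hn W j). field. apply Rgt_not_eq, hn_W_pos. lia.
    - exact Hj.
    - intros k Hk Hkj. rewrite P1, (op_orth N nd c c_pos nd_lin W W_pos j k) by lia.
      unfold Rdiv; ring. }
  rewrite (bsum_ext n _ _ D).
  rewrite (bsum_ext n (fun j => bsum n (fun k => phi (fun _ => 1) W j k * _ / _))
             (fun j => phi (fun x => g x * g x) W j j / hn W j)).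
  2:{ intros j Hj. rewrite <- (D j Hj). apply bsum_ext; intros k _. unfold Rdiv; ring. }
  rewrite varK_sum.
  rewrite (bsum_ext n (fun j => bsum n (fun k => phi g W j k * phi g W j k / _))
             (fun j => bsum n (fun k => phi g W j k ^ 2 / (hn W j * hn W k)))).
  - lra.
  - intros j _. apply bsum_ext; intros k _. unfold Rdiv; ring.
Qed.

Lemma varK_nonneg g n : (n <= S N)%nat -> 0 <= varK g W n.
Proof.
  intros Hn. rewrite varK_double by exact Hn.
  apply Rmult_le_pos; [lra|]. apply bsum_nonneg; intros x Hx. apply bsum_nonneg; intros y Hy.
  assert (Wx := W_pos x ltac:(lia)). assert (Wy := W_pos y ltac:(lia)).
  apply Rmult_le_pos; [|lra]. apply Rmult_le_pos; [|lra].
  apply Rmult_le_pos; apply pow2_ge_0.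
Qed.

Lemma varK_comparison g g' L n : (n <= S N)%nat ->
  (forall x y, (x <= N)%nat -> (y <= N)%nat -> (g x - g y) ^ 2 <= L * (g' x - g' y) ^ 2) ->
  varK g W n <= L * varK g' W n.
Proof.
  intros Hn H. rewrite !varK_double by exact Hn.
  rewrite <- Rmult_assoc, (Rmult_comm L), Rmult_assoc.
  apply Rmult_le_compat_l; [lra|]. rewrite <- bsum_scal.
  apply bsum_le; intros x Hx. rewrite <- bsum_scal. apply bsum_le; intros y Hy.
  assert (Wx := W_pos x ltac:(lia)). assert (Wy := W_pos y ltac:(lia)).
  specialize (H x y ltac:(lia) ltac:(lia)).
  rewrite <- !Rmult_assoc.
  apply Rmult_le_compat_r; [lra|]. apply Rmult_le_compat_r; [lra|].
  apply Rmult_le_compat_r; [apply pow2_ge_0|exact H].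
Qed.

Lemma phi_nd j k : phi nd W j k
  = ip W (op W (S j)) (op W k) + bc W j * ip W (op W j) (op W k)
    + ac W j * ip W (op W (pred j)) (op W k).
Proof. apply ip_op_nd. Qed.

(** Multiplication by the coordinate is tridiagonal, so a single pair of entries links degrees below
    n with degrees from n on. In the induction, [vinc] at n equals [ac W (S n) - ac W n]. *)
Lemma varK_nd n : (n <= N)%nat -> varK nd W n = ac W n.
Proof.
  induction n as [|n IH]; intros Hn; [reflexivity|].
  change (varK nd W (S n)) with (varK nd W n + vinc N nd nd W n).
  rewrite IH by lia. unfold vinc.
  assert (Ort := op_orth N nd c c_pos nd_lin W W_pos).
  assert (Hn' := hn_W_pos n ltac:(lia)).
  assert (Sjk : forall k, (k < n)%nat ->
     phi nd W n k = if Nat.eqb (S k) n then hn W n else 0).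
  { intros k Hk. rewrite phi_sym, phi_nd.
    rewrite (Ort k n), (Ort (pred k) n) by lia.
    destruct (Nat.eqb_spec (S k) n) as [E|E].
    - rewrite E. fold (hn W n). ring.
    - rewrite (Ort (S k) n) by lia. ring. }
  assert (Snn : phi nd W n n = bc W n * hn W n).
  { rewrite phi_nd, (Ort (S n) n) by lia. fold (hn W n).
    destruct n as [|m]; simpl ac; [ring|]. simpl pred. rewrite (Ort m (S m)) by lia. ring. }
  assert (E2 : phi (fun i => nd i * nd i) W n n
     = ip W (fun i => nd i * op W n i) (fun i => nd i * op W n i))
    by (apply bsum_ext; intros; ring).
  assert (Ev : forall v, ip W (op W v) (fun i => nd i * op W n i) = phi nd W n v)
    by (intros; apply ip_sym).
  rewrite E2, ip_op_nd, !Ev, Snn.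
  assert (ES : phi nd W n (S n) = hn W (S n)).
  { rewrite phi_nd, (Ort n (S n)), (Ort (pred n) (S n)) by lia. rewrite hn_def. ring. }
  rewrite ES.
  destruct n as [|m].
  - simpl. field. lra.
  - simpl pred. rewrite (Sjk m) by lia. rewrite Nat.eqb_refl.
    rewrite (bsum_single (S m) m).
    + rewrite (Sjk m), Nat.eqb_refl by lia. simpl ac. field.
      split; apply Rgt_not_eq, hn_W_pos; lia.
    + lia.
    + intros k Hk Hkm. rewrite Sjk by lia. destruct (Nat.eqb_spec (S k) (S m)); [lia|].
      unfold Rdiv; ring.
Qed.

(** Minimality of h_{m+1} among monic polynomials, tested on [nd * p_m]: the squared norm of p_{m+1}
    - nd p_m equals that of nd p_m minus h_{m+1}, and nd is at most 1. *)
Lemma ac_le_1 n : (forall i, (i <= N)%nat -> 0 <= nd i <= 1) -> (n <= N)%nat -> ac W n <= 1.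
Proof.
  intros Hnd Hn. destruct n as [|m]; [simpl; lra|].
  assert (h0 := hn_W_pos m ltac:(lia)).
  simpl. apply Rmult_le_reg_r with (hn W m); [exact h0|].
  unfold Rdiv. rewrite Rmult_assoc, Rinv_l, Rmult_1_r, Rmult_1_l by lra.
  assert (H1 : 0 <= ip W (fun i => op W (S m) i - nd i * op W m i)
                         (fun i => op W (S m) i - nd i * op W m i)).
  { apply bsum_nonneg; intros i Hi. apply Rmult_le_pos; [left; apply W_pos; lia|apply Rle_0_sqr]. }
  assert (H2 : ip W (fun i => op W (S m) i - nd i * op W m i)
                         (fun i => op W (S m) i - nd i * op W m i)
     = hn W (S m) - 2 * phi nd W m (S m) + bsum (S N) (fun i => W i * (nd i ^ 2 * op W m i ^ 2))).
  { rewrite hn_def, phi_def, !ip_def, <- bsum_scal, <- bsum_minus, <- bsum_plus.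
    apply bsum_ext; intros; ring. }
  assert (H3 : bsum (S N) (fun i => W i * (nd i ^ 2 * op W m i ^ 2)) <= hn W m).
  { rewrite hn_def, ip_def. apply bsum_le; intros i Hi.
    apply Rmult_le_compat_l; [left; apply W_pos; lia|].
    specialize (Hnd i ltac:(lia)).
    assert (X := pow2_ge_0 (op W m i)).
    assert (0 <= (1 - nd i ^ 2) * op W m i ^ 2) by (apply Rmult_le_pos; [nra|exact X]). nra. }
  assert (H4 : phi nd W m (S m) = hn W (S m)).
  { rewrite phi_nd, (op_orth N nd c c_pos nd_lin W W_pos m (S m)),
      (op_orth N nd c c_pos nd_lin W W_pos (pred m) (S m)) by lia.
    rewrite hn_def. ring. }
  lra.
Qed.

(** [bc W n] is the mean of [nd] under the probability weights W p_n^2 / h_n. *)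
Lemma bc_bounds n : (forall i, (i <= N)%nat -> 0 <= nd i <= 1) -> (n <= N)%nat ->
  0 <= bc W n <= 1.
Proof.
  intros Hnd Hn. assert (h0 := hn_W_pos n Hn).
  assert (Q : forall i, (i < S N)%nat -> 0 <= W i * (op W n i * op W n i)).
  { intros i Hi. apply Rmult_le_pos; [left; apply W_pos; lia|apply Rle_0_sqr]. }
  rewrite bc_def. split.
  - apply Rmult_le_pos; [|left; now apply Rinv_0_lt_compat].
    apply bsum_nonneg; intros i Hi. specialize (Q i Hi). specialize (Hnd i ltac:(lia)). nra.
  - apply Rmult_le_reg_r with (hn W n); [exact h0|].
    unfold Rdiv. rewrite Rmult_assoc, Rinv_l, Rmult_1_r, Rmult_1_l by lra.
    rewrite hn_def, !ip_def. apply bsum_le; intros i Hi.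
    specialize (Q i Hi). specialize (Hnd i ltac:(lia)). nra.
Qed.

(** Comparison with the coordinate, whose variance [ac W n] is at most 1. The bound does not involve
    the weight, so it holds along the whole deformation. *)
Lemma varK_lipschitz g L n :
  (forall i, (i <= N)%nat -> 0 <= nd i <= 1) -> (n <= N)%nat -> 0 <= L ->
  (forall x y, (x <= N)%nat -> (y <= N)%nat -> Rabs (g x - g y) <= L * Rabs (nd x - nd y)) ->
  varK g W n <= L ^ 2.
Proof.
  intros Hnd Hn HL H. apply Rle_trans with (L ^ 2 * varK nd W n).
  - apply varK_comparison; [lia|]. intros x y Hx Hy.
    rewrite <- Rpow_mult_distr, <- (pow2_abs (g x - g y)).
    rewrite <- (pow2_abs (L * _)), Rabs_mult, (Rabs_pos_eq L HL).
    apply pow_incr. split; [apply Rabs_pos|now apply H].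
  - rewrite varK_nd by exact Hn. assert (A := ac_le_1 n Hnd Hn).
    assert (0 <= L ^ 2) by apply pow2_ge_0. nra.
Qed.

(** * Polynomial multiplication in terms of the recurrence coefficients *)

(* The coefficient of p_k in x^m p_j. *)
Fixpoint Gc (b A : nat -> R) (m j k : nat) : R :=
  match m with
  | O => if Nat.eqb j k then 1 else 0
  | S m => Gc b A m (S j) k + b j * Gc b A m j k + A j * Gc b A m (pred j) k
  end.

(** [D] is the number of coefficients; the degree is below [D]. *)
Definition pol (a : nat -> R) (D : nat) (x : R) : R := bsum D (fun m => a m * x ^ m).
Definition Gpol (a : nat -> R) (D : nat) (b A : nat -> R) j k :=
  bsum D (fun m => a m * Gc b A m j k).

Lemma Gc_far b A m j k : (j + m < k)%nat -> Gc b A m j k = 0.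
Proof.
  revert j; induction m as [|m IH]; intros j Hk; simpl.
  - destruct (Nat.eqb_spec j k); [lia|reflexivity].
  - rewrite !IH by lia. ring.
Qed.

Lemma Gpol_far a D b A j k : (j + D <= k)%nat -> Gpol a D b A j k = 0.
Proof. intros Hk. apply bsum_zero; intros m Hm. rewrite Gc_far by lia. ring. Qed.

(** Any [M] beyond the top degree is allowed, so that the three terms of the induction share one
    range of summation. *)
Lemma pow_nd_op m j M i : (j + m < M)%nat ->
  nd i ^ m * op W j i = bsum M (fun k => Gc (bc W) (ac W) m j k * op W k i).
Proof.
  revert j; induction m as [|m IH]; intros j HM.
  - rewrite (bsum_single M j); [simpl; rewrite Nat.eqb_refl; ring|lia|].
    intros k _ Hk. simpl. destruct (Nat.eqb_spec j k); [lia|ring].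
  - simpl pow. rewrite (Rmult_comm (nd i)), Rmult_assoc, nd_op.
    rewrite !Rmult_plus_distr_l, (IH (S j)) by lia.
    replace (nd i ^ m * (bc W j * op W j i)) with (bc W j * (nd i ^ m * op W j i)) by ring.
    replace (nd i ^ m * (ac W j * op W (pred j) i))
      with (ac W j * (nd i ^ m * op W (pred j) i)) by ring.
    rewrite (IH j), (IH (pred j)) by lia.
    rewrite <- !bsum_scal, <- !bsum_plus. apply bsum_ext; intros k _. simpl; ring.
Qed.

Lemma pol_op a D j M i : (j + D <= M)%nat ->
  pol a D (nd i) * op W j i = bsum M (fun k => Gpol a D (bc W) (ac W) j k * op W k i).
Proof.
  intros HM. unfold pol.
  rewrite Rmult_comm, <- bsum_scal.
  rewrite (bsum_ext D _ (fun m => bsum M (fun k => a m * Gc (bc W) (ac W) m j k * op W k i))).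
  - rewrite bsum_swap. apply bsum_ext; intros k _. unfold Gpol.
    rewrite Rmult_comm, <- bsum_scal. apply bsum_ext; intros m _; ring.
  - intros m Hm. replace (op W j i * (a m * nd i ^ m)) with (a m * (nd i ^ m * op W j i)) by ring.
    rewrite (pow_nd_op m j M) by lia. rewrite <- bsum_scal. apply bsum_ext; intros k _; ring.
Qed.

Lemma ip_pol a D j M v : (j + D <= M)%nat ->
  ip W (fun i => pol a D (nd i) * op W j i) v
  = bsum M (fun k => Gpol a D (bc W) (ac W) j k * ip W (op W k) v).
Proof.
  intros HM. rewrite <- ip_bsum. apply ip_ext; [|reflexivity]. intros i _. now apply pol_op.
Qed.

Lemma phi_pol a D j k : (j + D <= S N)%nat -> (k <= S N)%nat ->
  phi (fun i => pol a D (nd i)) W j k = Gpol a D (bc W) (ac W) j k * hn W k.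
Proof.
  intros Hj Hk. destruct (Nat.le_gt_cases (j + D) k) as [Hf|Hf].
  - rewrite Gpol_far by exact Hf. rewrite phi_ip, (ip_pol a D j k) by exact Hf.
    rewrite bsum_zero; [ring|]. intros m Hm.
    rewrite (op_orth N nd c c_pos nd_lin W W_pos m k) by lia. ring.
  - rewrite phi_ip, (ip_pol a D j (j + D)) by lia. rewrite (bsum_single _ k); [reflexivity|lia|].
    intros m Hm Hmk. rewrite (op_orth N nd c c_pos nd_lin W W_pos m k) by lia. ring.
Qed.

Lemma phi_pol_sq a D j M : (j <= N)%nat -> (j + D <= M)%nat -> (M <= S N)%nat ->
  phi (fun i => pol a D (nd i) * pol a D (nd i)) W j j / hn W j
  = bsum M (fun k => phi (fun i => pol a D (nd i)) W j k ^ 2 / (hn W j * hn W k)).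
Proof.
  intros Hj0 Hj HM.
  replace (phi (fun i => pol a D (nd i) * pol a D (nd i)) W j j)
    with (ip W (fun i => pol a D (nd i) * op W j i) (fun i => pol a D (nd i) * op W j i))
    by (apply bsum_ext; intros; ring).
  rewrite (ip_pol a D j M) by exact Hj.
  unfold Rdiv. rewrite Rmult_comm, <- bsum_scal. apply bsum_ext; intros k Hk.
  rewrite (ip_sym N W (op W k)), <- phi_ip, (phi_pol a D j k) by lia.
  field. split; apply Rgt_not_eq, hn_W_pos; lia.
Qed.

(** All pairs of degrees cancel except j < n <= k, as in the trace of P_n g (1 - P_n) g P_n, and the
    band width D leaves j = n - 1 - p and k = n + q. The product of the two opposite entries is free
    of the norms [hn]. *)
Lemma varK_pol a D n : (D <= n)%nat -> (n + D + D <= S N)%nat ->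
  varK (fun i => pol a D (nd i)) W n
  = bsum D (fun p => bsum D (fun q =>
      Gpol a D (bc W) (ac W) (n - 1 - p) (n + q) * Gpol a D (bc W) (ac W) (n + q) (n - 1 - p))).
Proof.
  intros HD HN. rewrite varK_sum.
  set (T := fun j k => phi (fun i => pol a D (nd i)) W j k ^ 2 / (hn W j * hn W k)).
  rewrite (bsum_ext n _ (fun j => bsum n (T j) + bsum D (fun q => T j (n + q)%nat))).
  2:{ intros j Hj. rewrite (phi_pol_sq a D j (n + D)) by lia. rewrite bsum_split. reflexivity. }
  rewrite bsum_plus.
  assert (HT : forall j k, (j < n)%nat -> (n <= k < n + D)%nat ->
     T j k = Gpol a D (bc W) (ac W) j k * Gpol a D (bc W) (ac W) k j).
  { intros j k Hj Hk. unfold T.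
    replace (phi (fun i => pol a D (nd i)) W j k ^ 2)
      with (phi (fun i => pol a D (nd i)) W j k * phi (fun i => pol a D (nd i)) W k j)
      by (rewrite (phi_sym N nd _ W k j); ring).
    rewrite (phi_pol a D j k), (phi_pol a D k j) by lia.
    field. split; apply Rgt_not_eq, hn_W_pos; lia. }
  replace (bsum n (fun j => bsum D (fun q => T j (n + q)%nat)))
    with (bsum D (fun p => bsum D (fun q => T (n - 1 - p)%nat (n + q)%nat))).
  - rewrite (bsum_ext D (fun p => bsum D (fun q => T (n - 1 - p)%nat (n + q)%nat)) (fun p => bsum D (fun q =>
      Gpol a D (bc W) (ac W) (n - 1 - p) (n + q) * Gpol a D (bc W) (ac W) (n + q) (n - 1 - p)))).
    + unfold T. ring.
    + intros p Hp. apply bsum_ext; intros q Hq. apply HT; lia.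
  - symmetry. rewrite bsum_rev. apply bsum_widen; [exact HD|].
    intros p Hp. apply bsum_zero; intros q Hq.
    rewrite HT, Gpol_far by lia. ring.
Qed.

End Variance.

(** * Toeplitz limit of the recurrence *)

(* The coefficient of X^z in (X + be + al / X)^m. *)
Fixpoint Tz (be al : R) (m : nat) (z : Z) : R :=
  match m with
  | O => if Z.eqb z 0 then 1 else 0
  | S m => Tz be al m (z - 1) + be * Tz be al m z + al * Tz be al m (z + 1)
  end.

Lemma Tz_bound be al m z : Rabs be <= 1 -> Rabs al <= 1 -> Rabs (Tz be al m z) <= 3 ^ m.
Proof.
  intros Hb Ha. revert z; induction m as [|m IH]; intros z; simpl.
  - destruct (Z.eqb z 0); [rewrite Rabs_R1|rewrite Rabs_R0]; lra.
  - assert (H1 := IH (z - 1)%Z). assert (H2 := IH z). assert (H3 := IH (z + 1)%Z).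
    eapply Rle_trans; [apply Rabs_triang|].
    eapply Rle_trans; [apply Rplus_le_compat_r, Rabs_triang|].
    rewrite !Rabs_mult.
    assert (Rabs be * Rabs (Tz be al m z) <= 1 * 3 ^ m)
      by (apply Rmult_le_compat; auto using Rabs_pos).
    assert (Rabs al * Rabs (Tz be al m (z + 1)) <= 1 * 3 ^ m)
      by (apply Rmult_le_compat; auto using Rabs_pos).
    lra.
Qed.

(** Both recursions sum over the same paths of m steps. Replacing coefficients one step at a time
    costs e for each of m steps, over at most [3 ^ m] paths, all within distance m of j. *)
Lemma Gc_Tz (b A : nat -> R) be al m j k e :
  Rabs be <= 1 -> Rabs al <= 1 -> (m <= j)%nat -> 0 <= e ->
  (forall l, (j <= l + m)%nat -> (l <= j + m)%nat ->
     Rabs (b l) <= 1 /\ Rabs (A l) <= 1 /\ Rabs (b l - be) <= e /\ Rabs (A l - al) <= e) ->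
  Rabs (Gc b A m j k - Tz be al m (Z.of_nat k - Z.of_nat j)) <= INR m * 3 ^ m * e.
Proof.
  intros Hbe Hal Hm He. revert j Hm. induction m as [|m IH]; intros j Hm H.
  - simpl. destruct (Nat.eqb_spec j k) as [E|E];
      destruct (Z.eqb_spec (Z.of_nat k - Z.of_nat j) 0) as [F|F]; try lia;
      rewrite Rminus_diag, Rabs_R0; lra.
  - cbn [Gc Tz].
    assert (I1 := IH (S j) ltac:(lia) ltac:(intros; apply H; lia)).
    assert (I2 := IH j ltac:(lia) ltac:(intros; apply H; lia)).
    assert (I3 := IH (pred j) ltac:(lia) ltac:(intros; apply H; lia)).
    replace (Z.of_nat k - Z.of_nat (S j))%Z with (Z.of_nat k - Z.of_nat j - 1)%Z in I1 by lia.
    replace (Z.of_nat k - Z.of_nat (pred j))%Z with (Z.of_nat k - Z.of_nat j + 1)%Z in I3 by lia.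
    set (z := (Z.of_nat k - Z.of_nat j)%Z) in *.
    destruct (H j ltac:(lia) ltac:(lia)) as [B1 [A1 [B2 A2]]].
    assert (T2 := Tz_bound be al m z Hbe Hal).
    assert (T3 := Tz_bound be al m (z + 1) Hbe Hal).
    set (g1 := Gc b A m (S j) k) in *. set (g2 := Gc b A m j k) in *.
    set (g3 := Gc b A m (pred j) k) in *.
    set (t1 := Tz be al m (z - 1)) in *. set (t2 := Tz be al m z) in *.
    set (t3 := Tz be al m (z + 1)) in *.
    replace (g1 + b j * g2 + A j * g3 - (t1 + be * t2 + al * t3))
      with ((g1 - t1) + (b j * (g2 - t2) + (b j - be) * t2) + (A j * (g3 - t3) + (A j - al) * t3))
      by ring.
    set (P := INR m * 3 ^ m * e) in *.
    assert (M1 : Rabs (b j * (g2 - t2)) <= 1 * P)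
      by (rewrite Rabs_mult; apply Rmult_le_compat; auto using Rabs_pos).
    assert (M2 : Rabs (A j * (g3 - t3)) <= 1 * P)
      by (rewrite Rabs_mult; apply Rmult_le_compat; auto using Rabs_pos).
    assert (M3 : Rabs ((b j - be) * t2) <= e * 3 ^ m)
      by (rewrite Rabs_mult; apply Rmult_le_compat; auto using Rabs_pos).
    assert (M4 : Rabs ((A j - al) * t3) <= e * 3 ^ m)
      by (rewrite Rabs_mult; apply Rmult_le_compat; auto using Rabs_pos).
    assert (0 <= e * 3 ^ m) by (apply Rmult_le_pos; [exact He|apply pow_le; lra]).
    rewrite S_INR. replace ((INR m + 1) * 3 ^ S m * e) with (3 * P + 3 * (e * 3 ^ m))
      by (unfold P; simpl; ring).
    eapply Rle_trans; [apply Rabs_triang|].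
    eapply Rle_trans; [apply Rplus_le_compat; [apply Rabs_triang|apply Rabs_triang]|].
    eapply Rle_trans; [apply Rplus_le_compat_r, Rplus_le_compat_l, Rabs_triang|].
    lra.
Qed.

Definition Tpol (a : nat -> R) D be al z := bsum D (fun m => a m * Tz be al m z).
Definition Cpol (a : nat -> R) D := bsum D (fun m => Rabs (a m) * (INR m * 3 ^ m)).
Definition Bpol (a : nat -> R) D := bsum D (fun m => Rabs (a m) * 3 ^ m).

Lemma Cpol_nonneg a D : 0 <= Cpol a D.
Proof.
  apply bsum_nonneg; intros m _. apply Rmult_le_pos; [apply Rabs_pos|].
  apply Rmult_le_pos; [apply pos_INR|apply pow_le; lra].
Qed.

Lemma Bpol_nonneg a D : 0 <= Bpol a D.
Proof.
  apply bsum_nonneg; intros m _. apply Rmult_le_pos; [apply Rabs_pos|apply pow_le; lra].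
Qed.

Lemma Tpol_bound a D be al z : Rabs be <= 1 -> Rabs al <= 1 ->
  Rabs (Tpol a D be al z) <= Bpol a D.
Proof.
  intros Hb Ha. eapply Rle_trans; [apply bsum_Rabs|]. apply bsum_le; intros m _.
  rewrite Rabs_mult. apply Rmult_le_compat_l; [apply Rabs_pos|now apply Tz_bound].
Qed.

Lemma Gpol_Tpol a D (b A : nat -> R) be al j k e :
  Rabs be <= 1 -> Rabs al <= 1 -> (D <= j)%nat -> 0 <= e ->
  (forall l, (j <= l + D)%nat -> (l <= j + D)%nat ->
     Rabs (b l) <= 1 /\ Rabs (A l) <= 1 /\ Rabs (b l - be) <= e /\ Rabs (A l - al) <= e) ->
  Rabs (Gpol a D b A j k - Tpol a D be al (Z.of_nat k - Z.of_nat j)) <= Cpol a D * e.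
Proof.
  intros Hbe Hal HD He H. unfold Gpol, Tpol. rewrite <- bsum_minus.
  eapply Rle_trans; [apply bsum_Rabs|].
  unfold Cpol. rewrite Rmult_comm, <- bsum_scal. apply bsum_le; intros m Hm.
  rewrite <- Rmult_minus_distr_l, Rabs_mult.
  replace (e * (Rabs (a m) * (INR m * 3 ^ m))) with (Rabs (a m) * (INR m * 3 ^ m * e)) by ring.
  apply Rmult_le_compat_l; [apply Rabs_pos|].
  apply Gc_Tz; auto; [lia|]. intros l H1 H2; apply H; lia.
Qed.

(** * Propagation of limits along the Toda flow *)

(** Comparison of derivatives in place of integration. It carries the Gronwall argument, the two
    integrations of the variance, and the Taylor and tail estimates. *)
Lemma Rabs_increment_le (F g : R -> R) (dF dg : R -> R) s :
  0 <= s ->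
  (forall u, 0 <= u <= s -> is_derive F u (dF u)) ->
  (forall u, 0 <= u <= s -> is_derive g u (dg u)) ->
  (forall u, 0 <= u <= s -> Rabs (dF u) <= dg u) ->
  Rabs (F s - F 0) <= g s - g 0.
Proof.
  intros Hs HF Hg H.
  assert (mono : forall (h dh : R -> R), (forall u, 0 <= u <= s -> is_derive h u (dh u)) ->
                 (forall u, 0 <= u <= s -> 0 <= dh u) -> h 0 <= h s).
  { intros h dh Hh Hp.
    destruct (MVT_gen h 0 s dh) as [x [Hx E]].
    - rewrite Rmin_left, Rmax_right by lra. intros u Hu; apply Hh; lra.
    - rewrite Rmin_left, Rmax_right by lra. intros u Hu.
      apply continuity_pt_filterlim. apply (ex_derive_continuous h). eexists; apply Hh; lra.
    - rewrite Rmin_left, Rmax_right in Hx by lra. specialize (Hp x Hx).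
      assert (0 <= dh x * (s - 0)) by (apply Rmult_le_pos; lra). lra. }
  assert (M1 := mono (fun u => g u - F u) (fun u => dg u - dF u)).
  assert (M2 := mono (fun u => g u + F u) (fun u => dg u + dF u)).
  apply Rabs_le. split.
  - assert (g 0 + F 0 <= g s + F s); [|lra]. apply M2.
    + intros u Hu. apply @is_derive_plus; auto.
    + intros u Hu. specialize (H u Hu). apply Rabs_le_between in H. lra.
  - assert (g 0 - F 0 <= g s - F s); [|lra]. apply M1.
    + intros u Hu. apply @is_derive_minus; auto.
    + intros u Hu. specialize (H u Hu). apply Rabs_le_between in H. lra.
Qed.

Definition window (n d j : nat) : Prop := (n <= j + d)%nat /\ (j <= n + d)%nat.

Lemma is_derive_exp_term C K u :
  is_derive (fun u => C ^ S K * u ^ S K / INR (fact (S K))) u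
            (C * (C ^ K * u ^ K / INR (fact K))).
Proof.
  evar_last.
  - apply is_derive_ext with (fun u => C ^ S K / INR (fact (S K)) * u ^ S K).
    { intros t; simpl; unfold Rdiv; ring. }
    apply is_derive_scal, is_derive_pow, @is_derive_id.
  - unfold one; simpl (pred _). rewrite fact_simpl, mult_INR. simpl (C ^ S K). cbn [Hierarchy.one].
    match goal with |- context [Ring.one ?a ?b] => change (Ring.one a b) with 1 end.
    field. split; [apply INR_fact_neq_0|apply not_0_INR; lia].
Qed.

(* Iterating the differential inequality K times costs K enlargements of the window and
   leaves the tail [(C s)^K / K!] of an exponential series. *)
Lemma window_gronwall (x y : nat -> nat -> R -> R) (be al C : R) (D : nat) :
  0 <= C ->
  (forall d eps, 0 < eps -> eventually (fun n => forall j, window n d j ->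
     Rabs (x n j 0 - be) <= eps /\ Rabs (y n j 0 - al) <= eps)) ->
  (forall d, eventually (fun n => forall j, window n d j -> forall s, 0 <= s <= 1 ->
     Rabs (x n j s - be) <= 1 /\ Rabs (y n j s - al) <= 1)) ->
  (forall d, eventually (fun n => forall j, window n d j -> exists dx dy : R -> R,
     forall s, 0 <= s <= 1 ->
     is_derive (x n j) s (dx s) /\ is_derive (y n j) s (dy s) /\
     forall e, (forall l, window j D l -> Rabs (x n l s - be) <= e /\ Rabs (y n l s - al) <= e) ->
       Rabs (dx s) <= C * e /\ Rabs (dy s) <= C * e)) ->
  forall d eps, 0 < eps -> eventually (fun n => forall j, window n d j ->
    forall s, 0 <= s <= 1 -> Rabs (x n j s - be) <= eps /\ Rabs (y n j s - al) <= eps).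
Proof.
  intros HC H0 Hb Hd.
  assert (Main : forall K d eps, 0 < eps -> eventually (fun n => forall j, window n d j ->
    forall s, 0 <= s <= 1 ->
      Rabs (x n j s - be) <= eps + C ^ K * s ^ K / INR (fact K) /\
      Rabs (y n j s - al) <= eps + C ^ K * s ^ K / INR (fact K))).
  { induction K as [|K IH]; intros d eps Heps.
    - destruct (Hb d) as [n0 Hn0]. exists n0. intros n Hn j Hj s Hs.
      destruct (Hn0 n Hn j Hj s Hs). simpl. split; lra.
    (* Half of [eps] is spent on the initial values, half on [C * e1]; the shift [C + 1] covers C =
       0. *)
    - set (e1 := eps / (2 * (C + 1))).
      assert (He1 : 0 < e1) by (apply Rdiv_lt_0_compat; lra).
      assert (Ce1 : C * e1 <= eps / 2).
      { replace (eps / 2) with ((C + 1) * e1) by (unfold e1; field; lra).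
        apply Rmult_le_compat_r; lra. }
      destruct (H0 d (eps / 2) ltac:(lra)) as [n0 Hn0].
      destruct (IH (d + D)%nat e1 He1) as [n1 Hn1].
      destruct (Hd d) as [n2 Hn2].
      exists (n0 + n1 + n2)%nat. intros n Hn j Hj s Hs.
      destruct (Hn0 n ltac:(lia) j Hj) as [I1 I2].
      destruct (Hn2 n ltac:(lia) j Hj) as [dx [dy Hxy]].
      assert (Bd : forall u, 0 <= u <= s ->
        is_derive (x n j) u (dx u) /\ is_derive (y n j) u (dy u) /\
        Rabs (dx u) <= C * (e1 + C ^ K * u ^ K / INR (fact K)) /\
        Rabs (dy u) <= C * (e1 + C ^ K * u ^ K / INR (fact K))).
      { intros u Hu. destruct (Hxy u ltac:(lra)) as [D1 [D2 D3]].
        split; [exact D1|]. split; [exact D2|]. apply D3.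
        intros l Hl. apply Hn1; [lia| |lra].
        destruct Hj, Hl. split; lia. }
      set (g := fun u => C * e1 * u + C ^ S K * u ^ S K / INR (fact (S K))).
      set (dg := fun u => C * e1 + C * (C ^ K * u ^ K / INR (fact K))).
      assert (Dg : forall u, is_derive g u (dg u)).
      { intros u. apply @is_derive_plus; [|apply is_derive_exp_term].
        auto_derive; [exact I|ring]. }
      assert (Eg : g s - g 0 <= eps / 2 + C ^ S K * s ^ S K / INR (fact (S K))).
      { unfold g. rewrite (pow_ne_zero (S K)) by lia. unfold Rdiv at 2.
        rewrite !Rmult_0_r, Rmult_0_l.
        assert (C * e1 * s <= eps / 2 * 1)
          by (apply Rmult_le_compat; [apply Rmult_le_pos; lra|lra|lra|lra]). lra. }
      assert (G1 : Rabs (x n j s - x n j 0) <= g s - g 0).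
      { apply (Rabs_increment_le (x n j) g dx dg); [lra|intros u Hu; now apply Bd|intros; apply Dg|].
        intros u Hu. unfold dg. rewrite <- Rmult_plus_distr_l. now apply Bd. }
      assert (G2 : Rabs (y n j s - y n j 0) <= g s - g 0).
      { apply (Rabs_increment_le (y n j) g dy dg); [lra|intros u Hu; now apply Bd|intros; apply Dg|].
        intros u Hu. unfold dg. rewrite <- Rmult_plus_distr_l. now apply Bd. }
      split.
      + replace (x n j s - be) with ((x n j s - x n j 0) + (x n j 0 - be)) by ring.
        eapply Rle_trans; [apply Rabs_triang|]. lra.
      + replace (y n j s - al) with ((y n j s - y n j 0) + (y n j 0 - al)) by ring.
        eapply Rle_trans; [apply Rabs_triang|]. lra. }
  intros d eps Heps.
  (* K depends on C and [eps] alone, so the window is enlarged by a fixed width as n grows. *)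
  destruct (cv_speed_pow_fact C (eps / 2) ltac:(lra)) as [K HK].
  specialize (HK K (le_n _)). unfold Rdist in HK. rewrite Rminus_0_r in HK.
  apply Rabs_lt_between in HK.
  destruct (Main K d (eps / 2) ltac:(lra)) as [n0 Hn0].
  exists n0. intros n Hn j Hj s Hs. destruct (Hn0 n Hn j Hj s Hs) as [H1 H2].
  assert (C ^ K * s ^ K / INR (fact K) <= C ^ K / INR (fact K)).
  { apply Rmult_le_compat_r; [left; apply Rinv_0_lt_compat, INR_fact_lt_0|].
    rewrite <- (Rmult_1_r (C ^ K)) at 2. apply Rmult_le_compat_l; [now apply pow_le|].
    rewrite <- (pow1 K). apply pow_incr; lra. }
  split; lra.
Qed.

(** Written as a constant times [INR i], so that the hypothesis [nd_lin] is met by [eq_refl]. *)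
Definition node (N i : nat) : R := / INR N * INR i.

Lemma node_bounds N i : (i <= N)%nat -> 0 <= node N i <= 1.
Proof.
  intros Hi. unfold node. destruct N as [|N].
  - replace i with O by lia. simpl. rewrite Rmult_0_r. lra.
  - assert (0 < INR (S N)) by (apply lt_0_INR; lia). apply le_INR in Hi. assert (0 <= INR i) by apply pos_INR.
    split.
    + apply Rmult_le_pos; [left; now apply Rinv_0_lt_compat|exact H0].
    + apply Rmult_le_reg_l with (INR (S N)); [exact H|].
      rewrite <- Rmult_assoc, Rinv_r by lra. lra.
Qed.

Lemma Rabs_diff_le_add (g1 g2 t C e : R) :
  Rabs (g1 - t) <= C * e -> Rabs (g2 - t) <= C * e -> Rabs (g1 - g2) <= 2 * C * e.
Proof.
  intros H1 H2. replace (g1 - g2) with ((g1 - t) - (g2 - t)) by ring.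
  eapply Rle_trans; [apply Rabs_triang|]. rewrite Rabs_Ropp. lra.
Qed.

Lemma Rabs_prod_diff (g1 g2 t1 t2 B e : R) :
  0 <= e <= 1 -> Rabs t1 <= B -> Rabs t2 <= B -> Rabs (g1 - t1) <= e -> Rabs (g2 - t2) <= e ->
  Rabs (g1 * g2 - t1 * t2) <= (1 + 2 * B) * e.
Proof.
  intros He H1 H2 H3 H4.
  replace (g1 * g2 - t1 * t2) with ((g1 - t1) * (g2 - t2) + (g1 - t1) * t2 + t1 * (g2 - t2)) by ring.
  eapply Rle_trans; [apply Rabs_triang|].
  eapply Rle_trans; [apply Rplus_le_compat_r, Rabs_triang|].
  rewrite !Rabs_mult.
  assert (Rabs (g1 - t1) * Rabs (g2 - t2) <= 1 * e)
    by (apply Rmult_le_compat; try apply Rabs_pos; lra).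
  assert (Rabs (g1 - t1) * Rabs t2 <= e * B) by (apply Rmult_le_compat; auto using Rabs_pos).
  assert (Rabs t1 * Rabs (g2 - t2) <= B * e) by (apply Rmult_le_compat; auto using Rabs_pos).
  lra.
Qed.

Section Asymptotics.

Variable Nn : nat -> nat.
Hypothesis Nn_large : forall d, eventually (fun n => (n + d <= Nn n)%nat).
Variable w : nat -> nat -> R.
Hypothesis w_pos : forall n i, (i <= Nn n)%nat -> 0 < w n i.
Variables be al : R.
Hypothesis be_bounds : 0 <= be <= 1.
Hypothesis al_bounds : 0 <= al <= 1.
Hypothesis initial_limits : forall d eps, 0 < eps -> eventually (fun n => forall j, window n d j ->
  Rabs (bc (Nn n) (node (Nn n)) (w n) j - be) <= eps /\
  Rabs (ac (Nn n) (node (Nn n)) (w n) j - al) <= eps).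
Variable a : nat -> R.
Variable D : nat.

Definition Wpol n s := Wd (w n) (fun i => pol a D (node (Nn n) i)) s.

Lemma Wpol_pos n s i : (i <= Nn n)%nat -> 0 < Wpol n s i.
Proof. intros Hi. now apply (Wd_pos (Nn n) (w n) (w_pos n)). Qed.

(** The deformed weight at s = 0 is compared with [w] value by value; this carries the agreement to
    the recurrence coefficients. *)
Lemma stieltjes_ext N nd W W' : (forall i, W i = W' i) -> forall j,
  (forall i, fst (stieltjes N nd W j) i = fst (stieltjes N nd W' j) i) /\
  (forall i, snd (stieltjes N nd W j) i = snd (stieltjes N nd W' j) i).
Proof.
  intros HW.
  assert (E : forall u u' v v', (forall i, u i = u' i) -> (forall i, v i = v' i) ->
      ip N W u v = ip N W' u' v').
  { intros u u' v v' Hu Hv. apply bsum_ext; intros i _. now rewrite HW, Hu, Hv. }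
  induction j as [|j [IH1 IH2]]; [split; reflexivity|].
  split; [|exact IH1]. intros i. simpl.
  rewrite (E (fst (stieltjes N nd W j)) (fst (stieltjes N nd W' j)) (fst (stieltjes N nd W j)) (fst (stieltjes N nd W' j)))
    by auto.
  rewrite (E (snd (stieltjes N nd W j)) (snd (stieltjes N nd W' j)) (snd (stieltjes N nd W j)) (snd (stieltjes N nd W' j)))
    by auto.
  rewrite (E (fun i => nd i * fst (stieltjes N nd W j) i) (fun i => nd i * fst (stieltjes N nd W' j) i)
             (fst (stieltjes N nd W j)) (fst (stieltjes N nd W' j))); auto.
  - now rewrite IH1, IH2.
  - intros k. now rewrite IH1.
Qed.

Lemma hn_ext N nd W W' j : (forall i, W i = W' i) -> hn N nd W j = hn N nd W' j.
Proof.
  intros HW. destruct (stieltjes_ext N nd W W' HW j) as [H _].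
  apply bsum_ext; intros i _. unfold op. now rewrite HW, H.
Qed.

Lemma bc_ac_ext N nd W W' j : (forall i, W i = W' i) ->
  bc N nd W j = bc N nd W' j /\ ac N nd W j = ac N nd W' j.
Proof.
  intros HW. split.
  - rewrite !bc_def, (hn_ext N nd W W' j HW). f_equal.
    destruct (stieltjes_ext N nd W W' HW j) as [H _].
    apply bsum_ext; intros i _. unfold op. now rewrite HW, H.
  - destruct j as [|j]; [reflexivity|]. simpl. now rewrite !(hn_ext N nd W W' _ HW).
Qed.

(** In both Toda equations the two entries of a difference lie on one diagonal and share a Toeplitz
    limit, so the difference is at most twice the error of one entry. This gives the constant
    [2 * Cpol a D]; the factor [ac] in the second equation is at most 1. *)
Lemma recurrence_limits d eps : 0 < eps -> eventually (fun n => forall j, window n d j ->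
  forall s, 0 <= s <= 1 ->
  Rabs (bc (Nn n) (node (Nn n)) (Wpol n s) j - be) <= eps /\
  Rabs (ac (Nn n) (node (Nn n)) (Wpol n s) j - al) <= eps).
Proof.
  revert d eps.
  assert (Bd : forall n j s, (0 < Nn n)%nat -> (j <= Nn n)%nat -> (0 < j)%nat ->
    0 <= bc (Nn n) (node (Nn n)) (Wpol n s) j <= 1 /\
    0 <= ac (Nn n) (node (Nn n)) (Wpol n s) j <= 1).
  { intros n j s HN Hj Hj0.
    assert (Hc : 0 < / INR (Nn n)) by (apply Rinv_0_lt_compat, lt_0_INR; lia).
    split.
    - apply (bc_bounds (Nn n) (node (Nn n)) _ Hc (fun i => eq_refl) _ (Wpol_pos n s)); [|exact Hj].
      intros; now apply node_bounds.
    - split; [left; apply (ac_pos (Nn n) (node (Nn n)) _ Hc (fun i => eq_refl) _ (Wpol_pos n s)); lia|].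
      apply (ac_le_1 (Nn n) (node (Nn n)) _ Hc (fun i => eq_refl) _ (Wpol_pos n s)); [|exact Hj].
      intros; now apply node_bounds. }
  (* The equations at index j use rows j - 1, j and j + 1, each reaching D further, hence the radius
     [S D]. *)
  apply (window_gronwall (fun n j s => bc (Nn n) (node (Nn n)) (Wpol n s) j)
           (fun n j s => ac (Nn n) (node (Nn n)) (Wpol n s) j) be al (2 * Cpol a D) (S D)).
  - assert (H := Cpol_nonneg a D). lra.
  - intros d eps Heps. destruct (initial_limits d eps Heps) as [n0 Hn0].
    exists n0. intros n Hn j Hj. specialize (Hn0 n Hn j Hj).
    assert (E : forall i, Wpol n 0 i = w n i).
    { intros i. unfold Wpol, Wd. rewrite Rmult_0_l, exp_0. ring. }
    destruct (bc_ac_ext (Nn n) (node (Nn n)) _ _ j E) as [-> ->]. exact Hn0.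
  - intros d. destruct (Nn_large d) as [n0 Hn0].
    exists (n0 + d + 1)%nat. intros n Hn j [Hj1 Hj2] s Hs.
    assert (HN := Hn0 n ltac:(lia)).
    destruct (Bd n j s ltac:(lia) ltac:(lia) ltac:(lia)).
    split; apply Rabs_le; lra.
  - intros d. destruct (Nn_large (d + D + 2)) as [n0 Hn0].
    exists (n0 + d + D + 2)%nat. intros n Hn j [Hj1 Hj2].
    assert (HN := Hn0 n ltac:(lia)).
    assert (Hc : 0 < / INR (Nn n)) by (apply Rinv_0_lt_compat, lt_0_INR; lia).
    destruct j as [|j]; [lia|].
    set (P := fun i => pol a D (node (Nn n) i)).
    set (ph := fun s => phi (Nn n) (node (Nn n)) P (Wpol n s)).
    set (h := fun s => hn (Nn n) (node (Nn n)) (Wpol n s)).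
    exists (fun s => ph s (S (S j)) (S j) / h s (S j) - ph s (S j) j / h s j),
           (fun s => ac (Nn n) (node (Nn n)) (Wpol n s) (S j) *
              (ph s (S j) (S j) / h s (S j) - ph s j j / h s j)).
    intros s Hs. split; [|split].
    + apply (is_derive_bc (Nn n) (node (Nn n)) _ Hc (fun i => eq_refl) (w n) (w_pos n) P j s). lia.
    + apply (is_derive_ac (Nn n) (node (Nn n)) _ Hc (fun i => eq_refl) (w n) (w_pos n) P j s). lia.
    + intros e He.
      assert (He0 : 0 <= e).
      { destruct (He (S j)) as [H _]; [split; lia|]. eapply Rle_trans; [apply Rabs_pos|exact H]. }
      set (G := Gpol a D (bc (Nn n) (node (Nn n)) (Wpol n s)) (ac (Nn n) (node (Nn n)) (Wpol n s))).
      assert (EG : forall k l, (k <= S (S j))%nat -> (l <= S (S j))%nat -> ph s k l / h s l = G k l).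
      { intros k l Hk Hl. unfold ph, P.
        rewrite (phi_pol (Nn n) (node (Nn n)) _ Hc (fun i => eq_refl) _ (Wpol_pos n s) a D k l) by lia.
        unfold h, G. field. apply Rgt_not_eq.
        apply (hn_pos (Nn n) (node (Nn n)) _ Hc (fun i => eq_refl) _ (Wpol_pos n s)). lia. }
      assert (AG : forall k l, (j <= k <= S (S j))%nat ->
         Rabs (G k l - Tpol a D be al (Z.of_nat l - Z.of_nat k)) <= Cpol a D * e).
      { intros k l Hk. apply Gpol_Tpol; try (apply Rabs_le; lra); [lia|exact He0|].
        intros m Hm1 Hm2. destruct (He m) as [E1 E2]; [split; lia|].
        destruct (Bd n m s ltac:(lia) ltac:(lia) ltac:(lia)).
        repeat split; auto; apply Rabs_le; lra. }
      rewrite !EG by lia. split.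
      * apply Rabs_diff_le_add with (Tpol a D be al (-1)).
        -- replace (-1)%Z with (Z.of_nat (S j) - Z.of_nat (S (S j)))%Z by lia. apply AG; lia.
        -- replace (-1)%Z with (Z.of_nat j - Z.of_nat (S j))%Z by lia. apply AG; lia.
      * rewrite Rabs_mult.
        destruct (Bd n (S j) s ltac:(lia) ltac:(lia) ltac:(lia)) as [_ HA].
        rewrite (Rabs_pos_eq (ac _ _ _ _)) by lra.
        assert (X : Rabs (G (S j) (S j) - G j j) <= 2 * Cpol a D * e).
        { apply Rabs_diff_le_add with (Tpol a D be al 0).
          - replace 0%Z with (Z.of_nat (S j) - Z.of_nat (S j))%Z by lia. apply AG; lia.
          - replace 0%Z with (Z.of_nat j - Z.of_nat j)%Z by lia. apply AG; lia. }
        assert (0 <= Rabs (G (S j) (S j) - G j j)) by apply Rabs_pos. nra.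
Qed.

(** The formula of [varK_pol] with the entries (n - 1 - p, n + q) replaced by their Toeplitz limits,
    whose index is the distance p + q + 1 to the diagonal. *)
Definition toeplitz_variance :=
  bsum D (fun p => bsum D (fun q =>
    Tpol a D be al (Z.of_nat (p + q + 1)) * Tpol a D be al (- Z.of_nat (p + q + 1)))).

Lemma varK_limit eps : 0 < eps -> eventually (fun n => forall s, 0 <= s <= 1 ->
  Rabs (varK (Nn n) (node (Nn n)) (fun i => pol a D (node (Nn n) i)) (Wpol n s) n
        - toeplitz_variance) <= eps).
Proof.
  intros Heps.
  set (B := Bpol a D). set (C := Cpol a D).
  assert (HB : 0 <= B) by apply Bpol_nonneg. assert (HC : 0 <= C) by apply Cpol_nonneg.
  assert (HDD : 0 <= INR D * INR D) by (apply Rmult_le_pos; apply pos_INR).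
  set (M := INR D * INR D * (1 + 2 * B)).
  assert (HM : 0 <= M) by (apply Rmult_le_pos; lra).
  (* This choice gives [C * e <= 1], as [Rabs_prod_diff] needs, and also a total error
     [M * (C * e) <= eps] over the D^2 terms. *)
  set (e := Rmin 1 (eps / (M + 1)) / (C + 1)).
  assert (Hm : 0 < Rmin 1 (eps / (M + 1)))
    by (apply Rmin_pos; [lra|apply Rdiv_lt_0_compat; lra]).
  assert (He : 0 < e) by (apply Rdiv_lt_0_compat; lra).
  assert (HCe : C * e <= Rmin 1 (eps / (M + 1))).
  { replace (Rmin 1 (eps / (M + 1))) with ((C + 1) * e) by (unfold e; field; lra).
    apply Rmult_le_compat_r; lra. }
  assert (HCe1 : 0 <= C * e <= 1).
  { split; [apply Rmult_le_pos; lra|]. eapply Rle_trans; [exact HCe|apply Rmin_l]. }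
  assert (HMe : M * (C * e) <= eps).
  { apply Rle_trans with (M * (eps / (M + 1))).
    - apply Rmult_le_compat_l; [exact HM|]. eapply Rle_trans; [exact HCe|apply Rmin_r].
    - replace eps with ((M + 1) * (eps / (M + 1))) at 2 by (field; lra).
      apply Rmult_le_compat_r; [|lra]. apply Rlt_le, Rdiv_lt_0_compat; lra. }
  destruct (recurrence_limits (D + D) e He) as [n0 Hn0].
  destruct (Nn_large (D + D)) as [n1 Hn1].
  exists (n0 + n1 + D + D + 1)%nat. intros n Hn s Hs.
  assert (HN := Hn1 n ltac:(lia)). specialize (Hn0 n ltac:(lia)).
  assert (Hc : 0 < / INR (Nn n)) by (apply Rinv_0_lt_compat, lt_0_INR; lia).
  rewrite (varK_pol (Nn n) (node (Nn n)) _ Hc (fun i => eq_refl) _ (Wpol_pos n s)) by lia.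
  set (G := Gpol a D (bc (Nn n) (node (Nn n)) (Wpol n s)) (ac (Nn n) (node (Nn n)) (Wpol n s))).
  assert (AG : forall k l, window n D k ->
     Rabs (G k l - Tpol a D be al (Z.of_nat l - Z.of_nat k)) <= C * e).
  { intros k l [Hk1 Hk2]. apply Gpol_Tpol; try (apply Rabs_le; lra); [lia|lra|].
    intros m Hm1 Hm2. destruct (Hn0 m ltac:(split; lia) s Hs) as [E1 E2].
    assert (0 <= bc (Nn n) (node (Nn n)) (Wpol n s) m <= 1).
    { apply (bc_bounds (Nn n) (node (Nn n)) _ Hc (fun i => eq_refl) _ (Wpol_pos n s)); [|lia].
      intros; now apply node_bounds. }
    assert (0 < ac (Nn n) (node (Nn n)) (Wpol n s) m).
    { apply (ac_pos (Nn n) (node (Nn n)) _ Hc (fun i => eq_refl) _ (Wpol_pos n s)); lia. }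
    assert (ac (Nn n) (node (Nn n)) (Wpol n s) m <= 1).
    { apply (ac_le_1 (Nn n) (node (Nn n)) _ Hc (fun i => eq_refl) _ (Wpol_pos n s)); [|lia].
      intros; now apply node_bounds. }
    repeat split; auto; apply Rabs_le; lra. }
  unfold toeplitz_variance. rewrite <- bsum_minus.
  apply Rle_trans with (M * (C * e)); [|exact HMe].
  replace (M * (C * e)) with (bsum D (fun _ => bsum D (fun _ => (1 + 2 * B) * (C * e))))
    by (rewrite !bsum_const; unfold M; ring).
  eapply Rle_trans; [apply bsum_Rabs|]. apply bsum_le; intros p Hp.
  rewrite <- bsum_minus.
  eapply Rle_trans; [apply bsum_Rabs|]. apply bsum_le; intros q Hq.
  apply Rabs_prod_diff; auto.
  - apply Tpol_bound; apply Rabs_le; lra.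
  - apply Tpol_bound; apply Rabs_le; lra.
  - replace (Z.of_nat (p + q + 1)) with (Z.of_nat (n + q) - Z.of_nat (n - 1 - p))%Z by lia.
    apply AG. split; lia.
  - replace (- Z.of_nat (p + q + 1))%Z with (Z.of_nat (n - 1 - p) - Z.of_nat (n + q))%Z by lia.
    apply AG. split; lia.
Qed.

End Asymptotics.

(** * Recurrence coefficients of the Hahn weight *)

Section Scaling.

Variable N : nat.
Variable nd : nat -> R.
Variable c : R.
Hypothesis c_pos : 0 < c.
Variable W : nat -> R.

Let nd' i := c * nd i.

(** The Hahn coefficients are computed on the integers and transferred to nodes i/N. The hypothesis
    at the given index lets [op_scale] use the scaling of lower coefficients inside its own
    induction. *)
Lemma hn_scale_of j :
  (forall i, op N nd' W j i = c ^ j * op N nd W j i) ->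
  hn N nd' W j = c ^ j * c ^ j * hn N nd W j.
Proof.
  intros H. rewrite !hn_def, !ip_def, <- bsum_scal. apply bsum_ext; intros i _.
  rewrite H. ring.
Qed.

Lemma bc_scale_of j :
  (forall i, op N nd' W j i = c ^ j * op N nd W j i) -> bc N nd' W j = c * bc N nd W j.
Proof.
  intros H. assert (0 < c ^ j) by now apply pow_lt.
  rewrite !bc_def, hn_scale_of by exact H.
  replace (ip N W (fun i => nd' i * op N nd' W j i) (op N nd' W j))
    with (c * (c ^ j * c ^ j) * ip N W (fun i => nd i * op N nd W j i) (op N nd W j)).
  - unfold Rdiv. rewrite !Rinv_mult. generalize (/ hn N nd W j). intros ih. field. lra.
  - rewrite !ip_def, <- bsum_scal. apply bsum_ext; intros i _. rewrite H. unfold nd'. ring.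
Qed.

Lemma ac_scale_of j :
  (forall i, op N nd' W j i = c ^ j * op N nd W j i) ->
  (forall i, op N nd' W (pred j) i = c ^ (pred j) * op N nd W (pred j) i) ->
  ac N nd' W j = c ^ 2 * ac N nd W j.
Proof.
  intros H1 H2. destruct j as [|j]; [simpl; ring|].
  simpl pred in H2. simpl ac. rewrite (hn_scale_of (S j) H1), (hn_scale_of j H2).
  assert (0 < c ^ j) by now apply pow_lt.
  unfold Rdiv. rewrite !Rinv_mult. generalize (/ hn N nd W j). intros ih.
  simpl. field. lra.
Qed.

Lemma op_scale j i : op N nd' W j i = c ^ j * op N nd W j i.
Proof.
  revert i. induction j as [j IH] using (well_founded_induction lt_wf). intros i.
  destruct j as [|j]; [unfold op; simpl; ring|].
  rewrite !op_S, (bc_scale_of j), (ac_scale_of j) by (intros; apply IH; lia).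
  rewrite (IH j), (IH (pred j)) by lia. unfold nd'.
  destruct j as [|j]; simpl; ring.
Qed.

Lemma bc_scale j : bc N nd' W j = c * bc N nd W j.
Proof. apply bc_scale_of, op_scale. Qed.

Lemma ac_scale j : ac N nd' W j = c ^ 2 * ac N nd W j.
Proof. apply ac_scale_of; apply op_scale. Qed.

End Scaling.

Lemma falling_succ z k : falling (z + 1) (S k) = (z + 1) * falling z k.
Proof.
  induction k as [|k IH]; [simpl; ring|].
  change (falling (z + 1) (S (S k))) with (falling (z + 1) (S k) * (z + 1 - INR (S k))).
  rewrite IH, S_INR. simpl. ring.
Qed.

Lemma falling_nat_gt m k : (k < m)%nat -> falling (INR k) m = 0.
Proof.
  induction m as [|m IH]; intros H; [lia|]. simpl.
  destruct (Nat.eq_dec k m) as [->|E]; [ring|rewrite IH by lia; ring].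
Qed.

Lemma falling_pos z k : INR k < z + 1 -> 0 < falling z k.
Proof.
  induction k as [|k IH]; intros H; simpl; [lra|]. rewrite S_INR in H.
  apply Rmult_lt_0_compat; [apply IH|]; lra.
Qed.

Lemma gbinom_succ al k :
  gbinom (al + INR (S k)) (S k) = gbinom (al + INR k) k * ((al + INR k + 1) / (INR k + 1)).
Proof.
  unfold gbinom. rewrite S_INR, <- Rplus_assoc, falling_succ, fact_simpl, mult_INR, S_INR.
  assert (0 <= INR k) by apply pos_INR. field. split; [lra|apply INR_fact_neq_0].
Qed.

Lemma gbinom_pos al k : -1 < al -> 0 < gbinom (al + INR k) k.
Proof.
  intros H. apply Rdiv_lt_0_compat; [apply falling_pos; lra|apply INR_fact_lt_0].
Qed.

Lemma hahn_weight_pos N al be x : -1 < al -> -1 < be -> 0 < hahn_weight N al be x.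
Proof. intros Ha Hb. apply Rmult_lt_0_compat; now apply gbinom_pos. Qed.

(** * Expansion of the orthogonal polynomials in a Newton basis *)

Section NewtonBasis.

Variable N : nat.
Variable W : nat -> R.
Variable r : nat -> R.

Notation bc := (bc N INR).
Notation ac := (ac N INR).

(** Newton basis with centres r. Two choices are used: [INR] gives the falling factorials suited to
    the Hahn operator, and 0 gives the monomials of the Vandermonde determinant. *)
Fixpoint nb (k x : nat) : R :=
  match k with O => 1 | S j => nb j x * (INR x - r j) end.

(** The recurrence of p_j transported to coefficients through x nb_k = nb_{k+1} + r_k nb_k. As in
    [stieltjes], the pair remembers the previous index. *)
Fixpoint kp (j : nat) : (nat -> R) * (nat -> R) :=
  match j with
  | O => (fun k => match k with O => 1 | S _ => 0 end, fun _ => 0)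
  | S j' => (fun k => match k with O => 0 | S k' => fst (kp j') k' end
                      + (r k - bc W j') * fst (kp j') k - ac W j' * snd (kp j') k,
             fst (kp j'))
  end.
Definition kap j := fst (kp j).

Lemma kap_S j k : kap (S j) k
  = match k with O => 0 | S k' => kap j k' end
    + (r k - bc W j) * kap j k - ac W j * kap (pred j) k.
Proof. destruct j as [|j]; [unfold kap; simpl; ring|reflexivity]. Qed.

Lemma kap_gt j k : (j < k)%nat -> kap j k = 0.
Proof.
  revert k. induction j as [j IH] using (well_founded_induction lt_wf). intros k Hk.
  destruct j as [|j]; [destruct k; [lia|reflexivity]|].
  rewrite kap_S. destruct k as [|k]; [lia|].
  rewrite !IH by lia. ring.
Qed.

Lemma kap_diag j : kap j j = 1.
Proof.
  induction j as [|j IH]; [reflexivity|].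
  rewrite kap_S, IH, !kap_gt by lia. ring.
Qed.

Lemma op_kap j M x : (j < M)%nat -> op N INR W j x = bsum M (fun k => kap j k * nb k x).
Proof.
  revert M. induction j as [j IH] using (well_founded_induction lt_wf). intros M HM.
  destruct j as [|j].
  - rewrite (bsum_single M 0); [unfold op, kap; simpl; ring|lia|].
    intros k _ Hk. destruct k; [lia|]. unfold kap; simpl; ring.
  - destruct M as [|M]; [lia|].
    rewrite op_S, (IH j ltac:(lia) (S M)) by lia.
    rewrite (IH (pred j) ltac:(lia) (S M)) by lia.
    rewrite <- !bsum_scal, <- bsum_minus.
    rewrite (bsum_ext (S M) (fun k => kap (S j) k * nb k x) (fun k =>
       match k with O => 0 | S k' => kap j k' end * nb k x
       + ((r k - bc W j) * kap j k * nb k x - ac W j * kap (pred j) k * nb k x)))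
      by (intros; rewrite kap_S; ring).
    rewrite bsum_plus, (bsum_S_l M (fun k => match k with O => 0 | S k' => kap j k' end * nb k x)).
    rewrite Rmult_0_l, Rplus_0_l.
    replace (bsum M (fun i => kap j i * nb (S i) x))
      with (bsum (S M) (fun i => kap j i * nb (S i) x))
      by (simpl; rewrite (kap_gt j M) by lia; ring).
    rewrite <- bsum_plus. apply bsum_ext; intros k _. simpl. ring.
Qed.

End NewtonBasis.

(** * The Hahn difference operator and its eigenfunctions *)

Section Hahn.

Variable N : nat.
Variables alpha beta : R.
Hypothesis alpha_gt : -1 < alpha.
Hypothesis beta_gt : -1 < beta.

Let W := hahn_weight N alpha beta.

Lemma W_hahn_pos i : (i <= N)%nat -> 0 < W i.
Proof. intros _. now apply hahn_weight_pos. Qed.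

(** Birth and death rates. The zeros [Bh N = 0] and [Dh 0 = 0] remove from [Hop] any contribution of
    values outside the nodes. *)
Definition Bh (x : nat) : R := (INR x + alpha + 1) * (INR N - INR x).
Definition Dh (x : nat) : R := INR x * (beta + INR N - INR x + 1).
Definition Hop (u : nat -> R) (x : nat) : R :=
  Bh x * (u (S x) - u x) - Dh x * (u x - u (pred x)).

(** Detailed balance: both weights are written over the shorter products, and [gbinom_succ] supplies
    the ratios of the two binomial factors. *)
Lemma hahn_pearson x : (x < N)%nat -> W x * Bh x = W (S x) * Dh (S x).
Proof.
  intros Hx. unfold W, hahn_weight, Bh, Dh.
  replace (N - x)%nat with (S (N - S x)) by lia.
  rewrite !gbinom_succ. rewrite (minus_INR N (S x)) by lia. rewrite S_INR.
  assert (0 <= INR x) by apply pos_INR. assert (INR x + 1 <= INR N).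
  { rewrite <- S_INR. apply le_INR; lia. }
  field. lra.
Qed.

(** Summation by parts: balance matches the death term at x + 1 with the birth term at x, and the
    boundary terms vanish. The resulting form is symmetric in u and v. *)
Lemma ip_Hop u v : ip N W (Hop u) v
  = - bsum N (fun x => W x * Bh x * ((u (S x) - u x) * (v (S x) - v x))).
Proof.
  rewrite ip_def.
  rewrite (bsum_ext (S N) _ (fun x => W x * Bh x * ((u (S x) - u x) * v x)
                                      - W x * Dh x * ((u x - u (pred x)) * v x)))
    by (intros; unfold Hop; ring).
  rewrite bsum_minus.
  rewrite (bsum_S_l N (fun x => W x * Dh x * ((u x - u (pred x)) * v x))).
  simpl bsum at 1. unfold Bh at 2. unfold Dh at 1. simpl (INR 0).
  rewrite (bsum_ext N (fun i => W (S i) * Dh (S i) * _)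
             (fun x => W x * Bh x * ((u (S x) - u x) * v (S x))))
    by (intros i Hi; rewrite (hahn_pearson i Hi); reflexivity).
  rewrite (bsum_ext N (fun x => W x * Bh x * ((u (S x) - u x) * (v (S x) - v x)))
     (fun x => W x * Bh x * ((u (S x) - u x) * v (S x)) - W x * Bh x * ((u (S x) - u x) * v x)))
    by (intros; ring).
  rewrite bsum_minus. ring.
Qed.

Lemma Hop_selfadjoint u v : ip N W (Hop u) v = ip N W u (Hop v).
Proof.
  rewrite (ip_sym N W u), !ip_Hop. f_equal. apply bsum_ext; intros; ring.
Qed.

Definition ef (k x : nat) : R := falling (INR x) k.
Definition lam (k : nat) : R := INR k * (INR k + alpha + beta + 1).
Definition mu (k : nat) : R := INR k * (INR N - INR k + 1) * (alpha + INR k).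

Lemma Hop_ef k x : Hop (ef k) x = - lam k * ef k x + mu k * ef (pred k) x.
Proof.
  unfold Hop, lam, mu, ef. destruct k as [|k]; [simpl; ring|].
  simpl pred. unfold Bh, Dh.
  assert (F1 : falling (INR (S x)) (S k) = (INR x + 1) * falling (INR x) k)
    by (rewrite S_INR; apply falling_succ).
  rewrite F1.
  assert (F2 : INR x * (falling (INR x) (S k) - falling (INR (pred x)) (S k))
               = INR (S k) * falling (INR x) (S k)).
  { destruct x as [|x].
    - rewrite (falling_nat_gt (S k) 0) by lia. simpl. ring.
    - simpl pred. rewrite S_INR, falling_succ, S_INR. simpl. ring. }
  replace (INR x * (beta + INR N - INR x + 1) * (falling (INR x) (S k) - falling (INR (pred x)) (S k)))
    with ((beta + INR N - INR x + 1) * (INR (S k) * falling (INR x) (S k)))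
    by (rewrite <- F2; ring).
  rewrite S_INR. simpl falling. ring.
Qed.

Notation kap := (kap N W INR).
Notation op := (op N INR).
Notation bc := (bc N INR).
Notation ac := (ac N INR).

Lemma ef_nb k x : nb INR k x = ef k x.
Proof. unfold ef. induction k as [|k IH]; simpl; [reflexivity|now rewrite IH]. Qed.

Lemma op_falling j M x : (j < M)%nat -> op W j x = bsum M (fun k => kap j k * ef k x).
Proof.
  intros H. rewrite (op_kap N W INR j M x H). apply bsum_ext; intros k _. now rewrite ef_nb.
Qed.

Let one_pos : 0 < 1 := Rlt_0_1.
Let nd_id : forall i, INR i = 1 * INR i := fun i => eq_sym (Rmult_1_l (INR i)).

Lemma ef_inspan k : inspan N INR W (S k) (ef k).
Proof.
  induction k as [|k IH].
  - apply inspan_ext with (op W 0); [reflexivity|apply inspan_op; lia].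
  - apply inspan_ext with (fun x => 1 * (INR x * ef k x) + - INR k * ef k x).
    + intros x. unfold ef. simpl. ring.
    + apply inspan_lin; [now apply inspan_nd|]. apply inspan_widen with (S k); [lia|exact IH].
Qed.

Lemma Hop_op j x : Hop (op W j) x
  = bsum (S j) (fun k => kap j k * (- lam k * ef k x + mu k * ef (pred k) x)).
Proof.
  unfold Hop. rewrite !(op_falling j (S j)) by lia.
  rewrite <- !bsum_minus, <- !bsum_scal, <- bsum_minus. apply bsum_ext; intros k _.
  rewrite <- Hop_ef. unfold Hop. ring.
Qed.

Lemma Hop_op_inspan j : inspan N INR W (S j) (Hop (op W j)).
Proof.
  apply inspan_ext with
    (fun x => bsum (S j) (fun k => kap j k * (- lam k * ef k x + mu k * ef (pred k) x))).
  - intros x. symmetry. apply Hop_op.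
  - apply (inspan_bsum N INR W (S j) (S j) (kap j)
             (fun k x => - lam k * ef k x + mu k * ef (pred k) x)).
    intros k Hk. apply inspan_lin.
    + apply inspan_widen with (S k); [lia|apply ef_inspan].
    + apply inspan_widen with (S (pred k)); [lia|apply ef_inspan].
Qed.

(** The coefficient of [ef k] in [Hop p_j + lam j * p_j], for k < j; the top coefficient, at k = j,
    cancels. *)
Definition resid j k := (lam j - lam k) * kap j k + mu (S k) * kap j (S k).

Lemma Hop_resid j x : Hop (op W j) x + lam j * op W j x = bsum j (fun k => resid j k * ef k x).
Proof.
  rewrite Hop_op, (op_falling j (S j)) by lia.
  rewrite <- bsum_scal, <- bsum_plus.
  rewrite (bsum_ext (S j) _ (fun k => (lam j - lam k) * kap j k * ef k x
                                    + mu k * kap j k * ef (pred k) x)) by (intros; ring).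
  rewrite bsum_plus, (bsum_S_l j (fun k => mu k * kap j k * ef (pred k) x)).
  unfold mu at 1. simpl (INR 0). simpl bsum at 1. simpl pred.
  replace (lam j - lam j) with 0 by ring.
  rewrite (bsum_ext j (fun k => resid j k * ef k x)
     (fun k => (lam j - lam k) * kap j k * ef k x + mu (S k) * kap j (S k) * ef k x))
    by (intros; unfold resid; ring).
  rewrite bsum_plus. ring.
Qed.

(** Evaluation at x = 0, 1, ... is triangular, since [ef m k = 0] for m > k. *)
Lemma ef_independent j (r : nat -> R) : (j <= S N)%nat ->
  (forall x, (x <= N)%nat -> bsum j (fun k => r k * ef k x) = 0) ->
  forall k, (k < j)%nat -> r k = 0.
Proof.
  intros Hj H k. induction k as [k IH] using (well_founded_induction lt_wf). intros Hk.
  specialize (H k ltac:(lia)). rewrite (bsum_single j k) in H.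
  - apply Rmult_integral in H. destruct H as [H|H]; [exact H|].
    unfold ef in H. assert (0 < falling (INR k) k) by (apply falling_pos; lra). lra.
  - exact Hk.
  - intros m Hm Hmk. destruct (Nat.lt_ge_cases m k) as [L|L].
    + rewrite IH by lia. ring.
    + unfold ef. rewrite falling_nat_gt by lia. ring.
Qed.

(** [Hop p_j + lam j * p_j] has degree below j. It is orthogonal to each p_m with m < j, because
    [Hop] is self-adjoint and does not raise degrees. So its norm is zero, and p_j is an
    eigenfunction on the nodes. *)
Lemma resid_zero j k : (j <= N)%nat -> (k < j)%nat -> resid j k = 0.
Proof.
  intros Hj. revert k. apply ef_independent; [lia|].
  intros x Hx. rewrite <- Hop_resid.
  set (u := fun x => Hop (op W j) x + lam j * op W j x).
  assert (Hu : inspan N INR W j u).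
  { apply inspan_ext with (fun x => bsum j (fun k => resid j k * ef k x)).
    - intros y. symmetry. apply Hop_resid.
    - apply inspan_bsum. intros k Hk. apply inspan_widen with (S k); [lia|apply ef_inspan]. }
  assert (Hum : forall m, (m < j)%nat -> ip N W u (op W m) = 0).
  { intros m Hm.
    replace (ip N W u (op W m))
      with (ip N W (Hop (op W j)) (op W m) + lam j * ip N W (op W j) (op W m))
      by (rewrite !ip_def, <- bsum_scal, <- bsum_plus; apply bsum_ext; intros; unfold u; ring).
    rewrite Hop_selfadjoint, (ip_sym N W (op W j)).
    rewrite (ip_inspan N INR 1 one_pos nd_id W (S m) _ j W_hahn_pos (Hop_op_inspan m)) by lia.
    rewrite (op_orth N INR 1 one_pos nd_id W W_hahn_pos j m) by lia. ring. }
  assert (Huu : ip N W u u = 0).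
  { destruct Hu as [a Ha].
    rewrite (ip_ext N W u (fun i => bsum j (fun k => a k * op W k i)) u u); auto.
    rewrite ip_bsum. apply bsum_zero. intros m Hm. rewrite ip_sym, Hum by exact Hm. ring. }
  destruct (Req_dec (u x) 0) as [E|E]; [exact E|].
  exfalso. assert (P := ip_pos N W W_hahn_pos u x Hx E). lra.
Qed.

(** Since the operator is bidiagonal, the eigenvalue equation is a two-term recurrence descending
    from [kap j j = 1]. The positivity assumption keeps the gap [lam j - lam k] away from 0. *)
Lemma kap_ratio j k : (j <= N)%nat -> (k < j)%nat -> 0 < INR j + INR k + alpha + beta + 1 ->
  kap j k = - mu (S k) * kap j (S k) / ((INR j - INR k) * (INR j + INR k + alpha + beta + 1)).
Proof.
  intros Hj Hk Hp. assert (H := resid_zero j k Hj Hk). unfold resid in H.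
  replace (lam j - lam k) with ((INR j - INR k) * (INR j + INR k + alpha + beta + 1)) in H
    by (unfold lam; ring).
  assert (INR k + 1 <= INR j) by (rewrite <- S_INR; apply le_INR; lia).
  assert (Q : 0 < (INR j - INR k) * (INR j + INR k + alpha + beta + 1))
    by (apply Rmult_lt_0_compat; lra).
  apply Rmult_eq_reg_r with ((INR j - INR k) * (INR j + INR k + alpha + beta + 1)); [|lra].
  unfold Rdiv. rewrite Rmult_assoc, Rinv_l by lra. lra.
Qed.

Lemma kap_sub j : (1 <= j <= N)%nat -> 0 < 2 * INR j + alpha + beta ->
  kap j (pred j) = - (INR j * (INR N - INR j + 1) * (alpha + INR j)) / (2 * INR j + alpha + beta).
Proof.
  intros Hj Hp. destruct j as [|j]; [lia|]. simpl pred. rewrite S_INR in *.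
  rewrite kap_ratio, kap_diag by (try lia; rewrite S_INR; lra).
  unfold mu. rewrite !S_INR. field. lra.
Qed.

Lemma kap_sub2 j : (2 <= j <= N)%nat -> 0 < 2 * INR j + alpha + beta - 1 ->
  kap j (pred (pred j))
  = - (INR j - 1) * (INR N - INR j + 2) * (alpha + INR j - 1) * kap j (pred j)
    / (2 * (2 * INR j + alpha + beta - 1)).
Proof.
  intros Hj Hp. destruct j as [|[|j]]; [lia|lia|]. simpl pred. rewrite !S_INR in *.
  rewrite kap_ratio by (try lia; rewrite !S_INR; lra).
  unfold mu. rewrite !S_INR. field. lra.
Qed.

(** Comparing the coefficients of [ef j] in the recurrence for p_{j+1} gives b_j = j + kap_j(j-1) -
    kap_{j+1}(j). *)
Lemma hahn_bc j : (1 <= j < N)%nat -> 0 < 2 * INR j + alpha + beta ->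
  let x := INR j in
  bc W j = (x + alpha + beta + 1) * (x + alpha + 1) * (INR N - x)
             / ((2 * x + alpha + beta + 1) * (2 * x + alpha + beta + 2))
           + x * (x + alpha + beta + INR N + 1) * (x + beta)
             / ((2 * x + alpha + beta) * (2 * x + alpha + beta + 1)).
Proof.
  intros Hj Hp x. subst x.
  assert (E := kap_S N W INR j j). rewrite kap_diag, (kap_gt N W INR (pred j) j) in E by lia.
  assert (E1 := kap_sub (S j) ltac:(lia)). simpl pred in E1. rewrite S_INR in E1.
  assert (E2 := kap_sub j ltac:(lia) Hp).
  replace (match j with O => 0 | S k' => kap j k' end) with (kap j (pred j)) in E
    by (destruct j; [lia|reflexivity]).
  rewrite E1, E2 in E by lra.
  replace (bc W j) with (INR j + - (INR j * (INR N - INR j + 1) * (alpha + INR j)) / (2 * INR j + alpha + beta)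
    - - ((INR j + 1) * (INR N - (INR j + 1) + 1) * (alpha + (INR j + 1))) / (2 * (INR j + 1) + alpha + beta))
    by lra.
  field. lra.
Qed.

(** The same comparison one degree lower, at [ef (pred j)], with b_j already known. *)
Lemma hahn_ac j : (2 <= j < N)%nat -> 0 < 2 * INR j + alpha + beta - 1 ->
  let x := INR j in
  ac W j = (x + alpha + beta) * (x + alpha) * (INR N - x + 1)
             / ((2 * x + alpha + beta - 1) * (2 * x + alpha + beta))
           * (x * (x + alpha + beta + INR N + 1) * (x + beta)
             / ((2 * x + alpha + beta) * (2 * x + alpha + beta + 1))).
Proof.
  intros Hj Hp x. subst x.
  assert (E := kap_S N W INR j (pred j)).
  assert (E0 := kap_sub (S j) ltac:(lia)). simpl pred in E0. rewrite S_INR in E0.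
  assert (E1 := kap_sub2 (S j) ltac:(lia)). simpl pred in E1. rewrite S_INR in E1.
  rewrite E0 in E1 by lra.
  assert (E2 := kap_sub j ltac:(lia) ltac:(lra)).
  assert (E3 := kap_sub2 j ltac:(lia) Hp).
  replace (match pred j with O => 0 | S k' => kap j k' end) with (kap j (pred (pred j))) in E
    by (destruct j as [|[|j]]; [lia|lia|reflexivity]).
  replace (INR (pred j)) with (INR j - 1) in E
    by (destruct j; [lia|rewrite S_INR; simpl pred; ring]).
  rewrite kap_diag, E1, E3, E2, (hahn_bc j) in E by (try lia; lra).
  rewrite Rmult_1_r in E.
  match type of E with ?L = ?X + ?Y - _ => replace (ac W j) with (X + Y - L) by lra end.
  field. lra.
Qed.

End Hahn.

Lemma is_lim_seq_ratio (x y : nat -> R) (lx ly : R) :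
  is_lim_seq x lx -> is_lim_seq y ly -> ly <> 0 -> is_lim_seq (fun n => x n / y n) (lx / ly).
Proof. intros Hx Hy H. apply is_lim_seq_div'; auto. Qed.

(** A window holds 2d + 1 indices, each of the form n + i - d, so finitely many limits give
    uniformity. *)
Lemma eventually_window (F : nat -> nat -> R) (l : R) d eps : 0 < eps ->
  (forall i, is_lim_seq (fun n => F n (n + i - d)%nat) l) ->
  eventually (fun n => forall j, window n d j -> Rabs (F n j - l) <= eps).
Proof.
  intros Heps H.
  assert (E : forall m, eventually (fun n => forall i, (i < m)%nat ->
                 Rabs (F n (n + i - d)%nat - l) <= eps)).
  { induction m as [|m [n0 IH]]; [exists O; intros n _ i Hi; lia|].
    destruct (proj2 (is_lim_seq_spec _ _) (H m) (mkposreal eps Heps)) as [n1 H1]. simpl in H1.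
    exists (n0 + n1)%nat. intros n Hn i Hi. destruct (Nat.eq_dec i m) as [->|Hne].
    - left. apply H1; lia.
    - apply IH; lia. }
  destruct (E (2 * d + 1)%nat) as [n0 H0]. exists (n0 + d)%nat. intros n Hn j [H1 H2].
  replace j with (n + (j + d - n) - d)%nat by lia. apply H0; lia.
Qed.

Lemma is_lim_seq_inv_INR : is_lim_seq (fun n => 1 / INR n) 0.
Proof.
  apply is_lim_seq_ext with (fun n => / INR n).
  - intros n. unfold Rdiv. ring.
  - replace (Finite 0) with (Rbar_inv p_infty) by reflexivity.
    apply is_lim_seq_inv; [apply is_lim_seq_INR|discriminate].
Qed.

Lemma is_lim_seq_offset i d : is_lim_seq (fun n => INR (n + i - d) / INR n) 1.
Proof.
  apply is_lim_seq_ext_loc with (fun n => 1 + (INR i - INR d) * (1 / INR n)).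
  - exists (d + 1)%nat. intros n Hn. rewrite minus_INR, plus_INR by lia.
    assert (0 < INR n) by (apply lt_0_INR; lia). field. lra.
  - replace (Finite 1) with (Finite (1 + (INR i - INR d) * 0)) by (f_equal; ring).
    apply is_lim_seq_plus'; [apply is_lim_seq_const|].
    apply is_lim_seq_mult'; [apply is_lim_seq_const|apply is_lim_seq_inv_INR].
Qed.

(** * Limits of the Hahn recurrence coefficients *)

Section HahnLimits.

Variables A B t : R.
Hypothesis hA : 0 <= A.
Hypothesis hB : 0 <= B.
Hypothesis ht : 1 < t.
Variables alpha beta : nat -> R.
Variable Nn : nat -> nat.
Hypothesis halpha : forall n, -1 < alpha n.
Hypothesis hbeta : forall n, -1 < beta n.
Hypothesis lim_alpha : is_lim_seq (fun n => alpha n / INR n) A.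
Hypothesis lim_beta : is_lim_seq (fun n => beta n / INR n) B.
Hypothesis lim_N : is_lim_seq (fun n => INR (Nn n) / INR n) t.

Lemma Nn_large d : eventually (fun n => (n + d <= Nn n)%nat).
Proof.
  assert (L : is_lim_seq (fun n => INR (Nn n) / INR n - 1 - INR d * (1 / INR n)) (t - 1 - INR d * 0)).
  { apply is_lim_seq_minus'; [apply is_lim_seq_minus'; [exact lim_N|apply is_lim_seq_const]|].
    apply is_lim_seq_mult'; [apply is_lim_seq_const|apply is_lim_seq_inv_INR]. }
  assert (e : 0 < t - 1) by lra.
  destruct (proj2 (is_lim_seq_spec _ _) L (mkposreal _ e)) as [n0 H0]. simpl in H0.
  exists (n0 + 1)%nat. intros n Hn. specialize (H0 n ltac:(lia)).
  assert (Pn : 0 < INR n) by (apply lt_0_INR; lia).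
  apply INR_le. rewrite plus_INR.
  apply Rabs_lt_between in H0.
  assert (P : 0 < (INR (Nn n) / INR n - 1 - INR d * (1 / INR n)) * INR n)
    by (apply Rmult_lt_0_compat; lra).
  replace ((INR (Nn n) / INR n - 1 - INR d * (1 / INR n)) * INR n)
    with (INR (Nn n) - INR n - INR d) in P by (field; lra).
  lra.
Qed.

Ltac lims := repeat first
  [ apply is_lim_seq_offset | apply is_lim_seq_inv_INR | exact lim_alpha | exact lim_beta
  | exact lim_N | apply is_lim_seq_const
  | apply is_lim_seq_minus' | apply is_lim_seq_plus' | apply is_lim_seq_mult' ].

(** Dividing every linear factor by n leaves a fixed rational function of convergent ratios. The
    final division by [T n] reflects the nodes i/N. *)
Lemma hahn_bc_limit i d : is_lim_seq
  (fun n => bc (Nn n) (node (Nn n)) (hahn_weight (Nn n) (alpha n) (beta n)) (n + i - d))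
  (b_par A B t).
Proof.
  set (u := fun n => INR (n + i - d) / INR n).
  set (p := fun n => alpha n / INR n). set (q := fun n => beta n / INR n).
  set (T := fun n => INR (Nn n) / INR n). set (e := fun n => 1 / INR n).
  apply is_lim_seq_ext_loc with (fun n =>
    (((u n + p n + q n + e n) * (u n + p n + e n) * (T n - u n))
      / ((2 * u n + p n + q n + e n) * (2 * u n + p n + q n + 2 * e n))
     + u n * (u n + p n + q n + T n + e n) * (u n + q n)
      / ((2 * u n + p n + q n) * (2 * u n + p n + q n + e n))) / T n).
  - destruct (Nn_large (i + 1)) as [n0 H0].
    exists (n0 + d + 3)%nat. intros n Hn. specialize (H0 n ltac:(lia)).
    assert (Pn : 0 < INR n) by (apply lt_0_INR; lia).
    assert (PN : 0 < INR (Nn n)) by (apply lt_0_INR; lia).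
    assert (Px : 3 <= INR (n + i - d)) by (replace 3 with (INR 3) by (simpl; ring); apply le_INR; lia).
    assert (Ha := halpha n). assert (Hb := hbeta n).
    rewrite (bc_scale (Nn n) INR (/ INR (Nn n)) (Rinv_0_lt_compat _ PN)).
    rewrite hahn_bc; [|exact Ha|exact Hb|lia|lra].
    unfold u, p, q, T, e. set (x := INR (n + i - d)) in *.
    field. repeat split; lra.
  - evar_last.
    + apply is_lim_seq_ratio; [apply is_lim_seq_plus'; apply is_lim_seq_ratio| |]; unfold u, p, q, T, e; lims.
      all: try (apply Rgt_not_eq; lra).
      all: try (apply Rgt_not_eq, Rmult_lt_0_compat; lra).
    + f_equal. unfold b_par. field. repeat split; lra.
Qed.

Lemma hahn_ac_limit i d : is_lim_seq
  (fun n => ac (Nn n) (node (Nn n)) (hahn_weight (Nn n) (alpha n) (beta n)) (n + i - d))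
  (a_par A B t ^ 2).
Proof.
  set (u := fun n => INR (n + i - d) / INR n).
  set (p := fun n => alpha n / INR n). set (q := fun n => beta n / INR n).
  set (T := fun n => INR (Nn n) / INR n). set (e := fun n => 1 / INR n).
  apply is_lim_seq_ext_loc with (fun n =>
    ((u n + p n + q n) * (u n + p n) * (T n - u n + e n))
      / ((2 * u n + p n + q n - e n) * (2 * u n + p n + q n))
     * (u n * (u n + p n + q n + T n + e n) * (u n + q n)
      / ((2 * u n + p n + q n) * (2 * u n + p n + q n + e n))) / (T n * T n)).
  - destruct (Nn_large (i + 1)) as [n0 H0].
    exists (n0 + d + 3)%nat. intros n Hn. specialize (H0 n ltac:(lia)).
    assert (Pn : 0 < INR n) by (apply lt_0_INR; lia).
    assert (PN : 0 < INR (Nn n)) by (apply lt_0_INR; lia).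
    (* An index of at least 3 keeps every denominator positive, the smallest being 2x + alpha + beta
       - 1 with alpha, beta > -1. *)
    assert (Px : 3 <= INR (n + i - d)) by (replace 3 with (INR 3) by (simpl; ring); apply le_INR; lia).
    assert (Ha := halpha n). assert (Hb := hbeta n).
    rewrite (ac_scale (Nn n) INR (/ INR (Nn n)) (Rinv_0_lt_compat _ PN)).
    rewrite hahn_ac; [|exact Ha|exact Hb|lia|lra].
    unfold u, p, q, T, e. set (x := INR (n + i - d)) in *.
    field. repeat split; lra.
  - evar_last.
    + apply is_lim_seq_ratio; [apply is_lim_seq_mult'; apply is_lim_seq_ratio| |];
        unfold u, p, q, T, e; lims.
      all: try (apply Rgt_not_eq; lra).
      all: try (apply Rgt_not_eq, Rmult_lt_0_compat; lra).
    + f_equal. unfold a_par, Rdiv. rewrite Rpow_mult_distr, pow2_sqrt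
        by (left; repeat apply Rmult_lt_0_compat; lra).
      field. repeat split; lra.
Qed.

Lemma hahn_initial_limits d eps : 0 < eps -> eventually (fun n => forall j, window n d j ->
  Rabs (bc (Nn n) (node (Nn n)) (hahn_weight (Nn n) (alpha n) (beta n)) j - b_par A B t) <= eps /\
  Rabs (ac (Nn n) (node (Nn n)) (hahn_weight (Nn n) (alpha n) (beta n)) j - a_par A B t ^ 2) <= eps).
Proof.
  intros Heps.
  destruct (eventually_window
    (fun n j => bc (Nn n) (node (Nn n)) (hahn_weight (Nn n) (alpha n) (beta n)) j)
    _ d eps Heps (fun i => hahn_bc_limit i d)) as [n0 H0].
  destruct (eventually_window
    (fun n j => ac (Nn n) (node (Nn n)) (hahn_weight (Nn n) (alpha n) (beta n)) j)
    _ d eps Heps (fun i => hahn_ac_limit i d)) as [n1 H1].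
  exists (n0 + n1)%nat. intros n Hn j Hj. split; [apply H0|apply H1]; auto; lia.
Qed.

End HahnLimits.

(* Cauchy-Schwarz for the vectors (sqrt v, sqrt w) and (sqrt (u (t - 1)), sqrt (u + t)), with
   u = 1 + A + B, v = 1 + A, w = 1 + B. *)
Lemma support_bound A B t : 0 <= A -> 0 <= B -> 1 < t ->
  0 < a_par A B t /\ 0 <= b_par A B t - 2 * a_par A B t /\ b_par A B t + 2 * a_par A B t <= 1.
Proof.
  intros hA hB ht. unfold a_par, b_par.
  set (s := 2 + A + B). assert (Hsp : 0 < s) by (unfold s; lra).
  assert (Hs : 0 < t * s ^ 2) by (apply Rmult_lt_0_compat; [lra|apply pow_lt; unfold s; lra]).
  set (X := (t - 1) * (1 + A + B) * (1 + A)). set (Y := (1 + A + B + t) * (1 + B)).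
  assert (HX : 0 < X) by (unfold X; repeat apply Rmult_lt_0_compat; lra).
  assert (HY : 0 < Y) by (unfold Y; repeat apply Rmult_lt_0_compat; lra).
  replace (X * (1 + A + B + t) * (1 + B)) with (X * Y) by (unfold Y; ring).
  assert (HXY : 0 < X * Y) by now apply Rmult_lt_0_compat.
  split; [apply Rdiv_lt_0_compat; [now apply sqrt_lt_R0|exact Hs]|].
  split.
  - replace ((X + Y) / (t * s ^ 2) - 2 * (sqrt (X * Y) / (t * s ^ 2)))
      with ((X + Y - 2 * sqrt (X * Y)) / (t * s ^ 2)) by (field; lra).
    apply Rmult_le_pos; [|left; now apply Rinv_0_lt_compat].
    rewrite sqrt_mult by lra.
    assert (E1 := sqrt_sqrt X (Rlt_le _ _ HX)). assert (E2 := sqrt_sqrt Y (Rlt_le _ _ HY)).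
    assert (P := pow2_ge_0 (sqrt X - sqrt Y)). simpl in P. lra.
  - apply Rmult_le_reg_r with (t * s ^ 2); [exact Hs|].
    replace (((X + Y) / (t * s ^ 2) + 2 * (sqrt (X * Y) / (t * s ^ 2))) * (t * s ^ 2))
      with (X + Y + 2 * sqrt (X * Y)) by (field; lra).
    rewrite Rmult_1_l.
    (* P Q regroups the product X Y so that the arithmetic-geometric inequality is sharp enough: X +
       Y + P + Q factors as (v + w) t (u + 1), which is t s^2. *)
    set (P := (1 + B) * (1 + A + B) * (t - 1)). set (Q := (1 + A) * (1 + A + B + t)).
    assert (HP : 0 <= P) by (unfold P; left; repeat apply Rmult_lt_0_compat; lra).
    assert (HQ : 0 <= Q) by (unfold Q; left; repeat apply Rmult_lt_0_compat; lra).
    replace (X * Y) with (P * Q) by (unfold X, Y, P, Q; ring).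
    rewrite sqrt_mult by lra.
    assert (2 * (sqrt P * sqrt Q) <= P + Q).
    { assert (E1 := sqrt_sqrt P HP). assert (E2 := sqrt_sqrt Q HQ).
      assert (E := pow2_ge_0 (sqrt P - sqrt Q)). simpl in E. lra. }
    apply Rle_trans with (X + Y + (P + Q)); [lra|].
    unfold X, Y, P, Q, s. right. ring.
Qed.

(** * Heine's formula *)

Lemma fold_right_seq_bsum (F : nat -> R) m n :
  fold_right Rplus 0 (map F (seq m n)) = bsum n (fun i => F (m + i)%nat).
Proof.
  revert m; induction n as [|n IH]; intros m; [reflexivity|].
  rewrite bsum_S_l. simpl. rewrite IH, Nat.add_0_r. f_equal.
  apply bsum_ext; intros i _. f_equal; lia.
Qed.

Lemma sum_config_S n N F :
  sum_config (S n) N F = bsum (S N) (fun x => sum_config n N (fun l => F (x :: l))).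
Proof.
  exact (fold_right_seq_bsum (fun x => sum_config n N (fun l => F (x :: l))) 0 (S N)).
Qed.

Lemma sum_config_ext n N F G :
  (forall l, length l = n -> F l = G l) -> sum_config n N F = sum_config n N G.
Proof.
  revert F G; induction n as [|n IH]; intros F G H; [exact (H nil eq_refl)|].
  rewrite !sum_config_S. apply bsum_ext; intros x _. apply IH. intros l Hl. apply H.
  simpl; now rewrite Hl.
Qed.

Lemma sum_config_scal n N c F : sum_config n N (fun l => c * F l) = c * sum_config n N F.
Proof.
  revert F; induction n as [|n IH]; intros F; [reflexivity|].
  rewrite !sum_config_S, <- bsum_scal. apply bsum_ext; intros x _. apply IH.
Qed.

Lemma sum_config_plus n N F G :
  sum_config n N (fun l => F l + G l) = sum_config n N F + sum_config n N G.
Proof.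
  revert F G; induction n as [|n IH]; intros F G; [reflexivity|].
  rewrite !sum_config_S, <- bsum_plus. apply bsum_ext; intros x _. apply IH.
Qed.

Lemma sum_config_zero n N : sum_config n N (fun _ => 0) = 0.
Proof.
  induction n as [|n IH]; [reflexivity|]. rewrite sum_config_S. apply bsum_zero; auto.
Qed.

Module HeineFormula.
Import all_boot all_order all_fingroup all_algebra Rstruct.
Import GRing.Theory.
Local Open Scope ring_scope.

Lemma bsumE n (F : nat -> R) : bsum n F = \sum_(i < n) F i.
Proof. by elim: n => [|n IH] /=; rewrite ?big_ord0 // big_ord_recr /= IH. Qed.

Lemma sum_config_sum n N (I : finType) (F : I -> list nat -> R) :
  sum_config n N (fun l => \sum_(i : I) F i l) = \sum_(i : I) sum_config n N (F i).
Proof.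
elim: (index_enum I) => [|i s IH].
  rewrite big_nil -[RHS](sum_config_zero n N).
  by apply: sum_config_ext => l _; rewrite big_nil.
rewrite big_cons -IH -[RHS]sum_config_plus.
by apply: sum_config_ext => l _; rewrite big_cons.
Qed.

Lemma sum_config_prod n N (g : 'I_n -> nat -> R) :
  sum_config n N (fun l => \prod_(i < n) g i (nth O l i))
  = \prod_(i < n) bsum (S N) (g i).
Proof.
elim: n g => [|n IH] g; first by rewrite /= !big_ord0.
rewrite sum_config_S big_ord_recl -IH.
rewrite [RHS]mulrC -[RHS]bsum_scal.
apply: bsum_ext => x _; rewrite [RHS]Rmult_comm -[RHS]sum_config_scal.
by apply: sum_config_ext => l _; rewrite big_ord_recl.
Qed.

Lemma prod_list n (W : nat -> R) l : length l = n ->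
  fold_right Rmult 1 (map W l) = \prod_(i < n) W (nth O l i).
Proof.
elim: n l => [|n IH] [|x l] //=; first by rewrite big_ord0.
by case=> /IH ->; rewrite big_ord_recl.
Qed.

Lemma vdm_sq_prod n l : length l = n ->
  vdm_sq l = (\prod_(i < n) \prod_(j < n | (i < j)%N) (INR (nth O l j) - INR (nth O l i))) ^+ 2.
Proof.
elim: n l => [|n IH] [|x l] //=; first by rewrite big_ord0 expr1n.
case=> Hl; rewrite (IH l Hl) big_ord_recl exprMn; congr (_ * _).
  rewrite big_mkcond big_ord_recl /= mul1r -prodrXl.
  rewrite (prod_list _ (fun y => pow (Rminus (INR x) (INR y)) 2) _ Hl).
  by apply: eq_bigr => i _; rewrite RpowE RminusE -sqrrN opprB.
congr (_ ^+ 2); apply: eq_bigr => i _.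
by rewrite [RHS]big_mkcond big_ord_recl /= mul1r -big_mkcond.
Qed.

(** Passing from monomials to the P_j multiplies the Vandermonde matrix by a unit triangular one,
    which leaves the determinant unchanged. *)
Lemma vdm_sq_det n (P kap : nat -> nat -> R) l :
  (forall j x, (j < n)%N -> P j x = bsum n (fun k => Rmult (kap j k) (pow (INR x) k))) ->
  (forall j, kap j j = 1) -> (forall j k, (j < k)%N -> kap j k = 0) -> length l = n ->
  vdm_sq l = (\det (\matrix_(i < n, j < n) P i (nth O l j))) ^+ 2.
Proof.
move=> HP Hd Ht Hl; rewrite (vdm_sq_prod _ _ Hl).
have -> : \matrix_(i < n, j < n) P i (nth O l j)
    = (\matrix_(i < n, k < n) kap i k) *m Vandermonde n (\row_(j < n) INR (nth O l j)).
  apply/matrixP => i j; rewrite !mxE HP // bsumE.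
  by apply: eq_bigr => k _; rewrite !mxE RpowE.
rewrite det_mulmx det_trig; last by apply/is_trig_mxP => i j ij; rewrite mxE Ht.
have -> : \prod_(i < n) (\matrix_(i < n, k < n) kap i k) i i = 1.
  by rewrite big1 // => i _; rewrite mxE Hd.
rewrite mul1r det_Vandermonde; congr (_ ^+ 2).
by apply: eq_bigr => i _; apply: eq_bigr => j _; rewrite !mxE.
Qed.

(** Both determinants are expanded over permutations s and t, and the sum over configurations
    factors into one inner product per coordinate. Orthogonality forces t = s, and each of the n!
    remaining terms is the product of the norms. *)
Lemma heine n N (W : nat -> R) (P kap : nat -> nat -> R) (h : nat -> R) :
  (forall j x, (j < n)%N -> P j x = bsum n (fun k => Rmult (kap j k) (pow (INR x) k))) ->
  (forall j, kap j j = 1) -> (forall j k, (j < k)%N -> kap j k = 0) ->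
  (forall j k, (j < n)%N -> (k < n)%N -> ip N W (P j) (P k) = if j == k then h j else 0) ->
  sum_config n N (fun l => Rmult (vdm_sq l) (fold_right Rmult 1 (map W l)))
  = (n`!)%:R * \prod_(j < n) h j.
Proof.
move=> HP Hd Ht Ho.
transitivity (sum_config n N (fun l => \sum_(s : 'S_n) \sum_(t : 'S_n)
    ((-1) ^+ s * (-1) ^+ t) *
    \prod_(i < n) (W (nth O l i) * (P (s i) (nth O l i) * P (t i) (nth O l i))))).
  apply: sum_config_ext => l Hl.
  rewrite (vdm_sq_det n P kap l HP Hd Ht Hl) (prod_list n W l Hl) -det_tr.
  rewrite expr2 /determinant RmultE mulr_suml mulr_suml; apply: eq_bigr => s _.
  rewrite mulr_sumr mulr_suml; apply: eq_bigr => t _.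
  rewrite mulrACA -[LHS]mulrA -!big_split /=; congr (_ * _).
  by apply: eq_bigr => i _; rewrite !mxE mulrC.
rewrite sum_config_sum.
transitivity (\sum_(s : 'S_n) \prod_(j < n) h j); last first.
  by rewrite sumr_const card_Sn mulr_natl.
have E (s t : 'S_n) : sum_config n N (fun l => ((-1) ^+ s * (-1) ^+ t) *
    \prod_(i < n) (W (nth O l i) * (P (s i) (nth O l i) * P (t i) (nth O l i))))
    = ((-1) ^+ s * (-1) ^+ t) * \prod_(i < n) ip N W (P (s i)) (P (t i)).
  rewrite sum_config_scal; congr (_ * _).
  exact: (sum_config_prod n N (fun i x => W x * (P (s i) x * P (t i) x))).
apply: eq_bigr => s _; rewrite sum_config_sum (bigD1 s) //= [X in _ + X]big1 ?addr0.
  rewrite E -signr_addb addbb expr0 mul1r [RHS](reindex_inj (@perm_inj _ s)) /=.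
  by apply: eq_bigr => i _; rewrite Ho // eqxx.
move=> t ts; rewrite E.
have [i si] : exists i, s i != t i.
  apply/existsP; apply: contraNT ts; rewrite negb_exists => /forallP H.
  apply/eqP/permP => i; apply/esym/eqP; move: (H i); by rewrite negbK.
by rewrite (bigD1 i) //= Ho // ifN // mul0r mulr0.
Qed.

Lemma prod_exp_ln n (h : nat -> R) : (forall j, lt j n -> Rlt 0 (h j)) ->
  \prod_(j < n) h j = exp (bsum n (fun j => ln (h j))).
Proof.
elim: n => [|n IH] Hh; first by rewrite big_ord0 exp_0.
rewrite big_ord_recr /= exp_plus exp_ln ?IH // => [j jn|]; apply: Hh; lia.
Qed.

(** A restatement with [lt], [IZR] and an exponential of logarithms, ready for use outside the
    algebraic notations of the module. *)
Lemma heine_exp n N (W : nat -> R) (P kap : nat -> nat -> R) (h : nat -> R) :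
  (forall j x, lt j n -> P j x = bsum n (fun k => Rmult (kap j k) (pow (INR x) k))) ->
  (forall j, kap j j = IZR 1) -> (forall j k, lt j k -> kap j k = IZR 0) ->
  (forall j, lt j n -> Rlt (IZR 0) (h j)) ->
  (forall j, lt j n -> ip N W (P j) (P j) = h j) ->
  (forall j k, lt j n -> lt k n -> j <> k -> ip N W (P j) (P k) = IZR 0) ->
  sum_config n N (fun l => Rmult (vdm_sq l) (fold_right Rmult (IZR 1) (map W l)))
  = Rmult (INR (Factorial.fact n)) (exp (bsum n (fun j => ln (h j)))).
Proof.
move=> HP Hd Ht Hh Hjj Hjk.
rewrite (heine n N W P kap h) ?prod_exp_ln ?factE ?INRE //.
- by move=> j x /ltP; exact: HP.
- by move=> j k /ltP; exact: Ht.
- move=> j k /ltP jn /ltP kn; case: eqP => [<-|jk]; [exact: Hjj|exact: Hjk].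
Qed.

End HeineFormula.

Lemma hn_pos_INR N W j : (forall i, (i <= N)%nat -> 0 < W i) -> (j <= N)%nat -> 0 < hn N INR W j.
Proof. intros HW Hj. apply (hn_pos N INR 1 Rlt_0_1 (fun i => eq_sym (Rmult_1_l _)) W HW j Hj). Qed.

Lemma nb_0 k x : nb (fun _ => 0) k x = INR x ^ k.
Proof. induction k as [|k IH]; simpl; [reflexivity|]. rewrite IH. ring. Qed.

Lemma heine_hn n N W : (n <= S N)%nat -> (forall i, (i <= N)%nat -> 0 < W i) ->
  sum_config n N (fun l => vdm_sq l * fold_right Rmult 1 (map W l))
  = INR (fact n) * exp (bsum n (fun j => ln (hn N INR W j))).
Proof.
  intros Hn HW.
  apply (HeineFormula.heine_exp n N W (op N INR W) (kap N W (fun _ => 0))).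
  - intros j x Hj. rewrite (op_kap N W (fun _ => 0) j n x Hj).
    apply bsum_ext; intros k _. now rewrite nb_0.
  - apply kap_diag.
  - apply kap_gt.
  - intros j Hj. apply hn_pos_INR; [exact HW|lia].
  - reflexivity.
  - intros j k Hj Hk Hjk.
    apply (op_orth N INR 1 Rlt_0_1 (fun i => eq_sym (Rmult_1_l _)) W HW); lia.
Qed.

(** * Expectations and the moment generating function *)

Lemma sum_config_le n N F G :
  (forall l, length l = n -> List.Forall (fun x => (x <= N)%nat) l -> F l <= G l) ->
  sum_config n N F <= sum_config n N G.
Proof.
  revert F G; induction n as [|n IH]; intros F G H; [exact (H nil eq_refl (List.Forall_nil _))|].
  rewrite !sum_config_S. apply bsum_le; intros x Hx. apply IH. intros l Hl HF. apply H.
  - simpl; now rewrite Hl.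
  - constructor; [lia|exact HF].
Qed.

Lemma is_derive_sum_config n N (F : R -> list nat -> R) dF s :
  (forall l, is_derive (fun s => F s l) s (dF l)) ->
  is_derive (fun s => sum_config n N (F s)) s (sum_config n N dF).
Proof.
  revert F dF; induction n as [|n IH]; intros F dF H; [apply H|].
  rewrite sum_config_S.
  apply is_derive_ext with (fun s => bsum (S N) (fun x => sum_config n N (fun l => F s (x :: l)))).
  - intros u. now rewrite sum_config_S.
  - apply (is_derive_bsum (S N) (fun x s => sum_config n N (fun l => F s (x :: l)))).
    intros x _. apply (IH (fun s l => F s (x :: l))). intros l. apply H.
Qed.

Lemma vdm_sq_nonneg l : 0 <= vdm_sq l.
Proof.
  induction l as [|x r IH]; simpl vdm_sq; [lra|]. apply Rmult_le_pos; [|exact IH].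
  clear IH. induction r as [|y r IH]; [simpl; lra|].
  simpl fold_right. apply Rmult_le_pos; [apply pow2_ge_0|exact IH].
Qed.

Lemma lin_stat_scal s f N l : lin_stat (fun x => s * f x) N l = s * lin_stat f N l.
Proof. unfold lin_stat. induction l as [|x l IH]; simpl in *; [ring|rewrite IH; ring]. Qed.

Lemma lin_stat_plus f g N l : lin_stat (fun x => f x + g x) N l = lin_stat f N l + lin_stat g N l.
Proof. unfold lin_stat. induction l as [|x l IH]; simpl in *; [ring|rewrite IH; ring]. Qed.

Section Ensemble.

Variables n N : nat.
Hypothesis n_le_N : (n <= N)%nat.
Hypothesis N_pos : (0 < N)%nat.
Variables alpha beta : R.
Hypothesis alpha_gt : -1 < alpha.
Hypothesis beta_gt : -1 < beta.

Let w := hahn_weight N alpha beta.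
Notation Ex := (hahn_expect n N alpha beta).

Lemma c_node : 0 < / INR N.
Proof. apply Rinv_0_lt_compat, lt_0_INR, N_pos. Qed.

Lemma w_pos i : (i <= N)%nat -> 0 < w i.
Proof. intros _. now apply hahn_weight_pos. Qed.

Lemma hahn_density_nonneg l : 0 <= hahn_density N alpha beta l.
Proof.
  unfold hahn_density. apply Rmult_le_pos; [apply vdm_sq_nonneg|].
  induction l as [|x l IH]; simpl; [lra|].
  apply Rmult_le_pos; [left; now apply hahn_weight_pos|exact IH].
Qed.

Lemma partition_pos : 0 < sum_config n N (hahn_density N alpha beta).
Proof.
  unfold hahn_density. fold w. rewrite (heine_hn n N w ltac:(lia) w_pos).
  apply Rmult_lt_0_compat; [apply INR_fact_lt_0|apply exp_pos].
Qed.

Lemma Ex_le F G :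
  (forall l, length l = n -> List.Forall (fun x => (x <= N)%nat) l -> F l <= G l) -> Ex F <= Ex G.
Proof.
  intros H. unfold hahn_expect. apply Rmult_le_compat_r.
  - left; apply Rinv_0_lt_compat, partition_pos.
  - apply sum_config_le. intros l H1 H2. apply Rmult_le_compat_l; [apply hahn_density_nonneg|auto].
Qed.

Lemma Ex_ext F G :
  (forall l, length l = n -> List.Forall (fun x => (x <= N)%nat) l -> F l = G l) -> Ex F = Ex G.
Proof. intros H. apply Rle_antisym; apply Ex_le; intros l H1 H2; rewrite H by auto; lra. Qed.

Lemma Ex_plus F G : Ex (fun l => F l + G l) = Ex F + Ex G.
Proof.
  unfold hahn_expect. unfold Rdiv. rewrite <- Rmult_plus_distr_r, <- sum_config_plus. f_equal.
  apply sum_config_ext; intros; ring.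
Qed.

Lemma Ex_scal c F : Ex (fun l => c * F l) = c * Ex F.
Proof.
  unfold hahn_expect. unfold Rdiv. rewrite <- Rmult_assoc, <- sum_config_scal. f_equal.
  apply sum_config_ext; intros; ring.
Qed.

Lemma Ex_1 : Ex (fun _ => 1) = 1.
Proof.
  unfold hahn_expect. assert (P := partition_pos).
  rewrite (sum_config_ext n N (fun l => hahn_density N alpha beta l * 1) (hahn_density N alpha beta))
    by (intros; ring).
  field. lra.
Qed.

Section Statistic.

Variable f : R -> R.
Let fn i := f (node N i).
Let Ws := Wd w fn.

Definition logZ s := bsum n (fun j => ln (hn N (node N) (Ws s) j)).
Definition dlogZ s := bsum n (fun j => phi N (node N) fn (Ws s) j j / hn N (node N) (Ws s) j).

Lemma Ws_pos s i : (i <= N)%nat -> 0 < Ws s i.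
Proof. apply (Wd_pos N w w_pos). Qed.

Lemma is_derive_logZ s : is_derive logZ s (dlogZ s).
Proof.
  apply (is_derive_bsum n (fun j s => ln (hn N (node N) (Ws s) j))). intros j Hj.
  apply (is_derive_ln_hn N (node N) _ c_node (fun i => eq_refl) w w_pos fn); lia.
Qed.

Lemma is_derive_dlogZ s : is_derive dlogZ s (varK N (node N) fn (Ws s) n).
Proof.
  apply (is_derive_bsum n (fun j s => phi N (node N) fn (Ws s) j j / hn N (node N) (Ws s) j)).
  intros j Hj.
  apply (is_derive_ln_hn2 N (node N) _ c_node (fun i => eq_refl) w w_pos fn); lia.
Qed.

(** Heine's formula has the Vandermonde product of integers, while the variance bounds live on nodes
    i/N. Rescaling shifts the logarithm by a term free of s, which cancels in ratios. *)
Lemma logZ_INR s :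
  bsum n (fun j => ln (hn N INR (Ws s) j))
  = logZ s - bsum n (fun j => ln ((/ INR N) ^ j * (/ INR N) ^ j)).
Proof.
  unfold logZ. rewrite <- bsum_minus. apply bsum_ext; intros j Hj.
  assert (P : 0 < (/ INR N) ^ j) by (apply pow_lt, c_node).
  change (node N) with (fun i => / INR N * INR i).
  rewrite (hn_scale_of N INR (/ INR N) (Ws s) j)
    by (intros i; apply (op_scale N INR (/ INR N) c_node)).
  rewrite (ln_mult (_ * _)); [ring|now apply Rmult_lt_0_compat|].
  apply hn_pos_INR; [apply Ws_pos|lia].
Qed.

Lemma density_exp s l : hahn_density N alpha beta l * exp (s * lin_stat f N l)
  = vdm_sq l * fold_right Rmult 1 (map (Ws s) l).
Proof.
  unfold hahn_density. rewrite Rmult_assoc. f_equal. unfold lin_stat.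
  induction l as [|x l IH]; simpl; [rewrite Rmult_0_r, exp_0; ring|].
  rewrite <- IH. unfold Ws, Wd, fn, w, node.
  rewrite Rmult_plus_distr_l, exp_plus, (Rmult_comm (/ INR N)). unfold Rdiv. ring.
Qed.

Lemma sum_config_exp s :
  sum_config n N (fun l => hahn_density N alpha beta l * exp (s * lin_stat f N l))
  = INR (fact n) * exp (logZ s - bsum n (fun j => ln ((/ INR N) ^ j * (/ INR N) ^ j))).
Proof.
  rewrite <- logZ_INR, <- (heine_hn n N (Ws s)); [|lia|apply Ws_pos].
  apply sum_config_ext; intros l _. apply density_exp.
Qed.

Lemma Ex_exp s : Ex (fun l => exp (s * lin_stat f N l)) = exp (logZ s - logZ 0).
Proof.
  unfold hahn_expect. rewrite sum_config_exp.
  replace (sum_config n N (hahn_density N alpha beta))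
    with (sum_config n N (fun l => hahn_density N alpha beta l * exp (0 * lin_stat f N l)))
    by (apply sum_config_ext; intros; rewrite Rmult_0_l, exp_0; ring).
  rewrite sum_config_exp.
  set (K := bsum n _).
  replace (logZ s - K) with ((logZ s - logZ 0) + (logZ 0 - K)) by ring.
  rewrite exp_plus. assert (P := exp_pos (logZ 0 - K)). assert (Q := INR_fact_lt_0 n).
  field. lra.
Qed.

(** The moment generating function is differentiated at s = 0 in two ways: under the finite sum, and
    through [Ex_exp]. *)
Lemma Ex_lin_stat : Ex (lin_stat f N) = dlogZ 0.
Proof.
  assert (D1 : is_derive (fun s => Ex (fun l => exp (s * lin_stat f N l))) 0 (Ex (lin_stat f N))).
  { unfold hahn_expect.
    apply is_derive_ext with (fun s => / sum_config n N (hahn_density N alpha beta) *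
        sum_config n N (fun l => hahn_density N alpha beta l * exp (s * lin_stat f N l))).
    - intros s. unfold Rdiv. apply Rmult_comm.
    - unfold Rdiv. rewrite Rmult_comm. apply @is_derive_scal.
      apply (is_derive_sum_config n N (fun s l => hahn_density N alpha beta l * exp (s * lin_stat f N l))).
      intros l. evar_last.
      + apply @is_derive_scal. apply (is_derive_comp exp (fun s => s * lin_stat f N l));
          [apply is_derive_exp|].
        apply (is_derive_mult (fun s => s) (fun _ => lin_stat f N l));
          [apply @is_derive_id|apply @is_derive_const|intros; apply Rmult_comm].
      + unfold plus, mult, scal, zero, one; simpl. unfold mult; simpl.
        rewrite (Rmult_0_l (lin_stat f N l)), exp_0. ring. }
  assert (D2 : is_derive (fun s => Ex (fun l => exp (s * lin_stat f N l))) 0 (dlogZ 0)).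
  { apply is_derive_ext with (fun s => exp (logZ s - logZ 0)).
    - intros s. symmetry. apply Ex_exp.
    - evar_last.
      + apply (is_derive_comp exp (fun s => logZ s - logZ 0)); [apply is_derive_exp|].
        apply @is_derive_minus; [apply is_derive_logZ|apply @is_derive_const].
      + transitivity ((dlogZ 0 - 0) * exp (logZ 0 - logZ 0)); [reflexivity|].
        rewrite (Rminus_diag (logZ 0)), exp_0. ring. }
  rewrite <- (is_derive_unique _ _ _ D1). apply is_derive_unique, D2.
Qed.

Lemma mgf_center s :
  Ex (fun l => exp (s * (lin_stat f N l - Ex (lin_stat f N))))
  = exp (logZ s - logZ 0 - s * dlogZ 0).
Proof.
  rewrite Ex_lin_stat. unfold Rminus at 2. rewrite exp_plus, <- Ex_exp, Rmult_comm, <- Ex_scal.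
  apply Ex_ext. intros l _ _. rewrite <- exp_plus. f_equal. ring.
Qed.

(** The logarithm of the centered generating function vanishes at s = 0 with its first derivative.
    Integrating the second derivative twice over [0, 1] gives v / 2 with error eps / 2. *)
Lemma log_mgf_close v eps :
  (forall u, 0 <= u <= 1 -> Rabs (varK N (node N) fn (Ws u) n - v) <= eps) ->
  exists k, Ex (fun l => exp (lin_stat f N l - Ex (lin_stat f N))) = exp k
            /\ Rabs (k - v / 2) <= eps / 2.
Proof.
  intros H. exists (logZ 1 - logZ 0 - 1 * dlogZ 0). split.
  - rewrite <- mgf_center. apply Ex_ext. intros l _ _. f_equal. ring.
  - assert (D1 : forall s, 0 <= s <= 1 -> Rabs (dlogZ s - dlogZ 0 - s * v) <= eps * s).
    { intros s Hs.
      replace (dlogZ s - dlogZ 0 - s * v)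
        with ((dlogZ s - s * v) - (dlogZ 0 - 0 * v)) by ring.
      replace (eps * s) with (eps * s - eps * 0) by ring.
      apply (Rabs_increment_le (fun s => dlogZ s - s * v) (fun s => eps * s)
               (fun u => varK N (node N) fn (Ws u) n - v) (fun _ => eps)); [lra| | |].
      - intros u _. apply @is_derive_minus; [apply is_derive_dlogZ|].
        auto_derive; [exact I|ring].
      - intros u _. auto_derive; [exact I|ring].
      - intros u Hu. apply H. lra. }
    replace (logZ 1 - logZ 0 - 1 * dlogZ 0 - v / 2)
      with ((logZ 1 - 1 * dlogZ 0 - 1 ^ 2 * v / 2) - (logZ 0 - 0 * dlogZ 0 - 0 ^ 2 * v / 2)) by field.
    replace (eps / 2) with (eps * 1 ^ 2 / 2 - eps * 0 ^ 2 / 2) by field.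
    apply (Rabs_increment_le (fun s => logZ s - s * dlogZ 0 - s ^ 2 * v / 2)
             (fun s => eps * s ^ 2 / 2)
             (fun u => dlogZ u - dlogZ 0 - u * v) (fun u => eps * u)); [lra| | |].
    + intros u _. apply @is_derive_minus; [apply @is_derive_minus|].
      * apply is_derive_logZ.
      * auto_derive; [exact I|ring].
      * auto_derive; [exact I|field].
    + intros u _. auto_derive; [exact I|field].
    + exact D1.
Qed.

(** Throughout the deformation the variance lies in [0, L^2], that is, within L^2 / 2 of L^2 / 2.
    The lower bound 1 is Jensen's inequality for a centered statistic, needed in [mgf_close]. *)
Lemma mgf_lipschitz L : 0 <= L ->
  (forall x y, in01 x -> in01 y -> Rabs (f x - f y) <= L * Rabs (x - y)) ->
  1 <= Ex (fun l => exp (lin_stat f N l - Ex (lin_stat f N))) <= exp (L ^ 2).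
Proof.
  intros HL H.
  destruct (log_mgf_close (L ^ 2 / 2) (L ^ 2 / 2)) as [k [-> Hk]].
  - intros u _.
    assert (V1 := varK_nonneg N (node N) _ c_node (fun i => eq_refl) (Ws u) (Ws_pos u) fn n ltac:(lia)).
    assert (V2 := varK_lipschitz N (node N) _ c_node (fun i => eq_refl) (Ws u) (Ws_pos u) fn L n
                    (node_bounds N) n_le_N HL).
    apply Rabs_le. split; [lra|].
    assert (varK N (node N) fn (Ws u) n <= L ^ 2); [|lra].
    apply V2. intros x y Hx Hy. apply H; now apply node_bounds.
  - apply Rabs_le_between in Hk. split.
    + rewrite <- exp_0. assert (0 <= k) by lra. destruct H0 as [H0| <-]; [left; now apply exp_increasing|lra].
    + assert (k <= L ^ 2) by (assert (0 <= L ^ 2) by apply pow2_ge_0; lra).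
      destruct H0 as [H0| ->]; [left; now apply exp_increasing|lra].
Qed.

End Statistic.

End Ensemble.

(** * Polynomial approximation *)

(** The Bernstein operator in a form that conditions on the first of n trials, so that no binomial
    coefficients appear. *)
Fixpoint bern (n : nat) (p : nat -> R) (x : R) : R :=
  match n with
  | O => p O
  | S n => x * bern n (fun k => p (S k)) x + (1 - x) * bern n p x
  end.

Lemma bern_plus n p q x : bern n (fun k => p k + q k) x = bern n p x + bern n q x.
Proof. revert p q; induction n as [|n IH]; intros p q; simpl; [ring|rewrite !IH; ring]. Qed.

Lemma bern_scal n c p x : bern n (fun k => c * p k) x = c * bern n p x.
Proof. revert p; induction n as [|n IH]; intros p; simpl; [ring|rewrite !IH; ring]. Qed.

Lemma bern_const n c x : bern n (fun _ => c) x = c.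
Proof. induction n as [|n IH]; simpl; [ring|rewrite !IH; ring]. Qed.

Lemma bern_le n p q x : 0 <= x <= 1 -> (forall k, (k <= n)%nat -> p k <= q k) ->
  bern n p x <= bern n q x.
Proof.
  intros Hx. revert p q; induction n as [|n IH]; intros p q H; simpl; [apply H; lia|].
  apply Rplus_le_compat; apply Rmult_le_compat_l; try lra; apply IH; intros k Hk; apply H; lia.
Qed.

(** The free centre c serves the induction: a success in the first trial shifts it to c - 1. *)
Lemma bern_variance n c x :
  bern n (fun k => (INR k - c) ^ 2) x = INR n * x * (1 - x) + (INR n * x - c) ^ 2.
Proof.
  revert c; induction n as [|n IH]; intros c; [simpl; ring|].
  cbn [bern].
  replace (bern n (fun k => (INR (S k) - c) ^ 2) x)
    with (bern n (fun k => (INR k - (c - 1)) ^ 2) x).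
  - rewrite !IH, S_INR. ring.
  - f_equal. apply functional_extensionality. intros k.
    rewrite S_INR. ring.
Qed.

Definition is_pol (P : R -> R) : Prop := exists a D, forall x, P x = pol a D x.

Lemma is_pol_const c : is_pol (fun _ => c).
Proof. exists (fun _ => c), 1%nat. intros x. unfold pol; simpl. ring. Qed.

Lemma is_pol_plus P Q : is_pol P -> is_pol Q -> is_pol (fun x => P x + Q x).
Proof.
  intros [a [D HP]] [b [E HQ]].
  exists (fun m => (if Nat.ltb m D then a m else 0) + (if Nat.ltb m E then b m else 0)), (D + E)%nat.
  intros x. rewrite HP, HQ. unfold pol.
  rewrite (bsum_ext (D + E) _ (fun m => (if Nat.ltb m D then a m else 0) * x ^ m
                                       + (if Nat.ltb m E then b m else 0) * x ^ m)) by (intros; ring).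
  rewrite bsum_plus.
  rewrite (bsum_widen D (D + E)), (bsum_widen E (D + E)); try lia.
  - f_equal; apply bsum_ext; intros m Hm; apply Nat.ltb_lt in Hm; now rewrite Hm.
  - intros m [Hm _]. apply Nat.ltb_ge in Hm. rewrite Hm; ring.
  - intros m [Hm _]. apply Nat.ltb_ge in Hm. rewrite Hm; ring.
Qed.

Lemma is_pol_scal c P : is_pol P -> is_pol (fun x => c * P x).
Proof.
  intros [a [D HP]]. exists (fun m => c * a m), D. intros x. rewrite HP. unfold pol.
  rewrite <- bsum_scal. apply bsum_ext; intros; ring.
Qed.

Lemma is_pol_X P : is_pol P -> is_pol (fun x => x * P x).
Proof.
  intros [a [D HP]]. exists (fun m => match m with O => 0 | S k => a k end), (S D).
  intros x. rewrite HP. unfold pol. rewrite bsum_S_l, <- bsum_scal.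
  rewrite Rmult_0_l, Rplus_0_l. apply bsum_ext; intros; simpl; ring.
Qed.

Lemma is_pol_ext P Q : (forall x, P x = Q x) -> is_pol P -> is_pol Q.
Proof. intros H [a [D HP]]. exists a, D. intros x. now rewrite <- H. Qed.

Lemma is_pol_bern n p : is_pol (bern n p).
Proof.
  revert p; induction n as [|n IH]; intros p; [apply is_pol_const|].
  apply is_pol_ext with (fun x => x * bern n (fun k => p (S k)) x
                                  + (bern n p x + (-1) * (x * bern n p x))).
  - intros x; simpl; ring.
  - apply is_pol_plus; [now apply is_pol_X|].
    apply is_pol_plus; [apply IH|]. now apply is_pol_scal, is_pol_X.
Qed.

(* Bernstein's proof: [bern n p x] is the expectation of p(S) for S binomial (n, x). *)
Lemma weierstrass (g : R -> R) eps : (forall x, continuous g x) -> 0 < eps ->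
  exists a D, forall x, in01 x -> Rabs (g x - pol a D x) <= eps.
Proof.
  intros Hg Heps.
  assert (Hc : forall x, 0 <= x <= 1 -> continuity_pt g x)
    by (intros x _; apply continuity_pt_filterlim, Hg).
  destruct (Heine_cor2 Hc (mkposreal (eps / 2) ltac:(lra))) as [[del Hdel] Hu]. simpl in Hu.
  destruct (continuity_ab_maj (fun x => Rabs (g x)) 0 1 ltac:(lra)) as [Mx [HM _]].
  { intros x Hx. apply (continuity_pt_comp g Rabs); [now apply Hc|apply Rcontinuity_abs]. }
  set (M := Rabs (g Mx)) in *.
  assert (HM0 : 0 <= M) by apply Rabs_pos.
  (* By Chebyshev's inequality the nodes k/n farther than [del] from x cost at most 2 M / (n del^2);
     this n makes the cost at most eps / 2. *)
  destruct (archimed_cor1 (eps * del ^ 2 / (4 * M + 1))) as [n [Hn Hn0]].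
  { apply Rdiv_lt_0_compat; [|lra]. apply Rmult_lt_0_compat; [exact Heps|now apply pow_lt]. }
  assert (Pn : 0 < INR n) by now apply lt_0_INR.
  assert (Pd : 0 < del ^ 2) by now apply pow_lt.
  destruct (is_pol_bern n (fun k => g (INR k / INR n))) as [a [D HP]].
  exists a, D. intros x Hx. rewrite <- HP.
  assert (Key : forall k, (k <= n)%nat ->
     Rabs (g x - g (INR k / INR n))
     <= eps / 2 + 2 * M / del ^ 2 * / INR n ^ 2 * (INR k - INR n * x) ^ 2).
  { intros k Hk.
    assert (Hy : 0 <= INR k / INR n <= 1).
    { split; [apply Rmult_le_pos; [apply pos_INR|left; now apply Rinv_0_lt_compat]|].
      apply Rmult_le_reg_r with (INR n); [exact Pn|].
      unfold Rdiv. rewrite Rmult_assoc, Rinv_l by lra. apply le_INR in Hk. lra. }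
    set (y := INR k / INR n) in *.
    replace (2 * M / del ^ 2 * / INR n ^ 2 * (INR k - INR n * x) ^ 2)
      with (2 * M * ((y - x) ^ 2 / del ^ 2)) by (unfold y; field; split; apply Rgt_not_eq; assumption).
    assert (Q : 0 <= (y - x) ^ 2 / del ^ 2)
      by (apply Rmult_le_pos; [apply pow2_ge_0|left; now apply Rinv_0_lt_compat]).
    destruct (Rlt_le_dec (Rabs (x - y)) del) as [L|L].
    - assert (B := Hu x y Hx Hy L).
      assert (0 <= 2 * M * ((y - x) ^ 2 / del ^ 2)) by (apply Rmult_le_pos; lra). lra.
    - assert (1 <= (y - x) ^ 2 / del ^ 2).
      { apply Rmult_le_reg_r with (del ^ 2); [exact Pd|].
        unfold Rdiv. rewrite Rmult_assoc, Rinv_l by lra. rewrite Rmult_1_l, Rmult_1_r.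
        rewrite <- (pow2_abs (y - x)), Rabs_minus_sym. apply pow_incr. lra. }
      assert (B1 : Rabs (g x) <= M) by exact (HM x Hx).
      assert (B2 : Rabs (g y) <= M) by exact (HM y Hy).
      assert (Rabs (g x - g y) <= 2 * M).
      { unfold Rminus. eapply Rle_trans; [apply Rabs_triang|]. rewrite Rabs_Ropp. lra. }
      nra. }
  (* The sign [sg] covers both one-sided bounds, so that monotonicity of [bern] can be applied
     directly. *)
  assert (Bd : forall sg, sg = 1 \/ sg = -1 ->
     sg * (g x - bern n (fun k => g (INR k / INR n)) x) <= eps).
  { intros sg Hsg.
    apply Rle_trans with (bern n (fun k => eps / 2
        + 2 * M / del ^ 2 * / INR n ^ 2 * (INR k - INR n * x) ^ 2) x).
    - replace (sg * (g x - bern n (fun k => g (INR k / INR n)) x))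
        with (bern n (fun k => sg * (g x + -1 * g (INR k / INR n))) x)
        by (rewrite bern_scal, bern_plus, bern_const, bern_scal; ring).
      apply bern_le; [exact Hx|]. intros k Hk. specialize (Key k Hk).
      apply Rabs_le_between in Key. destruct Hsg as [-> | ->]; lra.
    - rewrite bern_plus, bern_const, bern_scal, bern_variance.
      rewrite Rminus_diag, pow_ne_zero, Rplus_0_r by lia.
      replace (2 * M / del ^ 2 * / INR n ^ 2 * (INR n * x * (1 - x)))
        with (2 * M / del ^ 2 * (x * (1 - x)) * / INR n) by (field; lra).
      assert (X : 0 <= x * (1 - x) <= 1) by (destruct Hx; nra).
      assert (C : 0 <= 2 * M / del ^ 2)
        by (apply Rmult_le_pos; [lra|left; now apply Rinv_0_lt_compat]).
      assert (I0 : 0 < / INR n) by now apply Rinv_0_lt_compat.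
      assert (2 * M / del ^ 2 * (x * (1 - x)) * / INR n <= 2 * M / del ^ 2 * 1 * (eps * del ^ 2 / (4 * M + 1))).
      { apply Rmult_le_compat; [apply Rmult_le_pos; lra|lra| |lra]. apply Rmult_le_compat_l; lra. }
      replace (2 * M / del ^ 2 * 1 * (eps * del ^ 2 / (4 * M + 1)))
        with (eps / 2 * (4 * M / (4 * M + 1))) in H by (field; lra).
      assert (4 * M / (4 * M + 1) <= 1).
      { apply Rmult_le_reg_r with (4 * M + 1); [lra|].
        unfold Rdiv. rewrite Rmult_assoc, Rinv_l by lra. lra. }
      assert (eps / 2 * (4 * M / (4 * M + 1)) <= eps / 2 * 1) by (apply Rmult_le_compat_l; lra).
      lra. }
  apply Rabs_le. assert (B1 := Bd 1 (or_introl eq_refl)). assert (B2 := Bd (-1) (or_intror eq_refl)).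
  lra.
Qed.

(** Retraction onto [0, 1]. Composition with it extends a function continuously to the line without
    changing its values on [0, 1], where the nodes and the range of the symbol lie. *)
Definition clamp (x : R) : R := Rmax 0 (Rmin 1 x).

Lemma clamp_in01 x : in01 (clamp x).
Proof.
  unfold in01, clamp. split; [apply Rmax_l|]. apply Rmax_lub; [lra|apply Rmin_l].
Qed.

Lemma clamp_id x : in01 x -> clamp x = x.
Proof. intros [H1 H2]. unfold clamp. rewrite Rmin_right, Rmax_right by lra. reflexivity. Qed.

Lemma clamp_contract x y : Rabs (clamp x - clamp y) <= Rabs (x - y).
Proof.
  unfold clamp, Rmax, Rmin.
  repeat destruct (Rle_dec _ _); apply Rabs_le; unfold Rabs; destruct (Rcase_abs _); lra.
Qed.

Lemma continuous_clamp (f : R -> R) :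
  (forall x, in01 x -> filterlim f (within in01 (locally x)) (locally (f x))) ->
  forall x, continuous (fun y => f (clamp y)) x.
Proof.
  intros H x. specialize (H (clamp x) (clamp_in01 x)).
  apply filterlim_locally. intros eps.
  destruct (proj1 (filterlim_locally f _) H eps) as [d Hd].
  exists d. intros y Hy. apply Hd; [|apply clamp_in01].
  change (Rabs (clamp y - clamp x) < d). change (Rabs (y - x) < d) in Hy.
  eapply Rle_lt_trans; [apply clamp_contract|exact Hy].
Qed.

Lemma is_derive_pol_primitive (a : nat -> R) D c x :
  is_derive (pol (fun m => match m with O => c | S k => a k / INR (S k) end) (S D)) x (pol a D x).
Proof.
  apply is_derive_ext with (fun x => c + bsum D (fun k => a k / INR (S k) * x ^ S k)).
  { intros y. unfold pol. rewrite bsum_S_l. simpl. ring. }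
  replace (pol a D x) with (0 + pol a D x) by ring.
  apply @is_derive_plus; [apply @is_derive_const|].
  apply (is_derive_bsum D (fun k x => a k / INR (S k) * x ^ S k)). intros k _.
  evar_last; [apply is_derive_scal, is_derive_pow, @is_derive_id|].
  simpl pred. change (a k / INR (S k) * (INR (S k) * 1 * x ^ k) = a k * x ^ k).
  field. apply not_0_INR; lia.
Qed.

Section C1.

Variable f : R -> R.
Variable f' : R -> R.
Hypothesis f_diff : forall x, in01 x ->
  filterlim (fun h => (f (x + h) - f x) / h)
            (within (fun h => h <> 0 /\ in01 (x + h)) (locally 0)) (locally (f' x)).
Hypothesis f'_cont : forall x, in01 x -> filterlim f' (within in01 (locally x)) (locally (f' x)).

Lemma f_quotient x eps : in01 x -> 0 < eps -> exists d, 0 < d /\ forall h,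
  Rabs h < d -> h <> 0 -> in01 (x + h) -> Rabs ((f (x + h) - f x) / h - f' x) < eps.
Proof.
  intros Hx He.
  destruct (proj1 (filterlim_locally _ _) (f_diff x Hx) (mkposreal eps He)) as [d Hd].
  exists d. split; [apply cond_pos|]. intros h H1 H2 H3. apply Hd; [|auto].
  change (Rabs (h - 0) < d). now rewrite Rminus_0_r.
Qed.

Lemma f_cont x : in01 x -> filterlim f (within in01 (locally x)) (locally (f x)).
Proof.
  intros Hx. apply filterlim_locally. intros [eps He].
  destruct (f_quotient x 1 Hx Rlt_0_1) as [d [Hd Hq]].
  set (K := Rabs (f' x) + 1). assert (HK : 0 < K) by (assert (A := Rabs_pos (f' x)); unfold K; lra).
  assert (Hm : 0 < Rmin d (eps / K)) by (apply Rmin_pos; [exact Hd|now apply Rdiv_lt_0_compat]).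
  enough (Main : forall y : R, Rabs (y - x) < Rmin d (eps / K) -> in01 y -> Rabs (f y - f x) < eps)
    by (exists (mkposreal _ Hm); exact Main).
  intros y Hy Hin.
  destruct (Req_dec y x) as [->|E]; [rewrite Rminus_diag, Rabs_R0; exact He|].
  specialize (Hq (y - x)). replace (x + (y - x)) with y in Hq by ring.
  assert (Q : Rabs ((f y - f x) / (y - x) - f' x) < 1).
  { apply Hq; [|lra|exact Hin]. eapply Rlt_le_trans; [exact Hy|apply Rmin_l]. }
  replace (f y - f x) with (((f y - f x) / (y - x) - f' x + f' x) * (y - x)) by (field; lra).
  rewrite Rabs_mult.
  apply Rle_lt_trans with (K * Rabs (y - x)).
  - apply Rmult_le_compat_r; [apply Rabs_pos|].
    eapply Rle_trans; [apply Rabs_triang|]. unfold K; lra.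
  - apply Rlt_le_trans with (K * (eps / K)).
    + apply Rmult_lt_compat_l; [exact HK|]. eapply Rlt_le_trans; [exact Hy|apply Rmin_r].
    + right; field; lra.
Qed.

Lemma f_derive x : 0 < x < 1 -> is_derive (fun y => f (clamp y)) x (f' x).
Proof.
  intros Hx. assert (Hx' : in01 x) by (unfold in01; lra).
  apply is_derive_Reals. intros eps He.
  destruct (f_quotient x eps Hx' He) as [d [Hd Hq]].
  assert (Hm : 0 < Rmin d (Rmin x (1 - x))) by (repeat apply Rmin_pos; lra).
  exists (mkposreal _ Hm). intros h Hh0 Hh. simpl in Hh.
  assert (H1 : Rabs h < d) by (eapply Rlt_le_trans; [exact Hh|apply Rmin_l]).
  assert (H2 : Rabs h < x).
  { eapply Rlt_le_trans; [exact Hh|]. eapply Rle_trans; [apply Rmin_r|apply Rmin_l]. }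
  assert (H3 : Rabs h < 1 - x).
  { eapply Rlt_le_trans; [exact Hh|]. eapply Rle_trans; [apply Rmin_r|apply Rmin_r]. }
  apply Rabs_lt_between in H2. apply Rabs_lt_between in H3.
  assert (Hin : in01 (x + h)) by (unfold in01; lra).
  rewrite !clamp_id by assumption. now apply Hq.
Qed.

(** The derivative is approximated uniformly and the polynomial integrated, with constant term
    [f 0]. By the mean value theorem the remainder then has a small Lipschitz constant, the quantity
    that controls variances. *)
Lemma C1_approx_deriv eps : 0 < eps -> exists a D,
  (forall x, in01 x -> Rabs (f x - pol a D x) <= eps) /\
  (forall x y, in01 x -> in01 y ->
     Rabs ((f x - pol a D x) - (f y - pol a D y)) <= eps * Rabs (x - y)).
Proof.
  intros He.
  destruct (weierstrass (fun x => f' (clamp x)) eps) as [a [D Ha]];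
    [apply continuous_clamp, f'_cont|exact He|].
  set (b := fun m => match m with O => f 0 | S k => a k / INR (S k) end).
  exists b, (S D).
  assert (Lip : forall x y, in01 x -> in01 y ->
     Rabs ((f x - pol b (S D) x) - (f y - pol b (S D) y)) <= eps * Rabs (x - y)).
  { intros x y Hx Hy.
    destruct (MVT_gen (fun z => f (clamp z) - pol b (S D) z) y x (fun z => f' z - pol a D z))
      as [z [Hz E]].
    - intros z Hz.
      assert (0 < z < 1).
      { destruct Hx, Hy. unfold Rmin, Rmax in Hz; destruct (Rle_dec y x); lra. }
      apply @is_derive_minus; [now apply f_derive|apply is_derive_pol_primitive].
    - intros z _. apply continuity_pt_filterlim.
      apply (continuous_minus (fun z => f (clamp z)) (pol b (S D))).
      + apply continuous_clamp, f_cont.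
      + apply (ex_derive_continuous (pol b (S D))). eexists; apply is_derive_pol_primitive.
    - rewrite !clamp_id in E by assumption. rewrite E, Rabs_mult.
      apply Rmult_le_compat_r; [apply Rabs_pos|].
      assert (Hz' : in01 z).
      { destruct Hx, Hy. unfold in01. unfold Rmin, Rmax in Hz; destruct (Rle_dec y x); lra. }
      specialize (Ha z Hz'). now rewrite clamp_id in Ha. }
  split; [|exact Lip].
  intros x Hx. assert (H0 : in01 0) by (unfold in01; lra).
  specialize (Lip x 0 Hx H0).
  replace (pol b (S D) 0) with (f 0) in Lip.
  - rewrite Rminus_diag, !Rminus_0_r in Lip. destruct Hx as [Hx0 Hx1].
    rewrite (Rabs_pos_eq x Hx0) in Lip. nra.
  - unfold pol. rewrite bsum_S_l, bsum_zero; [simpl; ring|]. intros i _. simpl; ring.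
Qed.

End C1.

Lemma C1_approx f eps : C1_on_01 f -> 0 < eps -> exists a D,
  (forall x, in01 x -> Rabs (f x - pol a D x) <= eps) /\
  (forall x y, in01 x -> in01 y ->
     Rabs ((f x - pol a D x) - (f y - pol a D y)) <= eps * Rabs (x - y)).
Proof. intros [f' [H1 H2]] He. now apply (C1_approx_deriv f f' H1 H2). Qed.

Lemma C1_continuous_clamp f : C1_on_01 f -> forall x, continuous (fun y => f (clamp y)) x.
Proof. intros [f' [H1 H2]]. apply continuous_clamp. now apply (f_cont f f'). Qed.

(** * The Gaussian functional *)

Lemma is_RInt_gen_primitive (k G : R -> R) (lp lm : R) :
  (forall x, continuous k x) -> (forall x, is_derive G x (k x)) ->
  filterlim G (Rbar_locally p_infty) (locally lp) ->
  filterlim G (Rbar_locally m_infty) (locally lm) ->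
  is_RInt_gen k (Rbar_locally m_infty) (Rbar_locally p_infty) (lp - lm).
Proof.
  intros Hk HG Hp Hm P HP.
  assert (L : filterlim (fun ab : R * R => minus (G (snd ab)) (G (fst ab)))
            (filter_prod (Rbar_locally m_infty) (Rbar_locally p_infty)) (locally (minus lp lm))).
  { apply (filterlim_comp_2 (F := filter_prod (Rbar_locally m_infty) (Rbar_locally p_infty))
             (G := locally lp) (H := locally (opp lm))
             (fun ab => G (snd ab)) (fun ab => opp (G (fst ab))) plus).
    - apply (filterlim_comp _ _ _ snd G _ (Rbar_locally p_infty)); [apply filterlim_snd|exact Hp].
    - apply (filterlim_comp _ _ _ (fun ab : R * R => G (fst ab)) opp _ (locally lm)).
      + apply (filterlim_comp _ _ _ fst G _ (Rbar_locally m_infty)); [apply filterlim_fst|exact Hm].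
      + apply (filterlim_opp lm).
    - apply (filterlim_plus lp (opp lm)). }
  specialize (L P HP). unfold filtermap in L. unfold filtermapi.
  revert L. apply filter_imp. intros [a b] Hab. exists (minus (G b) (G a)). split; [|exact Hab].
  apply (is_RInt_derive G k); intros; [apply HG|apply Hk].
Qed.

(** Symmetric truncation reduces order properties of improper integrals to those of ordinary
    ones. *)
Lemma is_RInt_gen_seq (k : R -> R) (I : R) :
  is_RInt_gen k (Rbar_locally m_infty) (Rbar_locally p_infty) I ->
  is_lim_seq (fun n => RInt k (- INR n) (INR n)) I.
Proof.
  intros H. apply is_lim_seq_spec. intros eps.
  destruct (H (fun y => Rabs (y - I) < eps)) as [Q R [M1 HQ] [M2 HR] Hall].
  { exists eps. intros y Hy. exact Hy. }
  destruct (INR_unbounded (Rmax (- M1) M2)) as [n0 Hn0].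
  exists n0. intros n Hn. apply le_INR in Hn.
  assert (A1 := Rmax_l (- M1) M2). assert (A2 := Rmax_r (- M1) M2).
  destruct (Hall (- INR n) (INR n)) as [y [Hy1 Hy2]]; [apply HQ; lra|apply HR; lra|].
  simpl in Hy1. now rewrite (is_RInt_unique _ _ _ _ Hy1).
Qed.

Lemma ex_RInt_cont (k : R -> R) a b : (forall x, continuous k x) -> ex_RInt k a b.
Proof. intros Hk. apply (ex_RInt_continuous k). intros; apply Hk. Qed.

Lemma is_derive_prim (k : R -> R) a x : (forall x, continuous k x) ->
  is_derive (fun x => RInt k a x) x (k x).
Proof.
  intros Hk. apply (is_derive_RInt k (fun x => RInt k a x) a x); [|apply Hk].
  apply filter_forall. intros y. apply (RInt_correct k), ex_RInt_cont, Hk.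
Qed.

(** Comparison with - C / x, whose derivative is C / x^2; the shift by x starts the interval at 0,
    as [Rabs_increment_le] asks. *)
Lemma tail_increment (k G : R -> R) C x y :
  (forall z, is_derive G z (k z)) -> 0 <= C ->
  (forall z, 1 <= Rabs z -> Rabs (k z) <= C / z ^ 2) ->
  1 <= x -> x <= y -> Rabs (G y - G x) <= C / x.
Proof.
  intros HG HC Hk Hx Hxy.
  apply Rle_trans with (- C / y - - C / x).
  - replace (G y - G x) with (G (x + (y - x)) - G (x + 0)) by (f_equal; [f_equal|f_equal; f_equal]; ring).
    replace (- C / y - - C / x) with (- C / (x + (y - x)) - - C / (x + 0))
      by (replace (x + (y - x)) with y by ring; now rewrite Rplus_0_r).
    apply (Rabs_increment_le (fun u => G (x + u)) (fun u => - C / (x + u))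
             (fun u => k (x + u)) (fun u => C / (x + u) ^ 2)); [lra| | |].
    + intros u Hu. evar_last.
      * apply (is_derive_comp G (fun u => x + u)); [apply HG|].
        apply @is_derive_plus; [apply @is_derive_const|apply @is_derive_id].
      * change ((0 + 1) * k (x + u) = k (x + u)). ring.
    + intros u Hu. auto_derive; [lra|]. field. lra.
    + intros u Hu. apply Hk. rewrite Rabs_pos_eq; lra.
  - assert (0 <= C / y) by (apply Rmult_le_pos; [lra|left; apply Rinv_0_lt_compat; lra]).
    unfold Rdiv in *. lra.
Qed.

Lemma filterlim_of_tail (k G : R -> R) C :
  (forall z, is_derive G z (k z)) -> 0 <= C ->
  (forall z, 1 <= Rabs z -> Rabs (k z) <= C / z ^ 2) ->
  exists l : R, filterlim G (Rbar_locally p_infty) (locally l).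
Proof.
  intros HG HC Hk.
  apply (proj1 (filterlim_locally_cauchy (F := Rbar_locally p_infty) (U := R_CompleteSpace) G)).
  intros eps. set (M := Rmax 1 (2 * C / eps)).
  assert (He := cond_pos eps).
  exists (fun x => M < x). split; [exists M; auto|].
  intros u v Hu Hv.
  assert (M1 : 1 <= M) by apply Rmax_l. assert (M2 : 2 * C / eps <= M) by apply Rmax_r.
  assert (Q : forall x, M < x -> C / x < eps).
  { intros x Hx. apply Rmult_lt_reg_r with x; [lra|].
    unfold Rdiv. rewrite Rmult_assoc, Rinv_l, Rmult_1_r by lra.
    assert (2 * C <= eps * M).
    { apply Rle_trans with (eps * (2 * C / eps)); [right; field; lra|].
      apply Rmult_le_compat_l; lra. }
    assert (eps * M < eps * x) by (apply Rmult_lt_compat_l; lra).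
    lra. }
  change (Rabs (G v - G u) < eps).
  destruct (Rle_lt_dec u v) as [L|L].
  - eapply Rle_lt_trans; [apply (tail_increment k G C u v); auto; lra|now apply Q].
  - rewrite Rabs_minus_sym.
    eapply Rle_lt_trans; [apply (tail_increment k G C v u); auto; lra|now apply Q].
Qed.

Lemma ex_RInt_gen_of_tail (k : R -> R) C :
  (forall x, continuous k x) -> 0 <= C ->
  (forall z, 1 <= Rabs z -> Rabs (k z) <= C / z ^ 2) ->
  exists I : R, is_RInt_gen k (Rbar_locally m_infty) (Rbar_locally p_infty) I.
Proof.
  intros Hc HC Hk.
  set (G := fun x => RInt k 0 x).
  assert (HG : forall z, is_derive G z (k z)) by (intros; now apply is_derive_prim).
  destruct (filterlim_of_tail k G C HG HC Hk) as [lp Hp].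
  destruct (filterlim_of_tail (fun z => - k (- z)) (fun z => G (- z)) C) as [lm Hm].
  - intros z. evar_last.
    + apply (is_derive_comp G (fun z => - z)); [apply HG|].
      apply @is_derive_opp, @is_derive_id.
    + change (- (1) * k (- z) = - k (- z)). ring.
  - exact HC.
  - intros z Hz. rewrite Rabs_Ropp. replace (z ^ 2) with ((- z) ^ 2) by ring.
    apply Hk. now rewrite Rabs_Ropp.
  - exists (lp - lm). apply (is_RInt_gen_primitive k G); auto.
    intros P HP. destruct (Hm P HP) as [M HM]. exists (- M). intros x Hx.
    replace x with (- - x) by ring. apply HM. lra.
Qed.

(** * The Gaussian integral *)

Definition gk (z : R) : R := exp (- z ^ 2 / 2).
Definition gF (x : R) : R := RInt gk 0 x.
(* [gF ^ 2 + gH] is constant, which evaluates the Gaussian integral. *)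
Definition gH (x : R) : R := RInt (fun t => 2 * exp (- (x ^ 2 * (1 + t ^ 2)) / 2) / (1 + t ^ 2)) 0 1.

Lemma gk_cont x : continuous gk x.
Proof. apply (ex_derive_continuous gk). unfold gk. auto_derive. exact I. Qed.

Lemma gF_derive (x : R) : is_derive gF x (gk x).
Proof. apply is_derive_prim, gk_cont. Qed.

Lemma one_plus_sq_pos t : 0 < 1 + t ^ 2.
Proof. assert (H := pow2_ge_0 t). lra. Qed.

Lemma gH_integrand_cont x t :
  continuous (fun t => 2 * exp (- (x ^ 2 * (1 + t ^ 2)) / 2) / (1 + t ^ 2)) t.
Proof.
  apply (ex_derive_continuous (fun t => 2 * exp (- (x ^ 2 * (1 + t ^ 2)) / 2) / (1 + t ^ 2))).
  auto_derive. assert (H := one_plus_sq_pos t). simpl in H. lra.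
Qed.

Lemma gH_integrand_derive (x t : R) :
  is_derive (fun u => 2 * exp (- (u ^ 2 * (1 + t ^ 2)) / 2) / (1 + t ^ 2)) x
            (- 2 * x * exp (- (x ^ 2 * (1 + t ^ 2)) / 2)).
Proof.
  assert (H := one_plus_sq_pos t). auto_derive; [lra|].
  replace (t * (t * 1)) with (t ^ 2) by ring. replace (x * (x * 1)) with (x ^ 2) by ring.
  unfold Rdiv. field. lra.
Qed.

Lemma gH_derive (x : R) : is_derive gH x (- 2 * gk x * gF x).
Proof.
  evar_last.
  - apply (is_derive_RInt_param (fun x t => 2 * exp (- (x ^ 2 * (1 + t ^ 2)) / 2) / (1 + t ^ 2)) 0 1 x).
    + apply filter_forall. intros y t _. eexists. apply gH_integrand_derive.
    + intros t _.
      apply continuity_2d_pt_ext with (fun u v => (- 2 * u) * exp (- (u * u * (1 + v * v)) * / 2)).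
      { intros u v. symmetry. erewrite is_derive_unique; [|apply gH_integrand_derive].
        f_equal. f_equal. unfold Rdiv. simpl. ring. }
      apply continuity_2d_pt_mult.
      * apply continuity_2d_pt_mult; [apply continuity_2d_pt_const|apply continuity_2d_pt_id1].
      * apply (continuity_1d_2d_pt_comp exp (fun u v => - (u * u * (1 + v * v)) * / 2)).
        -- apply continuity_pt_filterlim. apply (ex_derive_continuous exp).
           eexists; apply is_derive_exp.
        -- repeat first [ apply continuity_2d_pt_mult | apply continuity_2d_pt_opp
             | apply continuity_2d_pt_plus | apply continuity_2d_pt_const
             | apply continuity_2d_pt_id1 | apply continuity_2d_pt_id2 ].
    + apply filter_forall. intros y. apply ex_RInt_cont, gH_integrand_cont.
  (* Since x^2 (1 + t^2) = x^2 + (x t)^2, the integrand is -2 gk(x) times x gk(x t), and the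
     substitution u = x t produces [gF x]. *)
  - rewrite (RInt_ext _ (fun t => scal (- 2 * gk x) (scal x (gk (x * t + 0))))).
    + rewrite (RInt_scal (fun t => scal x (gk (x * t + 0)))).
      * transitivity (scal (- 2 * gk x) (RInt gk (x * 0 + 0) (x * 1 + 0))).
        -- f_equal. apply (RInt_comp_lin gk x 0 0 1), ex_RInt_cont, gk_cont.
        -- rewrite Rmult_0_r, Rmult_1_r, !Rplus_0_r. reflexivity.
      * apply ex_RInt_cont. intros t.
        apply (ex_derive_continuous (fun t => x * gk (x * t + 0))). unfold gk. auto_derive. exact I.
    + intros t _. erewrite is_derive_unique; [|apply gH_integrand_derive].
      change (-2 * x * exp (- (x ^ 2 * (1 + t ^ 2)) / 2) = (-2 * gk x) * (x * gk (x * t + 0))).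
      unfold gk. replace (- (x ^ 2 * (1 + t ^ 2)) / 2) with (- x ^ 2 / 2 + - (x * t + 0) ^ 2 / 2) by field.
      rewrite exp_plus. ring.
Qed.

Lemma gH_0 : gH 0 = PI / 2.
Proof.
  unfold gH. rewrite (RInt_ext _ (fun t => 2 * / (1 + t²))).
  - apply is_RInt_unique. evar_last.
    + apply (is_RInt_derive (fun t => 2 * atan t)).
      * intros t _. apply @is_derive_scal, is_derive_atan.
      * intros t _. apply (ex_derive_continuous (fun t => 2 * / (1 + t²))).
        unfold Rsqr. auto_derive. nra.
    + change (2 * atan 1 - 2 * atan 0 = PI / 2). rewrite atan_1, atan_0. field.
  - intros t _. unfold Rsqr, Rdiv. replace (- (0 ^ 2 * (1 + t ^ 2)) * / 2) with 0 by (simpl; field).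
    rewrite exp_0. simpl. rewrite !Rmult_1_r. reflexivity.
Qed.

Lemma gF_sq x : 0 <= x -> gF x ^ 2 + gH x = PI / 2.
Proof.
  intros Hx.
  assert (E : Rabs ((gF x ^ 2 + gH x) - (gF 0 ^ 2 + gH 0)) <= 0 - 0).
  { apply (Rabs_increment_le (fun x => gF x ^ 2 + gH x) (fun _ => 0) (fun _ => 0) (fun _ => 0)); auto.
    - intros u _. evar_last.
      + apply @is_derive_plus; [apply (is_derive_pow gF 2), gF_derive|apply gH_derive].
      + change (INR 2 * gk u * gF u ^ 1 + -2 * gk u * gF u = 0). simpl; ring.
    - intros u _. apply @is_derive_const.
    - intros u _. rewrite Rabs_R0; lra. }
  rewrite Rminus_diag in E.
  assert (Z : (gF x ^ 2 + gH x) - (gF 0 ^ 2 + gH 0) = 0).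
  { destruct (Req_dec ((gF x ^ 2 + gH x) - (gF 0 ^ 2 + gH 0)) 0) as [e|e]; [exact e|].
    apply Rabs_pos_lt in e. lra. }
  rewrite gH_0 in Z. unfold gF at 2 in Z. rewrite RInt_point in Z.
  change (@zero R_CompleteNormedModule) with 0 in Z. simpl in Z. lra.
Qed.

Lemma exp_neg_le_inv y : 0 < y -> exp (- y) <= / y.
Proof.
  intros Hy. rewrite exp_Ropp. apply Rinv_le_contravar; [exact Hy|].
  assert (H := exp_ineq1_le y). lra.
Qed.

Lemma gH_bound x : 0 < x -> 0 <= gH x <= 4 / x ^ 2.
Proof.
  intros Hx. unfold gH.
  assert (P : forall t, 0 <= 2 * exp (- (x ^ 2 * (1 + t ^ 2)) / 2) / (1 + t ^ 2) <= 4 / x ^ 2).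
  { intros t. assert (H := one_plus_sq_pos t).
    assert (Ht : 0 <= t ^ 2) by apply pow2_ge_0.
    assert (Hx2 : 0 < x ^ 2) by now apply pow_lt.
    split.
    - apply Rmult_le_pos; [|left; now apply Rinv_0_lt_compat].
      assert (E := exp_pos (- (x ^ 2 * (1 + t ^ 2)) / 2)). lra.
    - apply Rle_trans with (2 * exp (- (x ^ 2 * (1 + t ^ 2)) / 2) * 1).
      + apply Rmult_le_compat_l; [assert (E := exp_pos (- (x ^ 2 * (1 + t ^ 2)) / 2)); lra|].
        rewrite <- Rinv_1. apply Rinv_le_contravar; lra.
      + rewrite Rmult_1_r.
        apply Rle_trans with (2 * exp (- (x ^ 2 / 2))).
        * apply Rmult_le_compat_l; [lra|]. 
          destruct (Req_dec (x ^ 2 * t ^ 2) 0) as [Z|Z].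
          -- right. f_equal. lra.
          -- left. apply exp_increasing.
             assert (0 <= x ^ 2 * t ^ 2) by (apply Rmult_le_pos; lra). lra.
        * replace (4 / x ^ 2) with (2 * / (x ^ 2 / 2)) by (field; lra).
          apply Rmult_le_compat_l; [lra|]. apply exp_neg_le_inv. lra. }
  split.
  - apply RInt_ge_0; [lra|apply ex_RInt_cont, gH_integrand_cont|]. intros t _. apply P.
  - replace (4 / x ^ 2) with (RInt (fun _ => 4 / x ^ 2) 0 1).
    + apply RInt_le; [lra|apply ex_RInt_cont, gH_integrand_cont|apply ex_RInt_const|].
      intros t _. apply P.
    + rewrite RInt_const. change ((1 - 0) * (4 / x ^ 2) = 4 / x ^ 2). ring.
Qed.

Definition gl : R := sqrt (2 * PI) / 2.

Lemma gl_sq : gl ^ 2 = PI / 2.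
Proof.
  unfold gl, Rdiv. assert (P := PI_RGT_0).
  rewrite Rpow_mult_distr, pow2_sqrt by lra. field.
Qed.

Lemma gl_pos : 0 < gl.
Proof.
  unfold gl. assert (P := PI_RGT_0). apply Rdiv_lt_0_compat; [apply sqrt_lt_R0|]; lra.
Qed.

Lemma gF_nonneg x : 0 <= x -> 0 <= gF x.
Proof.
  intros Hx. apply RInt_ge_0; [exact Hx|apply ex_RInt_cont, gk_cont|].
  intros t _. left. apply exp_pos.
Qed.

(** By [gF_sq] and [gl_sq], (gF - gl)(gF + gl) = - gH. The second factor is at least gl > 0, so the
    decay of [gH] passes to gF - gl. *)
Lemma gF_lim_p : filterlim gF (Rbar_locally p_infty) (locally gl).
Proof.
  apply filterlim_locally. intros eps. assert (Hl := gl_pos). assert (He := cond_pos eps).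
  set (M := Rmax 1 (4 / (gl * eps))).
  exists M. intros x Hx. change (Rabs (gF x - gl) < eps).
  assert (M1 : 1 <= M) by apply Rmax_l. assert (M2 : 4 / (gl * eps) <= M) by apply Rmax_r.
  assert (HF := gF_nonneg x ltac:(lra)). assert (E := gF_sq x ltac:(lra)).
  assert (B := gH_bound x ltac:(lra)). assert (L := gl_sq).
  assert (K : Rabs (gF x - gl) * (gF x + gl) = gH x).
  { rewrite <- (Rabs_pos_eq (gF x + gl)) by lra. rewrite <- Rabs_mult.
    replace ((gF x - gl) * (gF x + gl)) with (- gH x) by (simpl in *; lra).
    rewrite Rabs_Ropp. apply Rabs_pos_eq. lra. }
  assert (A := Rabs_pos (gF x - gl)).
  assert (K2 : Rabs (gF x - gl) * gl <= 4 / x ^ 2).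
  { apply Rle_trans with (Rabs (gF x - gl) * (gF x + gl)); [|lra].
    apply Rmult_le_compat_l; lra. }
  assert (K3 : 4 / x ^ 2 <= 4 / x).
  { apply Rmult_le_compat_l; [lra|]. apply Rinv_le_contravar; [lra|]. simpl. nra. }
  assert (K4 : 4 / x < gl * eps).
  { apply Rmult_lt_reg_r with x; [lra|]. unfold Rdiv. rewrite Rmult_assoc, Rinv_l by lra.
    assert (Pg : 0 < gl * eps) by now apply Rmult_lt_0_compat.
    assert (4 <= gl * eps * M).
    { apply Rle_trans with (gl * eps * (4 / (gl * eps))); [right; field; lra|].
      apply Rmult_le_compat_l; lra. }
    assert (gl * eps * M < gl * eps * x) by (apply Rmult_lt_compat_l; lra). lra. }
  apply Rmult_lt_reg_r with gl; [exact Hl|]. lra.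
Qed.

Lemma gF_odd x : gF (- x) = - gF x.
Proof.
  assert (D : forall u, is_derive (fun x => gF (- x) + gF x) u 0).
  { intros u. evar_last.
    - apply @is_derive_plus; [|apply gF_derive].
      apply (is_derive_comp gF (fun z => - z)); [apply gF_derive|apply @is_derive_opp, @is_derive_id].
    - change (- (1) * gk (- u) + gk u = 0). unfold gk. replace ((- u) ^ 2) with (u ^ 2) by ring. ring. }
  assert (E : forall y, 0 <= y -> gF (- y) + gF y = 0).
  { intros y Hy.
    assert (I := Rabs_increment_le (fun x => gF (- x) + gF x) (fun _ => 0) (fun _ => 0) (fun _ => 0) y Hy
       (fun u _ => D u) (fun u _ => is_derive_const 0 u) (fun u _ => Req_le _ _ Rabs_R0)).
    cbv beta in I. rewrite Ropp_0 in I.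
    assert (Z0 : gF 0 = 0) by (unfold gF; now rewrite RInt_point).
    rewrite Z0 in I. rewrite Rminus_diag, Rplus_0_r, Rminus_0_r in I.
    destruct (Req_dec (gF (- y) + gF y) 0) as [e|e]; [exact e|].
    apply Rabs_pos_lt in e. lra. }
  destruct (Rle_lt_dec 0 x) as [H|H]; [specialize (E x H); lra|].
  specialize (E (- x) ltac:(lra)). rewrite Ropp_involutive in E. lra.
Qed.

Lemma gF_lim_m : filterlim gF (Rbar_locally m_infty) (locally (- gl)).
Proof.
  apply filterlim_locally. intros eps.
  destruct (proj1 (filterlim_locally gF gl) gF_lim_p eps) as [M HM].
  exists (- M). intros x Hx. specialize (HM (- x) ltac:(lra)).
  change (Rabs (gF (- x) - gl) < eps) in HM. change (Rabs (gF x - - gl) < eps).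
  rewrite gF_odd, Rabs_minus_sym in HM. now replace (gF x - - gl) with (gl - - gF x) by ring.
Qed.

(* E[u(Z)] = I for Z ~ N(0, v). *)
Definition GI (v : R) (u : R -> R) (I : R) : Prop :=
  is_RInt_gen (gauss_integrand v u) (Rbar_locally m_infty) (Rbar_locally p_infty) I.

Definition expgrow (u : R -> R) : Prop :=
  (forall x, continuous u x) /\
  exists C r, 0 <= C /\ 0 <= r /\ forall x, Rabs (u x) <= C * exp (r * Rabs x).

Lemma gauss_integrand_cont (v : R) (u : R -> R) (x : R) : (forall x, continuous u x) -> continuous (gauss_integrand v u) x.
Proof.
  intros Hu. unfold gauss_integrand.
  apply (continuous_mult (fun z => u (sqrt v * z)) (fun z => exp (- z ^ 2 / 2) / sqrt (2 * PI))).
  - apply (continuous_comp (fun z => sqrt v * z) u); [|apply Hu].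
    apply (ex_derive_continuous (fun z => sqrt v * z)). auto_derive. exact I.
  - apply (continuous_mult (fun z => exp (- z ^ 2 / 2)) (fun _ => / sqrt (2 * PI)));
      [apply gk_cont|apply continuous_const].
Qed.

Lemma sqrt_2PI_pos : 0 < sqrt (2 * PI).
Proof. assert (P := PI_RGT_0). apply sqrt_lt_R0; lra. Qed.

(** The Gaussian factor beats the exponential growth and leaves exp(- z^2 / 4), which is below the 1
    / z^2 decay of the tail criterion. *)
Lemma GI_exists v u : expgrow u -> exists I, GI v u I.
Proof.
  intros [Hu [C [r [HC [Hr Hb]]]]].
  set (rho := r * sqrt v). assert (P2 := sqrt_2PI_pos).
  assert (Hrho : 0 <= rho) by (apply Rmult_le_pos; [exact Hr|apply sqrt_pos]).
  set (K := C * exp (rho ^ 2) / sqrt (2 * PI)).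
  assert (HK : 0 <= K).
  { apply Rmult_le_pos; [|left; now apply Rinv_0_lt_compat].
    apply Rmult_le_pos; [exact HC|left; apply exp_pos]. }
  apply (ex_RInt_gen_of_tail (gauss_integrand v u) (4 * K)).
  - intros x; now apply gauss_integrand_cont.
  - lra.
  - intros z Hz. unfold gauss_integrand.
    assert (Hz2 : 0 < z ^ 2).
    { rewrite <- (pow2_abs z). apply pow_lt. lra. }
    rewrite Rabs_mult, (Rabs_pos_eq (exp _ / _))
      by (apply Rmult_le_pos; [left; apply exp_pos|left; now apply Rinv_0_lt_compat]).
    assert (B : Rabs (u (sqrt v * z)) <= C * exp (rho * Rabs z)).
    { eapply Rle_trans; [apply Hb|]. rewrite Rabs_mult, (Rabs_pos_eq (sqrt v)) by apply sqrt_pos.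
      unfold rho. rewrite Rmult_assoc. lra. }
    apply Rle_trans with (C * exp (rho * Rabs z) * (exp (- z ^ 2 / 2) / sqrt (2 * PI))).
    { apply Rmult_le_compat_r; [|exact B].
      apply Rmult_le_pos; [left; apply exp_pos|left; now apply Rinv_0_lt_compat]. }
    replace (C * exp (rho * Rabs z) * (exp (- z ^ 2 / 2) / sqrt (2 * PI)))
      with (C / sqrt (2 * PI) * (exp (rho * Rabs z) * exp (- z ^ 2 / 2))) by (field; lra).
    rewrite <- exp_plus.
    (* [rho |z| <= rho^2 + z^2 / 4] *)
    apply Rle_trans with (C / sqrt (2 * PI) * (exp (rho ^ 2) * exp (- (z ^ 2 / 4)))).
    { apply Rmult_le_compat_l.
      - apply Rmult_le_pos; [exact HC|left; now apply Rinv_0_lt_compat].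
      - rewrite <- exp_plus.
        assert (Q := pow2_ge_0 (rho - Rabs z / 2)).
        assert (E : rho * Rabs z + - z ^ 2 / 2 <= rho ^ 2 + - (z ^ 2 / 4)).
        { rewrite <- (pow2_abs z). simpl in *. lra. }
        destruct E as [E|E]; [left; now apply exp_increasing|rewrite E; lra]. }
    replace (4 * K / z ^ 2) with (C / sqrt (2 * PI) * (exp (rho ^ 2) * / (z ^ 2 / 4)))
      by (unfold K; field; split; [lra|intros ->; simpl in Hz2; lra]).
    apply Rmult_le_compat_l; [apply Rmult_le_pos; [exact HC|left; now apply Rinv_0_lt_compat]|].
    apply Rmult_le_compat_l; [left; apply exp_pos|]. apply exp_neg_le_inv. lra.
Qed.

Lemma GI_lin v u w a b I J : GI v u I -> GI v w J -> GI v (fun x => a * u x + b * w x) (a * I + b * J).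
Proof.
  intros H1 H2. unfold GI.
  replace (gauss_integrand v (fun x => a * u x + b * w x))
    with (fun z => plus (scal a (gauss_integrand v u z)) (scal b (gauss_integrand v w z))).
  - apply (is_RInt_gen_plus (fun z => scal a (gauss_integrand v u z))
             (fun z => scal b (gauss_integrand v w z)) (scal a I) (scal b J));
      now apply (is_RInt_gen_scal (V := R_NormedModule)).
  - apply functional_extensionality. intros z. unfold gauss_integrand.
    change (a * (u (sqrt v * z) * (exp (- z ^ 2 / 2) / sqrt (2 * PI)))
            + b * (w (sqrt v * z) * (exp (- z ^ 2 / 2) / sqrt (2 * PI)))
      = (a * u (sqrt v * z) + b * w (sqrt v * z)) * (exp (- z ^ 2 / 2) / sqrt (2 * PI))). ring.
Qed.

Lemma GI_le (v : R) (u w : R -> R) (I J : R) : (forall x, continuous u x) -> (forall x, continuous w x) ->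
  (forall x, u x <= w x) -> GI v u I -> GI v w J -> I <= J.
Proof.
  intros Hu Hw H H1 H2.
  refine (is_lim_seq_le _ _ (Finite I) (Finite J) _
            (is_RInt_gen_seq (gauss_integrand v u) I H1) (is_RInt_gen_seq (gauss_integrand v w) J H2)).
  intros n. apply RInt_le.
  - assert (P := pos_INR n). lra.
  - apply ex_RInt_cont. intros; now apply gauss_integrand_cont.
  - apply ex_RInt_cont. intros; now apply gauss_integrand_cont.
  - intros x _. unfold gauss_integrand. apply Rmult_le_compat_r; [|apply H].
    apply Rmult_le_pos; [left; apply exp_pos|left; apply Rinv_0_lt_compat, sqrt_2PI_pos].
Qed.

Lemma continuous_exp_scal s x : continuous (fun x => exp (s * x)) x.
Proof. apply (ex_derive_continuous (fun x => exp (s * x))). auto_derive. exact I. Qed.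

(** Completing the square: the integrand is a multiple of a Gaussian centred at [s * sqrt v], with a
    translate of [gF] as primitive. The degenerate case v = 0 is included, the centre being 0. *)
Lemma GI_exp v s : 0 <= v -> GI v (fun x => exp (s * x)) (exp (s ^ 2 * v / 2)).
Proof.
  intros Hv. unfold GI. assert (P2 := sqrt_2PI_pos).
  set (c := s * sqrt v).
  set (G := fun z => exp (c ^ 2 / 2) / sqrt (2 * PI) * gF (z - c)).
  assert (Ec : c ^ 2 = s ^ 2 * v) by (unfold c; rewrite Rpow_mult_distr, pow2_sqrt by exact Hv; ring).
  replace (exp (s ^ 2 * v / 2))
    with (exp (c ^ 2 / 2) / sqrt (2 * PI) * gl - exp (c ^ 2 / 2) / sqrt (2 * PI) * (- gl))
    by (rewrite Ec; unfold gl; field; lra).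
  apply (is_RInt_gen_primitive _ G).
  - intros x. apply gauss_integrand_cont. intros y. apply continuous_exp_scal.
  - intros z. unfold G. evar_last.
    + apply @is_derive_scal. apply (is_derive_comp gF (fun z => z - c)); [apply gF_derive|].
      apply @is_derive_minus; [apply @is_derive_id|apply @is_derive_const].
    + unfold gauss_integrand.
      change (exp (c ^ 2 / 2) / sqrt (2 * PI) * ((1 - 0) * gk (z - c))
        = exp (s * (sqrt v * z)) * (exp (- z ^ 2 / 2) / sqrt (2 * PI))).
      unfold gk. rewrite Rminus_0_r, Rmult_1_l.
      replace (exp (c ^ 2 / 2) / sqrt (2 * PI) * exp (- (z - c) ^ 2 / 2))
        with (exp (c ^ 2 / 2) * exp (- (z - c) ^ 2 / 2) / sqrt (2 * PI)) by (field; lra).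
      replace (exp (s * (sqrt v * z)) * (exp (- z ^ 2 / 2) / sqrt (2 * PI)))
        with (exp (s * (sqrt v * z)) * exp (- z ^ 2 / 2) / sqrt (2 * PI)) by (field; lra).
      rewrite <- !exp_plus. f_equal. f_equal. unfold c. field.
  - apply (filterlim_comp _ _ _ (fun z => gF (z - c)) (fun y => exp (c ^ 2 / 2) / sqrt (2 * PI) * y)
             _ (locally gl)).
    + intros P HP. destruct (gF_lim_p P HP) as [M HM]. exists (M + c). intros x Hx. apply HM. lra.
    + apply (filterlim_scal_r (exp (c ^ 2 / 2) / sqrt (2 * PI)) gl).
  - apply (filterlim_comp _ _ _ (fun z => gF (z - c)) (fun y => exp (c ^ 2 / 2) / sqrt (2 * PI) * y)
             _ (locally (- gl))).
    + intros P HP. destruct (gF_lim_m P HP) as [M HM]. exists (M + c). intros x Hx. apply HM. lra.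
    + apply (filterlim_scal_r (exp (c ^ 2 / 2) / sqrt (2 * PI)) (- gl)).
Qed.

(** * From moment generating functions to weak convergence *)

Lemma exp_le a b : a <= b -> exp a <= exp b.
Proof. intros [H| ->]; [left; now apply exp_increasing|lra]. Qed.

(** A majorant of exp(r |x|) that is itself a sum of exponentials, so that its expectations converge
    by the hypothesis on generating functions. *)
Definition cosh2 (r x : R) : R := exp (r * x) + exp (- r * x).

Lemma exp_Rabs_le_cosh2 r x : exp (r * Rabs x) <= cosh2 r x.
Proof.
  unfold cosh2. assert (A := exp_pos (r * x)). assert (B := exp_pos (- r * x)).
  unfold Rabs. destruct (Rcase_abs x).
  - replace (r * - x) with (- r * x) by ring. lra.
  - lra.
Qed.

Lemma Rabs_exp_minus_1_le z : Rabs (exp z - 1) <= Rabs z * exp (Rabs z).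
Proof.
  assert (I := Rabs_increment_le (fun u => exp (u * z)) (fun u => Rabs z * exp (Rabs z) * u)
                 (fun u => z * exp (u * z)) (fun _ => Rabs z * exp (Rabs z)) 1 Rle_0_1).
  cbv beta in I. rewrite Rmult_0_l, exp_0, Rmult_1_l, Rmult_0_r, Rmult_1_r, Rminus_0_r in I.
  apply I.
  - intros u _. auto_derive; [exact Logic.I|ring].
  - intros u _. auto_derive; [exact Logic.I|ring].
  - intros u Hu. rewrite Rabs_mult, (Rabs_pos_eq (exp _)) by (left; apply exp_pos).
    apply Rmult_le_compat_l; [apply Rabs_pos|]. apply exp_le.
    assert (X := Rabs_pos z). assert (Y := Rle_abs z). nra.
Qed.

Lemma exp_taylor1 y : Rabs (exp y - 1 - y) <= y ^ 2 * exp (Rabs y).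
Proof.
  assert (I := Rabs_increment_le (fun u => exp (u * y) - 1 - u * y) (fun u => y ^ 2 * exp (Rabs y) * u)
                 (fun u => y * (exp (u * y) - 1)) (fun _ => y ^ 2 * exp (Rabs y)) 1 Rle_0_1).
  cbv beta in I. rewrite Rmult_0_l, exp_0, !Rmult_1_l, Rmult_0_r, Rmult_1_r, !Rminus_0_r, Rminus_diag in I.
  rewrite Rminus_0_r in I. apply I.
  - intros u _. auto_derive; [exact Logic.I|ring].
  - intros u _. auto_derive; [exact Logic.I|ring].
  - intros u Hu. rewrite <- (pow2_abs y), Rabs_mult.
    replace (Rabs y ^ 2 * exp (Rabs y)) with (Rabs y * (Rabs y * exp (Rabs y))) by ring.
    apply Rmult_le_compat_l; [apply Rabs_pos|].
    eapply Rle_trans; [apply Rabs_exp_minus_1_le|].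
    assert (X := Rabs_pos y).
    assert (L : Rabs (u * y) <= Rabs y) by (rewrite Rabs_mult, (Rabs_pos_eq u) by lra; nra).
    apply Rmult_le_compat; [apply Rabs_pos|left; apply exp_pos|exact L|now apply exp_le].
Qed.

Definition sinT (K : nat) (y : R) :=
  bsum K (fun k => (-1) ^ k * y ^ (2 * k + 1) / INR (fact (2 * k + 1))).
Definition cosT (K : nat) (y : R) :=
  bsum K (fun k => (-1) ^ k * y ^ (2 * k) / INR (fact (2 * k))).

Lemma is_derive_monomial m (y : R) : is_derive (fun y => y ^ S m / INR (fact (S m))) y (y ^ m / INR (fact m)).
Proof.
  assert (H := is_derive_exp_term 1 m y). evar_last.
  - eapply is_derive_ext; [|exact H]. intros t. cbv beta. rewrite pow1. now rewrite Rmult_1_l.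
  - rewrite pow1. now rewrite !Rmult_1_l.
Qed.

Ltac eqR := match goal with |- @eq _ ?a ?b => change (@eq R a b) end.

Lemma sinT_derive K (y : R) : is_derive (sinT K) y (cosT K y).
Proof.
  apply (is_derive_bsum K (fun k y => (-1) ^ k * y ^ (2 * k + 1) / INR (fact (2 * k + 1)))).
  intros k _. rewrite Nat.add_1_r.
  apply is_derive_ext with (fun y => (-1) ^ k * (y ^ S (2 * k) / INR (fact (S (2 * k))))).
  - intros t. eqR. unfold Rdiv. ring.
  - replace ((-1) ^ k * y ^ (2 * k) / INR (fact (2 * k)))
      with ((-1) ^ k * (y ^ (2 * k) / INR (fact (2 * k)))) by (unfold Rdiv; ring).
    apply @is_derive_scal, is_derive_monomial.
Qed.

Lemma cosT_derive K (y : R) : is_derive (cosT (S K)) y (- sinT K y).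
Proof.
  apply is_derive_ext with (fun y => 1 + bsum K (fun k => (-1) ^ S k * (y ^ S (2 * k + 1) / INR (fact (S (2 * k + 1)))))).
  - intros t. eqR. unfold cosT. rewrite bsum_S_l. f_equal; [simpl; field|].
    apply bsum_ext; intros k _. replace (2 * S k)%nat with (S (2 * k + 1)) by lia.
    unfold Rdiv. ring.
  - replace (- sinT K y) with (0 + -1 * sinT K y) by ring.
    apply @is_derive_plus; [apply @is_derive_const|].
    unfold sinT. rewrite <- bsum_scal.
    apply (is_derive_bsum K (fun k y => (-1) ^ S k * (y ^ S (2 * k + 1) / INR (fact (S (2 * k + 1)))))).
    intros k _.
    replace (-1 * ((-1) ^ k * y ^ (2 * k + 1) / INR (fact (2 * k + 1))))
      with ((-1) ^ S k * (y ^ (2 * k + 1) / INR (fact (2 * k + 1)))) by (simpl; unfold Rdiv; ring).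
    apply @is_derive_scal, is_derive_monomial.
Qed.

(** Starting from |cos| <= 1, the remainders of cosine and sine are integrated in turn, each being
    up to sign the derivative of the next. *)
Lemma sin_taylor_pos K : forall y, 0 <= y ->
  Rabs (cos y - cosT K y) <= y ^ (2 * K) / INR (fact (2 * K)) /\
  Rabs (sin y - sinT K y) <= y ^ S (2 * K) / INR (fact (S (2 * K))).
Proof.
  assert (step : forall K, (forall y, 0 <= y ->
      Rabs (cos y - cosT K y) <= y ^ (2 * K) / INR (fact (2 * K))) ->
    forall y, 0 <= y -> Rabs (sin y - sinT K y) <= y ^ S (2 * K) / INR (fact (S (2 * K)))).
  { intros k H y Hy.
    assert (Z : sin 0 - sinT k 0 = 0).
    { rewrite sin_0. unfold sinT. rewrite bsum_zero; [ring|]. intros i _.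
      rewrite Nat.add_1_r. simpl. unfold Rdiv. ring. }
    assert (I := Rabs_increment_le (fun y => sin y - sinT k y)
       (fun y => y ^ S (2 * k) / INR (fact (S (2 * k))))
       (fun y => cos y - cosT k y) (fun y => y ^ (2 * k) / INR (fact (2 * k))) y Hy).
    cbv beta in I. rewrite Z, pow_ne_zero in I by lia.
    replace (0 / INR (fact (S (2 * k)))) with 0 in I by (unfold Rdiv; ring).
    rewrite !Rminus_0_r in I. apply I.
    - intros u _. apply @is_derive_minus; [apply is_derive_sin|apply sinT_derive].
    - intros u _. apply is_derive_monomial.
    - intros u Hu. apply H. lra. }
  induction K as [|K IH].
  - assert (C0 : forall y, 0 <= y -> Rabs (cos y - cosT 0 y) <= y ^ (2 * 0) / INR (fact (2 * 0))).
    { intros y _. unfold cosT. simpl. rewrite Rminus_0_r. unfold Rdiv. rewrite Rinv_1, Rmult_1_l.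
      apply Rabs_le. apply COS_bound. }
    intros y Hy. split; [now apply C0|now apply step].
  - assert (C1 : forall y, 0 <= y ->
      Rabs (cos y - cosT (S K) y) <= y ^ (2 * S K) / INR (fact (2 * S K))).
    { intros y Hy. replace (2 * S K)%nat with (S (S (2 * K))) by lia.
      assert (Z : cos 0 - cosT (S K) 0 = 0).
      { rewrite cos_0. unfold cosT. rewrite bsum_S_l, bsum_zero; [simpl; field|]. intros i _.
        replace (2 * S i)%nat with (S (2 * i + 1)) by lia. simpl. unfold Rdiv. ring. }
      assert (I := Rabs_increment_le (fun y => cos y - cosT (S K) y)
         (fun y => y ^ S (S (2 * K)) / INR (fact (S (S (2 * K)))))
         (fun y => - sin y - - sinT K y) (fun y => y ^ S (2 * K) / INR (fact (S (2 * K)))) y Hy).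
      cbv beta in I. rewrite Z, (pow_ne_zero (S (S (2 * K)))) in I by lia.
      replace (0 / INR (fact (S (S (2 * K))))) with 0 in I by (unfold Rdiv; ring).
      rewrite !Rminus_0_r in I. apply I.
      - intros u _. apply @is_derive_minus; [apply is_derive_cos|apply cosT_derive].
      - intros u _. apply is_derive_monomial.
      - intros u Hu. replace (- sin u - - sinT K u) with (- (sin u - sinT K u)) by ring.
        rewrite Rabs_Ropp. apply IH. lra. }
    intros y Hy. split; [now apply C1|now apply step].
Qed.

Lemma sinT_odd K y : sinT K (- y) = - sinT K y.
Proof.
  unfold sinT. replace (- bsum K _) with
    (-1 * bsum K (fun k => (-1) ^ k * y ^ (2 * k + 1) / INR (fact (2 * k + 1)))) by ring.
  rewrite <- bsum_scal. apply bsum_ext; intros k _.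
  replace ((- y) ^ (2 * k + 1)) with (- y ^ (2 * k + 1)); [unfold Rdiv; ring|].
  rewrite !Nat.add_1_r. simpl pow. replace ((- y) ^ (k + (k + 0))) with (y ^ (k + (k + 0))); [ring|].
  replace (k + (k + 0))%nat with (2 * k)%nat by lia. rewrite !pow_mult. f_equal. ring.
Qed.

Lemma sin_taylor K y : Rabs (sin y - sinT K y) <= Rabs y ^ S (2 * K) / INR (fact (S (2 * K))).
Proof.
  destruct (Rle_lt_dec 0 y) as [H|H].
  - rewrite (Rabs_pos_eq y H). now apply sin_taylor_pos.
  - rewrite (Rabs_left y H), <- Rabs_Ropp.
    replace (- (sin y - sinT K y)) with (sin (- y) - sinT K (- y)) by (rewrite sin_neg, sinT_odd; ring).
    apply sin_taylor_pos. lra.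
Qed.

Lemma pow_fact_le_exp m y : 0 <= y -> y ^ m / INR (fact m) <= exp y.
Proof.
  revert y; induction m as [|m IH]; intros y Hy.
  - simpl. unfold Rdiv. rewrite Rinv_1, Rmult_1_l. assert (E := exp_ineq1_le y). lra.
  - assert (I := Rabs_increment_le (fun y => y ^ S m / INR (fact (S m))) exp
                   (fun y => y ^ m / INR (fact m)) exp y Hy).
    cbv beta in I. rewrite pow_ne_zero in I by lia.
    replace (0 / INR (fact (S m))) with 0 in I by (unfold Rdiv; ring).
    rewrite Rminus_0_r, exp_0 in I.
    apply Rle_trans with (exp y - 1); [|lra].
    eapply Rle_trans; [apply Rle_abs|]. apply I.
    + intros u _. apply is_derive_monomial.
    + intros u _. apply is_derive_exp.
    + intros u Hu. rewrite Rabs_pos_eq; [apply IH; lra|].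
      apply Rmult_le_pos; [apply pow_le; lra|left; apply Rinv_0_lt_compat, INR_fact_lt_0].
Qed.

Lemma expgrow_lin a b u w : expgrow u -> expgrow w -> expgrow (fun x => a * u x + b * w x).
Proof.
  intros [Hu [C [r [HC [Hr Bu]]]]] [Hw [C' [r' [HC' [Hr' Bw]]]]]. split.
  - intros x. apply (continuous_plus (fun x => a * u x) (fun x => b * w x)).
    + apply (continuous_scal_r a u), Hu.
    + apply (continuous_scal_r b w), Hw.
  - assert (A := Rabs_pos a). assert (B := Rabs_pos b).
    exists (Rabs a * C + Rabs b * C'), (r + r'). split; [|split].
    + apply Rplus_le_le_0_compat; now apply Rmult_le_pos.
    + lra.
    + intros x. assert (X := Rabs_pos x).
      eapply Rle_trans; [apply Rabs_triang|]. rewrite !Rabs_mult, Rmult_plus_distr_r.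
      apply Rplus_le_compat; rewrite Rmult_assoc; apply Rmult_le_compat_l; auto.
      * eapply Rle_trans; [apply Bu|]. apply Rmult_le_compat_l; [exact HC|].
        apply exp_le. apply Rmult_le_compat_r; lra.
      * eapply Rle_trans; [apply Bw|]. apply Rmult_le_compat_l; [exact HC'|].
        apply exp_le. apply Rmult_le_compat_r; lra.
Qed.

Lemma expgrow_mult u w : expgrow u -> expgrow w -> expgrow (fun x => u x * w x).
Proof.
  intros [Hu [C [r [HC [Hr Bu]]]]] [Hw [C' [r' [HC' [Hr' Bw]]]]]. split.
  - intros x. apply (continuous_mult u w); auto.
  - exists (C * C'), (r + r'). split; [now apply Rmult_le_pos|]. split; [lra|].
    intros x. rewrite Rabs_mult, Rmult_plus_distr_r, exp_plus.
    replace (C * C' * (exp (r * Rabs x) * exp (r' * Rabs x)))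
      with ((C * exp (r * Rabs x)) * (C' * exp (r' * Rabs x))) by ring.
    apply Rmult_le_compat; auto using Rabs_pos.
Qed.

Lemma expgrow_exp s : expgrow (fun x => exp (s * x)).
Proof.
  split; [intros; apply continuous_exp_scal|].
  exists 1, (Rabs s). split; [lra|]. split; [apply Rabs_pos|].
  intros x. rewrite Rabs_pos_eq by (left; apply exp_pos). rewrite Rmult_1_l, <- Rabs_mult.
  apply exp_le, Rle_abs.
Qed.

Lemma expgrow_bounded u M : (forall x, continuous u x) -> (forall x, Rabs (u x) <= M) -> expgrow u.
Proof.
  intros Hu HM. split; [exact Hu|]. exists M, 0. split; [|split; [lra|]].
  - eapply Rle_trans; [apply Rabs_pos|apply (HM 0)].
  - intros x. rewrite Rmult_0_l, exp_0, Rmult_1_r. apply HM.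
Qed.

Lemma expgrow_id : expgrow (fun x => x).
Proof.
  split; [intros; apply continuous_id|]. exists 1, 1. split; [lra|]. split; [lra|].
  intros x. assert (E := exp_ineq1_le (Rabs x)). rewrite !Rmult_1_l. lra.
Qed.

Section WeakConvergence.

Variable E : nat -> (R -> R) -> R.
Variable v : R.
Hypothesis v_nonneg : 0 <= v.
Hypothesis E_lin : forall n u w a b, E n (fun x => a * u x + b * w x) = a * E n u + b * E n w.
Hypothesis E_le : forall n u w, (forall x, u x <= w x) -> E n u <= E n w.
Hypothesis mgf_limit : forall s, is_lim_seq (fun n => E n (fun x => exp (s * x))) (exp (s ^ 2 * v / 2)).

(** Continuity is included because [GI_le] compares Gaussian integrals of continuous functions. *)
Definition Conv (u : R -> R) : Prop :=
  (forall x, continuous u x) /\ exists I : R, GI v u I /\ is_lim_seq (fun n => E n u) I.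

Lemma conv_ext u w : (forall x, u x = w x) -> Conv u -> Conv w.
Proof.
  intros H. replace w with u; [auto|]. now apply functional_extensionality.
Qed.

Lemma continuous_lin (u w : R -> R) a b x : continuous u x -> continuous w x ->
  continuous (fun x => a * u x + b * w x) x.
Proof.
  intros Hu Hw. apply (continuous_plus (fun x => a * u x) (fun x => b * w x)).
  - apply (continuous_scal_r a u), Hu.
  - apply (continuous_scal_r b w), Hw.
Qed.

Lemma conv_lin u w a b : Conv u -> Conv w -> Conv (fun x => a * u x + b * w x).
Proof.
  intros [Hu [I [HI LI]]] [Hw [J [HJ LJ]]]. split; [intros; now apply continuous_lin|].
  exists (a * I + b * J). split; [now apply GI_lin|].
  apply is_lim_seq_ext with (fun n => a * E n u + b * E n w); [intros; now rewrite E_lin|].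
  apply is_lim_seq_plus'; apply is_lim_seq_mult'; auto using is_lim_seq_const.
Qed.

Lemma conv_exp s : Conv (fun x => exp (s * x)).
Proof.
  split; [intros; apply continuous_exp_scal|].
  exists (exp (s ^ 2 * v / 2)). split; [now apply GI_exp|apply mgf_limit].
Qed.

Lemma conv_cosh2 r : Conv (cosh2 r).
Proof.
  apply conv_ext with (fun x => 1 * exp (r * x) + 1 * exp (- r * x)).
  - intros x. unfold cosh2. ring.
  - apply conv_lin; apply conv_exp.
Qed.

Lemma E_close n u u' h eta : (forall x, Rabs (u x - u' x) <= eta * h x) ->
  Rabs (E n u - E n u') <= eta * E n h.
Proof.
  intros H.
  (* The summand with coefficient 0 gives the majorant the two-term shape to which [E_lin]
     applies. *)
  assert (A := E_le n (fun x => 1 * u x + -1 * u' x) (fun x => eta * h x + 0 * h x)).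
  assert (B := E_le n (fun x => 1 * u' x + -1 * u x) (fun x => eta * h x + 0 * h x)).
  rewrite !E_lin in A, B. apply Rabs_le. split.
  - assert (K : 1 * E n u' + -1 * E n u <= eta * E n h + 0 * E n h); [|lra].
    apply B. intros x. specialize (H x). apply Rabs_le_between in H. lra.
  - assert (K : 1 * E n u + -1 * E n u' <= eta * E n h + 0 * E n h); [|lra].
    apply A. intros x. specialize (H x). apply Rabs_le_between in H. lra.
Qed.

Lemma GI_close u u' h eta I I' J :
  (forall x, continuous u x) -> (forall x, continuous u' x) -> (forall x, continuous h x) ->
  (forall x, Rabs (u x - u' x) <= eta * h x) ->
  GI v u I -> GI v u' I' -> GI v h J -> Rabs (I - I') <= eta * J.
Proof.
  intros Cu Cu' Ch H HI HI' HJ.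
  assert (A := GI_le v (fun x => 1 * u x + -1 * u' x) (fun x => eta * h x + 0 * h x)
     (1 * I + -1 * I') (eta * J + 0 * J)).
  assert (B := GI_le v (fun x => 1 * u' x + -1 * u x) (fun x => eta * h x + 0 * h x)
     (1 * I' + -1 * I) (eta * J + 0 * J)).
  apply Rabs_le. split.
  - assert (K : 1 * I' + -1 * I <= eta * J + 0 * J); [|lra].
    apply B; [intros; now apply continuous_lin|intros; now apply continuous_lin| |
              now apply GI_lin|now apply GI_lin].
    intros x. specialize (H x). apply Rabs_le_between in H. lra.
  - assert (K : 1 * I + -1 * I' <= eta * J + 0 * J); [|lra].
    apply A; [intros; now apply continuous_lin|intros; now apply continuous_lin| |
              now apply GI_lin|now apply GI_lin].
    intros x. specialize (H x). apply Rabs_le_between in H. lra.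
Qed.

(** Expectations of [cosh2 r] converge, hence stay bounded. An approximation that is small relative
    to [cosh2 r] on the whole line therefore changes little both the expectations under [E n] and
    the Gaussian one. *)
Lemma conv_closure u r : expgrow u ->
  (forall eta, 0 < eta -> exists u', Conv u' /\ forall x, Rabs (u x - u' x) <= eta * cosh2 r x) ->
  Conv u.
Proof.
  intros Hg H. destruct (GI_exists v u Hg) as [I HI]. destruct Hg as [Cu _].
  split; [exact Cu|]. exists I. split; [exact HI|].
  destruct (conv_cosh2 r) as [Ch [J [HJ LJ]]].
  apply is_lim_seq_spec. intros [eps Heps]. simpl.
  assert (J0 := Rabs_pos J).
  set (eta := eps / (4 * (Rabs J + 1))).
  assert (Heta : 0 < eta) by (apply Rdiv_lt_0_compat; lra).
  assert (Eeta : eta * (Rabs J + 1) = eps / 4) by (unfold eta; field; lra).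
  destruct (H eta Heta) as [u' [[Cu' [I' [HI' LI']]] Hb]].
  destruct (proj2 (is_lim_seq_spec _ _) LJ (mkposreal 1 Rlt_0_1)) as [n1 H1]. simpl in H1.
  destruct (proj2 (is_lim_seq_spec _ _) LI' (mkposreal (eps / 4) ltac:(lra))) as [n2 H2]. simpl in H2.
  exists (n1 + n2)%nat. intros n Hn. specialize (H1 n ltac:(lia)). specialize (H2 n ltac:(lia)).
  assert (A := E_close n u u' (cosh2 r) eta Hb).
  assert (B := GI_close u u' (cosh2 r) eta I I' J Cu Cu' Ch Hb HI HI' HJ).
  assert (JA := Rle_abs J).
  assert (A' : eta * E n (cosh2 r) <= eps / 4).
  { rewrite <- Eeta. apply Rmult_le_compat_l; [lra|]. apply Rabs_lt_between in H1. lra. }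
  assert (B' : eta * J <= eps / 4).
  { rewrite <- Eeta. apply Rmult_le_compat_l; lra. }
  replace (E n u - I) with ((E n u - E n u') + (E n u' - I') + (I' - I)) by ring.
  eapply Rle_lt_trans; [apply Rabs_triang|].
  eapply Rle_lt_trans; [apply Rplus_le_compat_r, Rabs_triang|].
  rewrite (Rabs_minus_sym I' I). lra.
Qed.

(* Asking for all exponential tilts makes the class stable under multiplication by x. *)
Definition Tconv (u : R -> R) : Prop := expgrow u /\ forall s, Conv (fun x => u x * exp (s * x)).

Lemma tconv_ext u w : (forall x, u x = w x) -> Tconv u -> Tconv w.
Proof.
  intros H. replace w with u; [auto|]. now apply functional_extensionality.
Qed.

Lemma tconv_1 : Tconv (fun _ => 1).
Proof.
  split.
  - apply expgrow_bounded with 1; [intros; apply continuous_const|intros; rewrite Rabs_R1; lra].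
  - intros s. apply conv_ext with (fun x => exp (s * x)); [intros; ring|apply conv_exp].
Qed.

Lemma tconv_lin u w a b : Tconv u -> Tconv w -> Tconv (fun x => a * u x + b * w x).
Proof.
  intros [H1 H2] [H3 H4]. split; [now apply expgrow_lin|]. intros s.
  apply conv_ext with (fun x => a * (u x * exp (s * x)) + b * (w x * exp (s * x))); [intros; ring|].
  now apply conv_lin.
Qed.

Lemma tconv_shift u h : Tconv u -> Tconv (fun x => u x * exp (h * x)).
Proof.
  intros [H1 H2]. split; [apply expgrow_mult; [exact H1|apply expgrow_exp]|]. intros s.
  apply conv_ext with (fun x => u x * exp ((h + s) * x)); [|apply H2].
  intros x. rewrite Rmult_plus_distr_r, exp_plus. ring.
Qed.

Lemma tconv_closure u r : expgrow u ->
  (forall eta, 0 < eta -> exists u', Tconv u' /\ forall x, Rabs (u x - u' x) <= eta * exp (r * Rabs x)) ->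
  Tconv u.
Proof.
  intros Hg H. split; [exact Hg|]. intros s.
  apply conv_closure with (r + Rabs s); [apply expgrow_mult; [exact Hg|apply expgrow_exp]|].
  intros eta Heta. destruct (H eta Heta) as [u' [[_ Hu'] Hb]].
  exists (fun x => u' x * exp (s * x)). split; [apply Hu'|]. intros x.
  rewrite <- Rmult_minus_distr_r, Rabs_mult, (Rabs_pos_eq (exp _)) by (left; apply exp_pos).
  apply Rle_trans with (eta * exp (r * Rabs x) * exp (Rabs s * Rabs x)).
  - apply Rmult_le_compat; [apply Rabs_pos|left; apply exp_pos|apply Hb|].
    apply exp_le. rewrite <- Rabs_mult. apply Rle_abs.
  - rewrite Rmult_assoc, <- exp_plus, <- Rmult_plus_distr_r.
    apply Rmult_le_compat_l; [lra|apply exp_Rabs_le_cosh2].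
Qed.

Lemma sq_le_exp y : 0 <= y -> y ^ 2 <= 2 * exp y.
Proof.
  intros Hy. assert (H := pow_fact_le_exp 2 y Hy). simpl in H. unfold Rdiv in H.
  simpl. lra.
Qed.

(* [x u(x)] is the derivative at h = 0 of [u(x) exp (h x)]. *)
Lemma tconv_X u : Tconv u -> Tconv (fun x => x * u x).
Proof.
  intros Hu. destruct Hu as [Hg Hs]. assert (Hu : Tconv u) by now split.
  assert (Hg' := Hg). destruct Hg' as [_ [C [r [HC [Hr Hb]]]]].
  apply tconv_closure with (r + 2); [apply expgrow_mult; [apply expgrow_id|exact Hg]|].
  intros eta Heta.
  (* By [exp_taylor1] and x^2 <= 2 exp |x|, the difference quotient with step h <= 1 has error at
     most h (2 C) exp((r + 2) |x|). *)
  set (h := Rmin 1 (eta / (2 * C + 1))).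
  assert (h0 : 0 < h) by (apply Rmin_pos; [lra|apply Rdiv_lt_0_compat; lra]).
  assert (h1 : h <= 1) by apply Rmin_l.
  assert (h2 : h * (2 * C) <= eta).
  { apply Rle_trans with (eta / (2 * C + 1) * (2 * C + 1)); [|right; field; lra].
    apply Rmult_le_compat; [lra|lra|apply Rmin_r|lra]. }
  exists (fun x => / h * (u x * exp (h * x)) + - / h * u x).
  split; [apply tconv_lin; [now apply tconv_shift|exact Hu]|].
  intros x. assert (X := Rabs_pos x).
  replace (x * u x - (/ h * (u x * exp (h * x)) + - / h * u x))
    with (- (/ h * (u x * (exp (h * x) - 1 - h * x)))) by (field; lra).
  rewrite Rabs_Ropp, !Rabs_mult, (Rabs_pos_eq (/ h)) by (left; now apply Rinv_0_lt_compat).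
  assert (T := exp_taylor1 (h * x)).
  apply Rle_trans with (/ h * ((C * exp (r * Rabs x)) * ((h * x) ^ 2 * exp (Rabs (h * x))))).
  { apply Rmult_le_compat_l; [left; now apply Rinv_0_lt_compat|].
    apply Rmult_le_compat; auto using Rabs_pos. }
  replace (/ h * ((C * exp (r * Rabs x)) * ((h * x) ^ 2 * exp (Rabs (h * x)))))
    with (h * C * exp (r * Rabs x) * (x ^ 2 * exp (Rabs (h * x)))) by (field; lra).
  apply Rle_trans with (h * C * exp (r * Rabs x) * (2 * exp (Rabs x) * exp (Rabs x))).
  { apply Rmult_le_compat_l.
    - apply Rmult_le_pos; [apply Rmult_le_pos; lra|left; apply exp_pos].
    - apply Rmult_le_compat; [apply pow2_ge_0|left; apply exp_pos| |].
      + rewrite <- (pow2_abs x). now apply sq_le_exp.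
      + apply exp_le. rewrite Rabs_mult, (Rabs_pos_eq h) by lra.
        rewrite <- (Rmult_1_l (Rabs x)) at 2. apply Rmult_le_compat_r; lra. }
  replace (exp ((r + 2) * Rabs x)) with (exp (r * Rabs x) * exp (Rabs x) * exp (Rabs x))
    by (rewrite <- !exp_plus; f_equal; ring).
  replace (h * C * exp (r * Rabs x) * (2 * exp (Rabs x) * exp (Rabs x)))
    with (h * (2 * C) * (exp (r * Rabs x) * exp (Rabs x) * exp (Rabs x))) by ring.
  apply Rmult_le_compat_r; [|exact h2].
  repeat apply Rmult_le_pos; left; apply exp_pos.
Qed.

Lemma tconv_pow u k : Tconv u -> Tconv (fun x => x ^ k * u x).
Proof.
  intros Hu. induction k as [|k IH].
  - apply tconv_ext with u; [intros; simpl; ring|exact Hu].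
  - apply tconv_ext with (fun x => x * (x ^ k * u x)); [intros; simpl; ring|now apply tconv_X].
Qed.

Lemma tconv_bsum m (c : nat -> R) (u : nat -> R -> R) :
  (forall k, (k < m)%nat -> Tconv (u k)) -> Tconv (fun x => bsum m (fun k => c k * u k x)).
Proof.
  induction m as [|m IH]; intros H.
  - apply tconv_ext with (fun x => 0 * 1 + 0 * 1); [intros; simpl; ring|].
    apply (tconv_lin (fun _ => 1) (fun _ => 1)); apply tconv_1.
  - apply tconv_ext with (fun x => 1 * bsum m (fun k => c k * u k x) + c m * u m x);
      [intros; simpl; ring|].
    apply tconv_lin; [apply IH; intros; apply H; lia|apply H; lia].
Qed.

Lemma tconv_sinT u om K : Tconv u -> Tconv (fun x => sinT K (om * x) * u x).
Proof.
  intros Hu.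
  apply tconv_ext with (fun x => bsum K (fun k =>
     ((-1) ^ k * om ^ (2 * k + 1) / INR (fact (2 * k + 1))) * (x ^ (2 * k + 1) * u x))).
  - intros x. unfold sinT. rewrite (Rmult_comm _ (u x)), <- bsum_scal. apply bsum_ext; intros k _.
    rewrite Rpow_mult_distr. unfold Rdiv. ring.
  - apply (tconv_bsum K _ (fun k x => x ^ (2 * k + 1) * u x)). intros k _. now apply tconv_pow.
Qed.

(** The Taylor remainder |y|^m / m! equals 2^(-m) (2 |y|)^m / m!, at most 2^(-m) exp(2 |y|). So
    Taylor sums converge on the whole line relative to an exponential of fixed rate. *)
Lemma tconv_sin u om : Tconv u -> Tconv (fun x => sin (om * x) * u x).
Proof.
  intros Hu. assert (Hg : expgrow u) by apply Hu.
  assert (Hg' := Hg). destruct Hg' as [_ [C [r [HC [Hr Hb]]]]].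
  apply tconv_closure with (2 * Rabs om + r).
  - apply (expgrow_mult (fun x => sin (om * x)) u); [|exact Hg].
    apply expgrow_bounded with 1.
    + intros x. apply (ex_derive_continuous (fun x => sin (om * x))). auto_derive. exact I.
    + intros x. apply Rabs_le. apply SIN_bound.
  - intros eta Heta.
    destruct (pow_lt_1_zero (/ 2)) with (y := eta / (C + 1)) as [n0 Hn0].
    { rewrite Rabs_pos_eq; lra. } { apply Rdiv_lt_0_compat; lra. }
    exists (fun x => sinT n0 (om * x) * u x). split; [now apply tconv_sinT|].
    intros x. rewrite <- Rmult_minus_distr_r, Rabs_mult.
    set (m := S (2 * n0)). specialize (Hn0 m ltac:(unfold m; lia)).
    rewrite Rabs_pos_eq in Hn0 by (apply pow_le; lra).
    assert (T := sin_taylor n0 (om * x)). fold m in T.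
    assert (F := pow_fact_le_exp m (2 * Rabs (om * x)) ltac:(assert (Q := Rabs_pos (om * x)); lra)).
    assert (P : 0 < (/ 2) ^ m) by (apply pow_lt; lra).
    assert (T' : Rabs (sin (om * x) - sinT n0 (om * x)) <= (/ 2) ^ m * exp (2 * Rabs (om * x))).
    { eapply Rle_trans; [exact T|].
      apply Rle_trans with ((/ 2) ^ m * ((2 * Rabs (om * x)) ^ m / INR (fact m))).
      - right. unfold Rdiv. rewrite <- Rmult_assoc, <- Rpow_mult_distr. f_equal. f_equal. field.
      - apply Rmult_le_compat_l; lra. }
    apply Rle_trans with ((/ 2) ^ m * exp (2 * Rabs (om * x)) * (C * exp (r * Rabs x))).
    { apply Rmult_le_compat; auto using Rabs_pos. }
    replace (exp ((2 * Rabs om + r) * Rabs x)) with (exp (2 * Rabs (om * x)) * exp (r * Rabs x))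
      by (rewrite <- exp_plus, Rabs_mult; f_equal; ring).
    replace ((/ 2) ^ m * exp (2 * Rabs (om * x)) * (C * exp (r * Rabs x)))
      with ((/ 2) ^ m * C * (exp (2 * Rabs (om * x)) * exp (r * Rabs x))) by ring.
    apply Rmult_le_compat_r; [apply Rmult_le_pos; left; apply exp_pos|].
    apply Rle_trans with (eta / (C + 1) * (C + 1)); [|right; field; lra].
    apply Rmult_le_compat; lra.
Qed.

Lemma tconv_sin_pow om k : Tconv (fun x => ((sin (om * x) + 1) / 2) ^ k).
Proof.
  induction k as [|k IH]; [apply tconv_1|].
  apply tconv_ext with (fun x => / 2 * (sin (om * x) * ((sin (om * x) + 1) / 2) ^ k)
                                 + / 2 * ((sin (om * x) + 1) / 2) ^ k).
  - intros x. simpl. field.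
  - apply tconv_lin; [now apply tconv_sin|exact IH].
Qed.

Lemma conv_pol_sin a D om : Conv (fun x => pol a D ((sin (om * x) + 1) / 2)).
Proof.
  assert (H : Tconv (fun x => pol a D ((sin (om * x) + 1) / 2))).
  { apply (tconv_bsum D a (fun k x => ((sin (om * x) + 1) / 2) ^ k)). intros k _. apply tconv_sin_pow. }
  destruct H as [_ H]. apply conv_ext with (2 := H 0). intros x. rewrite Rmult_0_l, exp_0. ring.
Qed.

Lemma cosh2_ge_1 x : 1 <= cosh2 1 x.
Proof.
  assert (H := exp_Rabs_le_cosh2 1 x). assert (X := Rabs_pos x).
  assert (E0 := exp_ineq1_le (1 * Rabs x)). lra.
Qed.

(** Truncation at - sin 1 and sin 1 keeps the argument strictly inside (-1, 1), where [asin] is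
    differentiable. *)
Lemma asin_clamp_cont M x :
  0 < M -> continuous (fun y => M * asin (Rmax (- sin 1) (Rmin (sin 1) (2 * y - 1)))) x.
Proof.
  intros HM. assert (P := PI_RGT_0). assert (P2 := PI2_3_2).
  assert (S1 : sin 1 < 1).
  { assert (S : sin 1 < sin (PI / 2)) by (apply sin_increasing_1; lra). now rewrite sin_PI2 in S. }
  assert (S0 : 0 < sin 1) by (apply sin_gt_0; lra).
  set (z := Rmax (- sin 1) (Rmin (sin 1) (2 * x - 1))).
  assert (Hz : -1 < z < 1).
  { unfold z, Rmax, Rmin. repeat destruct (Rle_dec _ _); lra. }
  apply (continuous_comp (fun y => Rmax (- sin 1) (Rmin (sin 1) (2 * y - 1))) (fun z => M * asin z)).
  - apply filterlim_locally. intros eps.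
    assert (He : 0 < eps / 2) by (assert (Q := cond_pos eps); lra).
    enough (Main : forall y : R, Rabs (y - x) < eps / 2 ->
      Rabs (Rmax (- sin 1) (Rmin (sin 1) (2 * y - 1)) - Rmax (- sin 1) (Rmin (sin 1) (2 * x - 1))) < eps)
      by (exists (mkposreal _ He); exact Main).
    intros y Hy. apply Rabs_lt_between in Hy. apply Rabs_lt_between.
    unfold Rmax, Rmin. repeat destruct (Rle_dec _ _); lra.
  - fold z. apply (continuous_scal_r M asin). apply continuity_pt_filterlim, derivable_continuous_pt.
    now apply derivable_pt_asin.
Qed.

(* On [-M, M], g is a continuous function of sin (x / M), hence close to a polynomial in it; outside,
   g and this polynomial are bounded, hence small with respect to [cosh2 1]. *)
Lemma mgf_weak_convergence g : (exists M, forall x, Rabs (g x) <= M) ->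
  (forall x, continuous g x) -> Conv g.
Proof.
  intros [M0 HM0] Hg.
  assert (M0p : 0 <= M0) by (eapply Rle_trans; [apply Rabs_pos|apply (HM0 0)]).
  apply conv_closure with 1; [now apply expgrow_bounded with M0|].
  intros eta Heta.
  (* Outside [-M, M] the error is at most 2 M0 + eta / 2. With this M, 2 M0 is at most eta / 2 times
     exp M, hence at most eta / 2 times [cosh2 1 x] there. *)
  set (M := Rmax 1 ((2 * M0 + 1) / (eta / 2))).
  assert (M1 : 1 <= M) by apply Rmax_l.
  assert (M2 : 2 * M0 <= eta / 2 * exp M).
  { assert (E1 := exp_ineq1_le M). assert (Q := Rmax_r 1 ((2 * M0 + 1) / (eta / 2))). fold M in Q.
    apply Rle_trans with (eta / 2 * ((2 * M0 + 1) / (eta / 2))).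
    - replace (eta / 2 * ((2 * M0 + 1) / (eta / 2))) with (2 * M0 + 1) by (field; lra). lra.
    - apply Rmult_le_compat_l; lra. }
  (* The inverse of x -> (sin(x / M) + 1) / 2 on [-M, M], extended continuously to the line. *)
  set (th := fun y => M * asin (Rmax (- sin 1) (Rmin (sin 1) (2 * y - 1)))).
  destruct (weierstrass (fun y => g (th y)) (eta / 2)) as [a [D Ha]].
  { intros y. apply (continuous_comp th g); [apply asin_clamp_cont; lra|apply Hg]. }
  { lra. }
  exists (fun x => pol a D ((sin (/ M * x) + 1) / 2)). split; [apply conv_pol_sin|].
  intros x. assert (H1 := cosh2_ge_1 x).
  assert (Hin : in01 ((sin (/ M * x) + 1) / 2)).
  { unfold in01. assert (B := SIN_bound (/ M * x)). lra. }
  specialize (Ha _ Hin). cbv beta in Ha.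
  assert (P := PI_RGT_0). assert (P2 := PI2_3_2).
  destruct (Rle_lt_dec (Rabs x) M) as [L|L].
  - assert (Eth : th ((sin (/ M * x) + 1) / 2) = x).
    { unfold th. replace (2 * ((sin (/ M * x) + 1) / 2) - 1) with (sin (/ M * x)) by field.
      assert (B : -1 <= / M * x <= 1).
      { apply Rabs_le_between in L. split; apply Rmult_le_reg_l with M; try lra;
          rewrite <- Rmult_assoc, Rinv_r by lra; lra. }
      assert (S1 : - sin 1 <= sin (/ M * x) <= sin 1).
      { rewrite <- sin_neg. split; apply sin_incr_1; lra. }
      rewrite Rmin_right, Rmax_right by lra. rewrite asin_sin by lra. field. lra. }
    rewrite Eth in Ha.
    apply Rle_trans with (eta / 2); [exact Ha|].
    apply Rle_trans with (eta * 1); [lra|]. apply Rmult_le_compat_l; lra.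
  - assert (Q := HM0 x). assert (Q' := HM0 (th ((sin (/ M * x) + 1) / 2))).
    set (p := pol a D ((sin (/ M * x) + 1) / 2)) in *.
    set (y := g (th ((sin (/ M * x) + 1) / 2))) in *.
    replace (g x - p) with (g x - y + (y - p)) by ring.
    eapply Rle_trans; [apply Rabs_triang|].
    assert (Rabs (g x - y) <= 2 * M0).
    { unfold Rminus. eapply Rle_trans; [apply Rabs_triang|]. rewrite Rabs_Ropp. lra. }
    assert (exp M <= cosh2 1 x).
    { eapply Rle_trans; [|apply exp_Rabs_le_cosh2]. apply exp_le. lra. }
    assert (eta / 2 * exp M <= eta / 2 * cosh2 1 x) by (apply Rmult_le_compat_l; lra).
    assert (eta / 2 * 1 <= eta / 2 * cosh2 1 x) by (apply Rmult_le_compat_l; lra).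
    lra.
Qed.

End WeakConvergence.

(** * Fourier coefficients *)

Section Fourier.

Variables a b : R.
Hypothesis a_pos : 0 < a.
Hypothesis b_lo : 0 <= b - 2 * a.
Hypothesis b_hi : b + 2 * a <= 1.

Lemma symbol_in01 th : in01 (2 * a * cos th + b).
Proof. assert (B := COS_bound th). unfold in01. split; nra. Qed.

Lemma continuous_symbol (f : R -> R) (h : R -> R) :
  (forall x, continuous f x) -> (forall x, continuous h x) ->
  forall th, continuous (fun th => f (2 * a * cos th + b) * h th) th.
Proof.
  intros Hf Hh th. apply (continuous_mult (fun th => f (2 * a * cos th + b)) h); [|apply Hh].
  apply (continuous_comp (fun th => 2 * a * cos th + b) f); [|apply Hf].
  apply (ex_derive_continuous (fun th => 2 * a * cos th + b)). auto_derive. exact I.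
Qed.

Lemma continuous_cos_scal r x : continuous (fun th => cos (r * th)) x.
Proof. apply (ex_derive_continuous (fun th => cos (r * th))). auto_derive. exact I. Qed.

Lemma continuous_sin_scal r x : continuous (fun th => sin (r * th)) x.
Proof. apply (ex_derive_continuous (fun th => sin (r * th))). auto_derive. exact I. Qed.

Lemma fhat_re_ext f g k : (forall x, in01 x -> f x = g x) -> fhat_re f a b k = fhat_re g a b k.
Proof.
  intros H. unfold fhat_re. f_equal. apply RInt_ext. intros th _. now rewrite (H _ (symbol_in01 th)).
Qed.

Lemma fhat_im_ext f g k : (forall x, in01 x -> f x = g x) -> fhat_im f a b k = fhat_im g a b k.
Proof.
  intros H. unfold fhat_im. f_equal. apply RInt_ext. intros th _. now rewrite (H _ (symbol_in01 th)).
Qed.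

(** The reflection th -> 2 pi - th preserves the symbol and reverses the sine, so the integral
    equals its own negative. *)
Lemma fhat_im_0 (f : R -> R) k : (forall x, continuous f x) -> fhat_im f a b k = 0.
Proof.
  intros Hf. unfold fhat_im.
  set (h := fun th => f (2 * a * cos th + b) * sin (INR k * th)).
  assert (Ch : forall th, continuous h th)
    by (apply continuous_symbol; [exact Hf|apply continuous_sin_scal]).
  assert (E := RInt_comp_lin h (-1) (2 * PI) 0 (2 * PI) (ex_RInt_cont h _ _ Ch)).
  replace (-1 * 0 + 2 * PI) with (2 * PI) in E by ring.
  replace (-1 * (2 * PI) + 2 * PI) with 0 in E by ring.
  rewrite (RInt_ext _ h) in E.
  - assert (S := opp_RInt_swap h 0 (2 * PI) (ex_RInt_cont h _ _ Ch)).
    rewrite <- S in E. change (RInt h 0 (2 * PI) = - RInt h 0 (2 * PI)) in E.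
    replace (RInt h 0 (2 * PI)) with 0 by lra. ring.
  - intros th _. unfold h. change (-1 * (f (2 * a * cos (-1 * th + 2 * PI) + b) * sin (INR k * (-1 * th + 2 * PI)))
      = f (2 * a * cos th + b) * sin (INR k * th)).
    replace (-1 * th + 2 * PI) with (- th + 2 * INR 1 * PI) by (simpl; ring).
    rewrite cos_period, cos_neg.
    replace (INR k * (- th + 2 * INR 1 * PI)) with (- (INR k * th) + 2 * INR k * PI) by (simpl; ring).
    rewrite sin_period, sin_neg. ring.
Qed.

(** Fourier coefficients of powers of the symbol. The integer index lets the recursion of [Jm_S]
    pass below 0. *)
Definition Jm (m : nat) (z : Z) : R :=
  / (2 * PI) * RInt (fun th => (2 * a * cos th + b) ^ m * cos (IZR z * th)) 0 (2 * PI).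

Lemma continuous_pow m (x : R) : continuous (fun x => x ^ m) x.
Proof. apply (ex_derive_continuous (fun x => x ^ m)). auto_derive. exact I. Qed.

Lemma Jm_S m z : Jm (S m) z = a * Jm m (z - 1) + b * Jm m z + a * Jm m (z + 1).
Proof.
  unfold Jm.
  set (h := fun w th => (2 * a * cos th + b) ^ m * cos (IZR w * th)).
  assert (Ch : forall w th, continuous (h w) th)
    by (intros w; apply (continuous_symbol (fun x => x ^ m)); [apply continuous_pow|apply continuous_cos_scal]).
  assert (Eh : forall w, is_RInt (h w) 0 (2 * PI) (RInt (h w) 0 (2 * PI)))
    by (intros w; apply (RInt_correct (h w)), ex_RInt_cont, Ch).
  assert (Sum : is_RInt (fun th => a * h (z - 1)%Z th + b * h z th + a * h (z + 1)%Z th) 0 (2 * PI)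
    (a * RInt (h (z - 1)%Z) 0 (2 * PI) + b * RInt (h z) 0 (2 * PI) + a * RInt (h (z + 1)%Z) 0 (2 * PI))).
  { apply (is_RInt_plus (fun th => a * h (z - 1)%Z th + b * h z th) (fun th => a * h (z + 1)%Z th)).
    - apply (is_RInt_plus (fun th => a * h (z - 1)%Z th) (fun th => b * h z th)).
      + apply (is_RInt_scal (h (z - 1)%Z) _ _ a), Eh.
      + apply (is_RInt_scal (h z) _ _ b), Eh.
    - apply (is_RInt_scal (h (z + 1)%Z) _ _ a), Eh. }
  rewrite (RInt_ext _ (fun th => a * h (z - 1)%Z th + b * h z th + a * h (z + 1)%Z th)).
  - rewrite (is_RInt_unique _ _ _ _ Sum). unfold h. ring.
  - intros th _. unfold h. rewrite minus_IZR, plus_IZR.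
    replace ((IZR z - 1) * th) with (IZR z * th - th) by ring.
    replace ((IZR z + 1) * th) with (IZR z * th + th) by ring.
    rewrite cos_minus, cos_plus. cbn [pow]. eqR. ring.
Qed.

Lemma Jm_0 z : Jm 0 z = if Z.eqb z 0 then 1 else 0.
Proof.
  assert (P := PI_RGT_0). unfold Jm.
  destruct (Z.eqb_spec z 0) as [->|Hz].
  - rewrite (RInt_ext _ (fun _ => 1)).
    + rewrite RInt_const. change (/ (2 * PI) * ((2 * PI - 0) * 1) = 1). field. lra.
    + intros th _. eqR. rewrite Rmult_0_l, cos_0. simpl. ring.
  - assert (Hz' : IZR z <> 0) by (now apply not_0_IZR).
    assert (E : is_RInt (fun th => (2 * a * cos th + b) ^ 0 * cos (IZR z * th)) 0 (2 * PI)
                  (minus (sin (IZR z * (2 * PI)) / IZR z) (sin (IZR z * 0) / IZR z))).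
    { apply (is_RInt_derive (fun th => sin (IZR z * th) / IZR z)).
      - intros th _. auto_derive; [exact I|]. simpl. field. exact Hz'.
      - intros th _. apply (continuous_symbol (fun x => x ^ 0)); [apply continuous_pow|apply continuous_cos_scal]. }
    rewrite (is_RInt_unique _ _ _ _ E). rewrite Rmult_0_r, sin_0.
    rewrite (sin_eq_0_1 (IZR z * (2 * PI))) by (exists (2 * z)%Z; rewrite mult_IZR; ring).
    change (/ (2 * PI) * (0 / IZR z - 0 / IZR z) = 0). unfold Rdiv. ring.
Qed.

(** The recursion of [Jm] has off-diagonal weights a, a where that of [Tz] has 1, a^2, as for
    orthonormal versus monic polynomials; conjugation by powers of a relates them. *)
Lemma Jm_Tz m z : Jm m z = Tz b (a ^ 2) m z * powerRZ a z.
Proof.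
  revert z; induction m as [|m IH]; intros z.
  - rewrite Jm_0. simpl. destruct (Z.eqb_spec z 0) as [->|Hz]; [simpl; ring|ring].
  - rewrite Jm_S, !IH. cbn [Tz].
    assert (E : powerRZ a z = powerRZ a (z - 1) * a).
    { replace z with ((z - 1) + 1)%Z at 1 by lia. rewrite powerRZ_add by lra. now rewrite powerRZ_1. }
    assert (E' : powerRZ a (z + 1) = powerRZ a z * a).
    { rewrite powerRZ_add by lra. now rewrite powerRZ_1. }
    rewrite E', E. ring.
Qed.

Lemma Jm_even m z : Jm m (- z) = Jm m z.
Proof.
  unfold Jm. f_equal. apply RInt_ext. intros th _. eqR. rewrite opp_IZR.
  replace (- IZR z * th) with (- (IZR z * th)) by ring. now rewrite cos_neg.
Qed.

Lemma Tz_far be al m z : (Z.of_nat m < z)%Z -> Tz be al m z = 0.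
Proof.
  revert z; induction m as [|m IH]; intros z Hz; simpl.
  - destruct (Z.eqb_spec z 0); [lia|reflexivity].
  - rewrite !IH by lia. ring.
Qed.

Lemma fhat_re_plus (f g : R -> R) c k : (forall x, continuous f x) -> (forall x, continuous g x) ->
  fhat_re (fun x => f x + c * g x) a b k = fhat_re f a b k + c * fhat_re g a b k.
Proof.
  intros Hf Hg. unfold fhat_re.
  set (hf := fun th => f (2 * a * cos th + b) * cos (INR k * th)).
  set (hg := fun th => g (2 * a * cos th + b) * cos (INR k * th)).
  assert (Sum : is_RInt (fun th => hf th + c * hg th) 0 (2 * PI)
                  (RInt hf 0 (2 * PI) + c * RInt hg 0 (2 * PI))).
  { apply (is_RInt_plus hf (fun th => c * hg th)).
    - apply (RInt_correct hf), ex_RInt_cont, continuous_symbol; [exact Hf|apply continuous_cos_scal].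
    - apply (is_RInt_scal hg _ _ c).
      apply (RInt_correct hg), ex_RInt_cont, continuous_symbol; [exact Hg|apply continuous_cos_scal]. }
  rewrite (RInt_ext _ (fun th => hf th + c * hg th)).
  - rewrite (is_RInt_unique _ _ _ _ Sum). ring.
  - intros th _. unfold hf, hg. eqR. ring.
Qed.

Lemma fhat_re_scal (f : R -> R) c k : (forall x, continuous f x) ->
  fhat_re (fun x => c * f x) a b k = c * fhat_re f a b k.
Proof.
  intros Hf.
  assert (Z : fhat_re (fun _ => 0) a b k = 0).
  { unfold fhat_re. rewrite (RInt_ext _ (fun _ => 0)) by (intros; eqR; ring).
    rewrite RInt_const. change (/ (2 * PI) * ((2 * PI - 0) * 0) = 0). ring. }
  rewrite (fhat_re_ext _ (fun x => 0 + c * f x)) by (intros; ring).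
  rewrite (fhat_re_plus (fun _ => 0) f c k (fun x => continuous_const 0 x) Hf), Z. ring.
Qed.

Lemma fhat_re_bound (f : R -> R) eps k : (forall x, continuous f x) ->
  (forall x, in01 x -> Rabs (f x) <= eps) -> Rabs (fhat_re f a b k) <= eps.
Proof.
  intros Hf He. assert (P := PI_RGT_0). unfold fhat_re.
  rewrite Rabs_mult, Rabs_pos_eq by (left; apply Rinv_0_lt_compat; lra).
  assert (B : Rabs (RInt (fun th => f (2 * a * cos th + b) * cos (INR k * th)) 0 (2 * PI))
              <= (2 * PI - 0) * eps).
  { apply (abs_RInt_le_const (fun th => f (2 * a * cos th + b) * cos (INR k * th))).
    - lra.
    - apply ex_RInt_cont, continuous_symbol; [exact Hf|apply continuous_cos_scal].
    - intros th _. rewrite Rabs_mult.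
      assert (B1 := He _ (symbol_in01 th)).
      assert (B2 : Rabs (cos (INR k * th)) <= 1) by (apply Rabs_le, COS_bound).
      rewrite <- (Rmult_1_r eps). apply Rmult_le_compat; auto using Rabs_pos. }
  apply Rle_trans with (/ (2 * PI) * ((2 * PI - 0) * eps)); [|right; field; lra].
  apply Rmult_le_compat_l; [left; apply Rinv_0_lt_compat; lra|exact B].
Qed.

Lemma continuous_pol p D x : continuous (pol p D) x.
Proof.
  induction D as [|D IH]; [apply (continuous_const 0)|].
  apply (continuous_plus (pol p D) (fun x => p D * x ^ D)); [exact IH|].
  apply (continuous_scal_r (p D) (fun x => x ^ D)), continuous_pow.
Qed.

Lemma fhat_re_pol p D k : fhat_re (pol p D) a b k = bsum D (fun m => p m * Jm m (Z.of_nat k)).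
Proof.
  induction D as [|D IH].
  - simpl. rewrite (fhat_re_ext _ (fun x => 0 * 0)) by (intros; unfold pol; simpl; ring).
    rewrite (fhat_re_scal (fun _ => 0) 0 k (fun x => continuous_const 0 x)). ring.
  - simpl. rewrite <- IH.
    rewrite (fhat_re_ext _ (fun x => pol p D x + p D * x ^ D)) by (intros; reflexivity).
    rewrite fhat_re_plus; [|intros; apply continuous_pol|intros; apply continuous_pow].
    f_equal. f_equal. unfold fhat_re, Jm. now rewrite INR_IZR_INZ.
Qed.

(** The opposite entries carry the factors a^k and a^(-k), which cancel, and [Jm] is even in its
    index. *)
Lemma Tpol_fhat p D k :
  Tpol p D b (a ^ 2) (Z.of_nat k) * Tpol p D b (a ^ 2) (- Z.of_nat k) = fhat_re (pol p D) a b k ^ 2.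
Proof.
  assert (E : forall z, bsum D (fun m => p m * Jm m z) = Tpol p D b (a ^ 2) z * powerRZ a z).
  { intros z. unfold Tpol. rewrite Rmult_comm, <- bsum_scal. apply bsum_ext; intros m _.
    rewrite Jm_Tz. ring. }
  assert (E2 : bsum D (fun m => p m * Jm m (- Z.of_nat k)) = bsum D (fun m => p m * Jm m (Z.of_nat k)))
    by (apply bsum_ext; intros; now rewrite Jm_even).
  assert (X : powerRZ a (Z.of_nat k) * powerRZ a (- Z.of_nat k) = 1).
  { rewrite <- powerRZ_add by lra. now rewrite Z.add_opp_diag_r. }
  rewrite fhat_re_pol. assert (F1 := E (Z.of_nat k)). assert (F2 := E (- Z.of_nat k)%Z).
  rewrite E2 in F2.
  set (S := bsum D (fun m => p m * Jm m (Z.of_nat k))) in *.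
  replace (S ^ 2) with (S * S) by ring. rewrite F1 at 1. rewrite F2.
  set (p1 := powerRZ a (Z.of_nat k)) in *. set (p2 := powerRZ a (- Z.of_nat k)) in *.
  replace (Tpol p D b (a ^ 2) (Z.of_nat k) * p1 * (Tpol p D b (a ^ 2) (- Z.of_nat k) * p2))
    with (Tpol p D b (a ^ 2) (Z.of_nat k) * Tpol p D b (a ^ 2) (- Z.of_nat k) * (p1 * p2)) by ring.
  rewrite X. ring.
Qed.

Lemma fhat_re_pol_far p D k : (D <= k)%nat -> fhat_re (pol p D) a b k = 0.
Proof.
  intros Hk. rewrite fhat_re_pol. apply bsum_zero; intros m Hm.
  rewrite Jm_Tz, Tz_far by lia. ring.
Qed.

(** Source of the weight k in the variance: the distance k = p + q + 1 arises from exactly k pairs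
    (p, q). *)
Lemma bsum_abel n (H : nat -> R) :
  bsum n (fun p => bsum n H - bsum p H) = bsum n (fun j => INR (S j) * H j).
Proof.
  induction n as [|n IH]; [reflexivity|].
  cbn [bsum]. rewrite <- IH.
  rewrite (bsum_ext n (fun p => bsum n H + H n - bsum p H) (fun p => (bsum n H - bsum p H) + H n))
    by (intros; ring).
  rewrite bsum_plus, bsum_const, S_INR. ring.
Qed.

Definition vpart (f : R -> R) (K : nat) := bsum K (fun m => INR (S m) * fhat_re f a b (S m) ^ 2).

Lemma toeplitz_variance_vpart p D K : (D <= K)%nat ->
  toeplitz_variance b (a ^ 2) p D = vpart (pol p D) K.
Proof.
  intros HK. unfold toeplitz_variance, vpart.
  set (H := fun j => fhat_re (pol p D) a b (S j) ^ 2).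
  assert (HH : forall j, (D <= j)%nat -> H j = 0).
  { intros j Hj. unfold H. rewrite fhat_re_pol_far by lia. simpl; ring. }
  rewrite (bsum_widen D K); [|exact HK|].
  2:{ intros i Hi. change (fhat_re (pol p D) a b (S i) ^ 2) with (H i). rewrite HH by lia. ring. }
  change (bsum D (fun m => INR (S m) * fhat_re (pol p D) a b (S m) ^ 2))
    with (bsum D (fun j => INR (S j) * H j)).
  rewrite <- (bsum_abel D H). apply bsum_ext; intros i Hi.
  replace (bsum D H) with (bsum (i + D) H)
    by (apply bsum_widen; [lia|intros; apply HH; lia]).
  rewrite bsum_split. replace (bsum i H + bsum D (fun i0 => H (i + i0)%nat) - bsum i H)
    with (bsum D (fun i0 => H (i + i0)%nat)) by ring.
  apply bsum_ext; intros q _. rewrite Tpol_fhat. unfold H. now rewrite Nat.add_1_r.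
Qed.

End Fourier.

(** * The variance series and the central limit theorem *)

Lemma Rabs_pow_diff m x y : in01 x -> in01 y -> Rabs (x ^ m - y ^ m) <= INR m * Rabs (x - y).
Proof.
  intros Hx Hy. induction m as [|m IH]; [simpl; rewrite Rminus_diag, Rabs_R0; lra|].
  replace (x ^ S m - y ^ S m) with (x * (x ^ m - y ^ m) + (x - y) * y ^ m) by (simpl; ring).
  eapply Rle_trans; [apply Rabs_triang|]. rewrite !Rabs_mult, S_INR.
  assert (H1 : Rabs x * Rabs (x ^ m - y ^ m) <= 1 * (INR m * Rabs (x - y))).
  { apply Rmult_le_compat; auto using Rabs_pos. destruct Hx. rewrite Rabs_pos_eq; lra. }
  assert (H2 : Rabs (x - y) * Rabs (y ^ m) <= Rabs (x - y) * 1).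
  { apply Rmult_le_compat_l; [apply Rabs_pos|]. destruct Hy.
    rewrite Rabs_pos_eq by (now apply pow_le). rewrite <- (pow1 m). apply pow_incr. lra. }
  lra.
Qed.

Lemma pol_lipschitz p D : exists L, 0 <= L /\ forall x y, in01 x -> in01 y ->
  Rabs (pol p D x - pol p D y) <= L * Rabs (x - y).
Proof.
  exists (bsum D (fun m => Rabs (p m) * INR m)). split.
  - apply bsum_nonneg; intros. apply Rmult_le_pos; [apply Rabs_pos|apply pos_INR].
  - intros x y Hx Hy. unfold pol. rewrite <- bsum_minus.
    eapply Rle_trans; [apply bsum_Rabs|].
    rewrite Rmult_comm, <- bsum_scal. apply bsum_le; intros m _.
    rewrite <- Rmult_minus_distr_l, Rabs_mult.
    replace (Rabs (x - y) * (Rabs (p m) * INR m)) with (Rabs (p m) * (INR m * Rabs (x - y))) by ring.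
    apply Rmult_le_compat_l; [apply Rabs_pos|now apply Rabs_pow_diff].
Qed.

Lemma is_pol_comb p D q E c : exists r F, forall x, pol r F x = pol p D x + c * pol q E x.
Proof.
  destruct (is_pol_plus (pol p D) (fun x => c * pol q E x)) as [r [F H]].
  - now exists p, D.
  - apply is_pol_scal. now exists q, E.
  - exists r, F. intros x. now rewrite H.
Qed.

Lemma sum_n_bsum (u : nat -> R) n : sum_n u n = bsum (S n) u.
Proof.
  induction n as [|n IH]; [rewrite sum_O; simpl; ring|].
  rewrite sum_Sn, IH. reflexivity.
Qed.

Lemma nonneg_series (u : nat -> R) M : (forall n, 0 <= u n) -> (forall n, bsum n u <= M) ->
  ex_series u /\ is_lim_seq (fun n => bsum n u) (Series u).
Proof.
  intros Hu HM.
  assert (L : ex_finite_lim_seq (sum_n u)).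
  { apply (ex_finite_lim_seq_incr _ M).
    - intros n. rewrite !sum_n_bsum. simpl. specialize (Hu (S n)). lra.
    - intros n. rewrite sum_n_bsum. apply HM. }
  destruct L as [l Hl].
  assert (S : is_series u l) by exact Hl.
  split; [now exists l|]. rewrite (is_series_unique _ _ S).
  apply is_lim_seq_incr_1. apply is_lim_seq_ext with (2 := Hl). intros n. apply sum_n_bsum.
Qed.

Lemma le_of_small x y C : 0 <= C -> (forall d, 0 < d <= 1 -> x <= y + d * C) -> x <= y.
Proof.
  intros HC H. apply Rnot_lt_le. intros Hlt.
  set (d := Rmin 1 ((x - y) / (2 * (C + 1)))).
  assert (Hd : 0 < d) by (apply Rmin_pos; [lra|apply Rdiv_lt_0_compat; lra]).
  specialize (H d (conj Hd (Rmin_l _ _))).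
  assert (d * C <= (x - y) / 2); [|lra].
  apply Rle_trans with ((x - y) / (2 * (C + 1)) * (C + 1)); [|right; field; lra].
  apply Rmult_le_compat; [lra|lra|apply Rmin_r|lra].
Qed.

Definition lip (g : R -> R) (L : R) : Prop :=
  forall x y, in01 x -> in01 y -> Rabs (g x - g y) <= L * Rabs (x - y).

(** What the argument uses of a C^1 function, in a form that passes directly to multiples of f. *)
Definition approximable (f : R -> R) : Prop :=
  (forall x, continuous (fun y => f (clamp y)) x) /\
  forall eps, 0 < eps -> exists p D,
    (forall x, in01 x -> Rabs (f x - pol p D x) <= eps) /\ lip (fun x => f x - pol p D x) eps.

Lemma C1_approximable f : C1_on_01 f -> approximable f.
Proof. intros H. split; [now apply C1_continuous_clamp|]. intros eps He. now apply C1_approx. Qed.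

Lemma approximable_scal f s : approximable f -> approximable (fun x => s * f x).
Proof.
  intros [Hc H]. split.
  - intros x. apply (continuous_scal_r s (fun y => f (clamp y))), Hc.
  - intros eps He. assert (S := Rabs_pos s).
    set (e := eps / (Rabs s + 1)).
    assert (He' : 0 < e) by (apply Rdiv_lt_0_compat; lra).
    assert (Hse : Rabs s * e <= eps).
    { replace eps with ((Rabs s + 1) * e) by (unfold e; field; lra).
      apply Rmult_le_compat_r; lra. }
    destruct (H _ He') as [p [D [H1 H2]]].
    destruct (is_pol_scal s (pol p D)) as [q [F HF]]; [now exists p, D|].
    exists q, F. split.
    + intros x Hx. rewrite <- HF. replace (s * f x - s * pol p D x) with (s * (f x - pol p D x)) by ring.
      rewrite Rabs_mult. apply Rle_trans with (Rabs s * e); [|exact Hse].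
      apply Rmult_le_compat_l; [exact S|now apply H1].
    + intros x y Hx Hy. rewrite <- !HF.
      replace (s * f x - s * pol p D x - (s * f y - s * pol p D y))
        with (s * ((f x - pol p D x) - (f y - pol p D y))) by ring.
      rewrite Rabs_mult. apply Rle_trans with (Rabs s * (e * Rabs (x - y))).
      * apply Rmult_le_compat_l; [exact S|now apply H2].
      * rewrite <- Rmult_assoc. apply Rmult_le_compat_r; [apply Rabs_pos|exact Hse].
Qed.

Lemma lip_sub f g K L : lip f K -> lip g L -> lip (fun x => f x - g x) (K + L).
Proof.
  intros Hf Hg x y Hx Hy.
  replace (f x - g x - (f y - g y)) with ((f x - f y) + - (g x - g y)) by ring.
  eapply Rle_trans; [apply Rabs_triang|]. rewrite Rabs_Ropp, Rmult_plus_distr_r.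
  apply Rplus_le_compat; auto.
Qed.

Lemma lip_ext f g L : (forall x, f x = g x) -> lip f L -> lip g L.
Proof. intros H Hf x y Hx Hy. rewrite <- !H. auto. Qed.

Section CentralLimit.

Variables A B t : R.
Hypothesis hA : 0 <= A.
Hypothesis hB : 0 <= B.
Hypothesis ht : 1 < t.
Variables alpha beta : nat -> R.
Variable Nn : nat -> nat.
Hypothesis halpha : forall n, -1 < alpha n.
Hypothesis hbeta : forall n, -1 < beta n.
Hypothesis lim_alpha : is_lim_seq (fun n => alpha n / INR n) A.
Hypothesis lim_beta : is_lim_seq (fun n => beta n / INR n) B.
Hypothesis lim_N : is_lim_seq (fun n => INR (Nn n) / INR n) t.

Let a := a_par A B t.
Let b := b_par A B t.
Let a_pos : 0 < a := proj1 (support_bound A B t hA hB ht).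
Let b_lo : 0 <= b - 2 * a := proj1 (proj2 (support_bound A B t hA hB ht)).
Let b_hi : b + 2 * a <= 1 := proj2 (proj2 (support_bound A B t hA hB ht)).

Notation Ex n := (hahn_expect n (Nn n) (alpha n) (beta n)).

Definition centered (f : R -> R) (n : nat) (l : list nat) : R :=
  lin_stat f (Nn n) l - Ex n (lin_stat f (Nn n)).

Lemma size_eventually : eventually (fun n => (n <= Nn n)%nat /\ (0 < Nn n)%nat).
Proof.
  destruct (Nn_large t ht Nn lim_N 0) as [n0 H0]. exists (n0 + 1)%nat. intros n Hn.
  specialize (H0 n ltac:(lia)). lia.
Qed.

Definition sig p D := toeplitz_variance b (a ^ 2) p D.

Lemma varK_pol_limit p D eps : 0 < eps -> eventually (fun n => forall s, 0 <= s <= 1 ->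
  Rabs (varK (Nn n) (node (Nn n)) (fun i => pol p D (node (Nn n) i))
          (Wd (hahn_weight (Nn n) (alpha n) (beta n)) (fun i => pol p D (node (Nn n) i)) s) n
        - sig p D) <= eps).
Proof.
  apply (varK_limit Nn (Nn_large t ht Nn lim_N) (fun n => hahn_weight (Nn n) (alpha n) (beta n))).
  - intros n i _. now apply hahn_weight_pos.
  - lra.
  - assert (a <= 1) by lra. split; [apply pow2_ge_0|]. rewrite <- (pow1 2). apply pow_incr. lra.
  - intros d e He.
    now apply (hahn_initial_limits A B t hA hB ht alpha beta Nn halpha hbeta lim_alpha lim_beta lim_N).
Qed.

(** [sig p D] is a limit of variances, each at most L^2 by [varK_lipschitz]; s = 0 suffices. *)
Lemma sig_le p D L : 0 <= L -> lip (pol p D) L -> sig p D <= L ^ 2.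
Proof.
  intros HL Hp. apply le_of_small with 1; [lra|]. intros d Hd. rewrite Rmult_1_r.
  destruct (varK_pol_limit p D d (proj1 Hd)) as [n0 H0]. destruct size_eventually as [n1 H1].
  destruct (H1 (n0 + n1)%nat ltac:(lia)) as [S1 S2].
  specialize (H0 (n0 + n1)%nat ltac:(lia) 0 ltac:(lra)).
  set (n := (n0 + n1)%nat) in *.
  assert (Hc : 0 < / INR (Nn n)) by (apply Rinv_0_lt_compat, lt_0_INR; lia).
  assert (V : varK (Nn n) (node (Nn n)) (fun i => pol p D (node (Nn n) i))
          (Wd (hahn_weight (Nn n) (alpha n) (beta n)) (fun i => pol p D (node (Nn n) i)) 0) n <= L ^ 2).
  { apply (varK_lipschitz (Nn n) (node (Nn n)) _ Hc (fun i => eq_refl)); auto.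
    - apply Wd_pos. intros i _. now apply hahn_weight_pos.
    - apply node_bounds.
    - intros x y Hx Hy. apply Hp; now apply node_bounds. }
  apply Rabs_le_between in H0. lra.
Qed.

Lemma sig_vpart p D K : (D <= K)%nat -> sig p D = vpart a b (pol p D) K.
Proof. now apply toeplitz_variance_vpart. Qed.

Lemma vpart_term_nonneg f m : 0 <= INR (S m) * fhat_re f a b (S m) ^ 2.
Proof. apply Rmult_le_pos; [apply pos_INR|apply pow2_ge_0]. Qed.

Lemma vpart_le_sig p D K : vpart a b (pol p D) K <= sig p D.
Proof.
  rewrite (sig_vpart p D (K + D)) by lia. unfold vpart. rewrite bsum_split.
  assert (H := bsum_nonneg D (fun i => INR (S (K + i)) * fhat_re (pol p D) a b (S (K + i)) ^ 2)
                 (fun i _ => vpart_term_nonneg _ _)). lra.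
Qed.

(** Polynomials uniformly close to g have nearby Fourier coefficients, and their partial sums are
    bounded by [sig_le] with almost the same Lipschitz constant. *)
Lemma vpart_le (g : R -> R) L K : (forall x, continuous g x) -> 0 <= L ->
  (forall d, 0 < d <= 1 -> exists p D,
     (forall x, in01 x -> Rabs (g x - pol p D x) <= d) /\ lip (pol p D) (L + d)) ->
  vpart a b g K <= L ^ 2.
Proof.
  intros Hg HL H.
  (* From x^2 - y^2 = (x - y)(2x - (x - y)), C bounds the change of the partial sum per unit of d.
     It depends on K, which stays fixed while d tends to 0. *)
  set (C := bsum K (fun m => INR (S m) * (2 * Rabs (fhat_re g a b (S m)) + 1))).
  assert (HC : 0 <= C).
  { apply bsum_nonneg; intros m _. apply Rmult_le_pos; [apply pos_INR|].
    assert (Q := Rabs_pos (fhat_re g a b (S m))). lra. }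
  apply le_of_small with (2 * L + 1 + C); [lra|]. intros d Hd.
  destruct (H d Hd) as [p [D [H1 H2]]].
  assert (S1 := sig_le p D (L + d) ltac:(lra) H2). assert (S2 := vpart_le_sig p D K).
  assert (S3 : vpart a b g K - vpart a b (pol p D) K <= d * C).
  { unfold vpart, C. rewrite <- bsum_minus, <- bsum_scal. apply bsum_le. intros m _.
    set (x := fhat_re g a b (S m)). set (y := fhat_re (pol p D) a b (S m)).
    assert (E : Rabs (x - y) <= d).
    { replace (x - y) with (fhat_re (fun z => g z + -1 * pol p D z) a b (S m)).
      - apply (fhat_re_bound a b a_pos b_lo b_hi).
        + intros z. apply (continuous_plus g (fun z => -1 * pol p D z)); [apply Hg|].
          apply (continuous_scal_r (-1) (pol p D)), continuous_pol.
        + intros z Hz. replace (g z + -1 * pol p D z) with (g z - pol p D z) by ring. now apply H1.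
      - rewrite fhat_re_plus; [unfold x, y; ring|exact Hg|intros; apply continuous_pol]. }
    replace (INR (S m) * x ^ 2 - INR (S m) * y ^ 2) with (INR (S m) * ((x - y) * (2 * x - (x - y)))) by ring.
    replace (d * (INR (S m) * (2 * Rabs x + 1))) with (INR (S m) * (d * (2 * Rabs x + 1))) by ring.
    apply Rmult_le_compat_l; [apply pos_INR|].
    eapply Rle_trans; [apply Rle_abs|]. rewrite Rabs_mult.
    apply Rmult_le_compat; try apply Rabs_pos; [exact E|].
    unfold Rminus at 1. eapply Rle_trans; [apply Rabs_triang|].
    rewrite Rabs_Ropp, Rabs_mult, (Rabs_pos_eq 2) by lra. lra. }
  assert (d ^ 2 <= d) by (destruct Hd; simpl; nra).
  assert ((L + d) ^ 2 = L ^ 2 + d * (2 * L) + d ^ 2) by ring. nra.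
Qed.

Section Approximable.

Variable f : R -> R.
Hypothesis f_app : approximable f.

Let fc (x : R) : R := f (clamp x).

Lemma fc_cont x : continuous fc x.
Proof. apply f_app. Qed.

Lemma approximable_lip : exists L, 0 <= L /\ lip f L.
Proof.
  destruct (proj2 f_app 1 Rlt_0_1) as [p [D [_ H]]]. destruct (pol_lipschitz p D) as [L [HL HpL]].
  exists (1 + L). split; [lra|]. intros x y Hx Hy.
  replace (f x - f y) with ((f x - pol p D x - (f y - pol p D y)) + (pol p D x - pol p D y)) by ring.
  eapply Rle_trans; [apply Rabs_triang|]. rewrite Rmult_plus_distr_r.
  apply Rplus_le_compat; [now apply H|now apply HpL].
Qed.

Lemma approx_lip p D eps L : lip f L -> lip (fun x => f x - pol p D x) eps -> lip (pol p D) (L + eps).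
Proof.
  intros H1 H2. apply lip_ext with (fun x => f x - (f x - pol p D x)); [intros; ring|].
  now apply lip_sub.
Qed.

Lemma vpart_fc L K : 0 <= L -> lip f L -> vpart a b fc K <= L ^ 2.
Proof.
  intros HL Hf. apply vpart_le; [apply fc_cont|exact HL|]. intros d Hd.
  destruct (proj2 f_app d (proj1 Hd)) as [p [D [H1 H2]]]. exists p, D. split.
  - intros x Hx. unfold fc. rewrite clamp_id by exact Hx. now apply H1.
  - now apply approx_lip.
Qed.

(** f minus the polynomial is approximated in turn by differences of polynomials, with Lipschitz
    constants eps + d. *)
Lemma vpart_remainder p D eps K : 0 <= eps -> lip (fun x => f x - pol p D x) eps ->
  vpart a b (fun x => fc x + -1 * pol p D x) K <= eps ^ 2.
Proof.
  intros He Hl. apply vpart_le; [|exact He|].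
  - intros x. apply (continuous_plus fc (fun z => -1 * pol p D z)); [apply fc_cont|].
    apply (continuous_scal_r (-1) (pol p D)), continuous_pol.
  - intros d Hd. destruct (proj2 f_app d (proj1 Hd)) as [q [E [H1 H2]]].
    destruct (is_pol_comb q E p D (-1)) as [r [F HF]]. exists r, F. split.
    + intros x Hx. rewrite HF. unfold fc. rewrite clamp_id by exact Hx.
      replace (f x + -1 * pol p D x - (pol q E x + -1 * pol p D x)) with (f x - pol q E x) by ring.
      now apply H1.
    + apply lip_ext with (fun x => (f x - pol p D x) - (f x - pol q E x));
        [intros; rewrite HF; ring|now apply lip_sub].
Qed.

Lemma var_term_fc m : var_term f a b m = INR (S m) * fhat_re fc a b (S m) ^ 2.
Proof.
  assert (E : forall x, in01 x -> f x = fc x) by (intros x Hx; unfold fc; now rewrite clamp_id).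
  unfold var_term, fhat_abs2.
  rewrite (fhat_re_ext a b a_pos b_lo b_hi f fc _ E), (fhat_im_ext a b a_pos b_lo b_hi f fc _ E).
  rewrite fhat_im_0 by apply fc_cont. ring.
Qed.

Lemma var_term_bsum K : bsum K (var_term f a b) = vpart a b fc K.
Proof. apply bsum_ext; intros m _. apply var_term_fc. Qed.

Lemma var_series : ex_series (var_term f a b) /\
  is_lim_seq (fun K => vpart a b fc K) (Series (var_term f a b)).
Proof.
  destruct approximable_lip as [L [HL Hf]].
  destruct (nonneg_series (var_term f a b) (L ^ 2)) as [H1 H2].
  - intros m. rewrite var_term_fc. apply vpart_term_nonneg.
  - intros K. rewrite var_term_bsum. now apply vpart_fc.
  - split; [exact H1|]. apply is_lim_seq_ext with (2 := H2). intros K. apply var_term_bsum.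
Qed.

Lemma var_series_nonneg : 0 <= Series (var_term f a b).
Proof.
  destruct var_series as [_ H].
  apply (is_lim_seq_le (fun _ => 0) (fun K => vpart a b fc K) (Finite 0) (Finite _));
    [|apply is_lim_seq_const|exact H].
  intros K. apply bsum_nonneg; intros. apply vpart_term_nonneg.
Qed.

(** With y the coefficient of the polynomial and z that of the remainder, |(y + z)^2 - y^2| <= (1 +
    1/eps) z^2 + eps y^2. The weighted sum of z^2 is at most eps^2 and that of y^2 at most L^2, so
    the bound is of order eps. *)
Lemma var_series_close p D eps L : 0 < eps -> 0 <= L ->
  lip (pol p D) L -> lip (fun x => f x - pol p D x) eps ->
  Rabs (Series (var_term f a b) - sig p D) <= (1 + / eps) * eps ^ 2 + eps * L ^ 2.
Proof.
  intros He HL Hp Hr.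
  set (c := (1 + / eps) * eps ^ 2 + eps * L ^ 2).
  assert (Hi : 0 < / eps) by now apply Rinv_0_lt_compat.
  assert (Key : forall K, (D <= K)%nat -> Rabs (vpart a b fc K - sig p D) <= c).
  { intros K HK. rewrite (sig_vpart p D K HK).
    set (g := fun x => fc x + -1 * pol p D x).
    assert (V1 : vpart a b g K <= eps ^ 2) by (apply vpart_remainder; [lra|exact Hr]).
    assert (V2 : vpart a b (pol p D) K <= L ^ 2)
      by (eapply Rle_trans; [apply vpart_le_sig|now apply sig_le]).
    apply Rle_trans with ((1 + / eps) * vpart a b g K + eps * vpart a b (pol p D) K).
    - unfold vpart. rewrite <- bsum_minus, <- !bsum_scal, <- bsum_plus.
      eapply Rle_trans; [apply bsum_Rabs|]. apply bsum_le; intros m _.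
      assert (E : fhat_re g a b (S m) = fhat_re fc a b (S m) + -1 * fhat_re (pol p D) a b (S m))
        by (apply fhat_re_plus; [apply fc_cont|intros; apply continuous_pol]).
      set (y := fhat_re (pol p D) a b (S m)) in *. set (z := fhat_re g a b (S m)) in *.
      replace (fhat_re fc a b (S m)) with (y + z) by lra.
      replace (INR (S m) * (y + z) ^ 2 - INR (S m) * y ^ 2) with (INR (S m) * (z ^ 2 + 2 * (y * z))) by ring.
      replace ((1 + / eps) * (INR (S m) * z ^ 2) + eps * (INR (S m) * y ^ 2))
        with (INR (S m) * (z ^ 2 + (/ eps * z ^ 2 + eps * y ^ 2))) by ring.
      rewrite Rabs_mult, (Rabs_pos_eq (INR _)) by apply pos_INR.
      apply Rmult_le_compat_l; [apply pos_INR|].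
      assert (P1 : 0 <= / eps * (z - eps * y) ^ 2) by (apply Rmult_le_pos; [lra|apply pow2_ge_0]).
      assert (P2 : 0 <= / eps * (z + eps * y) ^ 2) by (apply Rmult_le_pos; [lra|apply pow2_ge_0]).
      replace (/ eps * (z - eps * y) ^ 2) with (/ eps * z ^ 2 + eps * y ^ 2 - 2 * (y * z)) in P1
        by (field; lra).
      replace (/ eps * (z + eps * y) ^ 2) with (/ eps * z ^ 2 + eps * y ^ 2 + 2 * (y * z)) in P2
        by (field; lra).
      assert (Z := pow2_ge_0 z). apply Rabs_le. lra.
    - apply Rplus_le_compat; apply Rmult_le_compat_l; lra. }
  destruct var_series as [_ Hlim].
  apply Rabs_le. split.
  - assert (sig p D - c <= Series (var_term f a b)); [|lra].
    apply (is_lim_seq_le_loc (fun _ => sig p D - c) (fun K => vpart a b fc K) (Finite _) (Finite _));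
      [|apply is_lim_seq_const|exact Hlim].
    exists D. intros K HK. specialize (Key K HK). apply Rabs_le_between in Key. lra.
  - assert (Series (var_term f a b) <= sig p D + c); [|lra].
    apply (is_lim_seq_le_loc (fun K => vpart a b fc K) (fun _ => sig p D + c) (Finite _) (Finite _));
      [|exact Hlim|apply is_lim_seq_const].
    exists D. intros K HK. specialize (Key K HK). apply Rabs_le_between in Key. lra.
Qed.

End Approximable.

Lemma centered_scal s f n l : centered (fun x => s * f x) n l = s * centered f n l.
Proof.
  unfold centered. rewrite lin_stat_scal.
  replace (Ex n (lin_stat (fun x => s * f x) (Nn n))) with (s * Ex n (lin_stat f (Nn n))); [ring|].
  rewrite <- Ex_scal. f_equal.
  apply functional_extensionality. intros k. now rewrite lin_stat_scal.
Qed.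

Lemma centered_plus f g n l : centered (fun x => f x + g x) n l = centered f n l + centered g n l.
Proof.
  unfold centered. rewrite lin_stat_plus.
  replace (Ex n (lin_stat (fun x => f x + g x) (Nn n)))
    with (Ex n (lin_stat f (Nn n)) + Ex n (lin_stat g (Nn n))); [ring|].
  rewrite <- Ex_plus. f_equal.
  apply functional_extensionality. intros k. now rewrite lin_stat_plus.
Qed.

Lemma mgf_pol p D : is_lim_seq (fun n => Ex n (fun l => exp (centered (pol p D) n l)))
                               (exp (sig p D / 2)).
Proof.
  apply is_lim_seq_spec. intros eps. unfold centered.
  assert (C : continuity_pt exp (sig p D / 2)) by apply derivable_continuous_pt, derivable_pt_exp.
  destruct (proj1 (continuity_pt_locally exp _) C eps) as [d Hd].
  destruct (varK_pol_limit p D d (cond_pos d)) as [n0 H0]. destruct size_eventually as [n1 H1].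
  exists (n0 + n1)%nat. intros n Hn.
  destruct (H1 n ltac:(lia)) as [S1 S2]. specialize (H0 n ltac:(lia)).
  destruct (log_mgf_close n (Nn n) S1 S2 (alpha n) (beta n) (halpha n) (hbeta n) (pol p D) _ _ H0)
    as [k [-> Hk]].
  apply Hd. change (Rabs (k - sig p D / 2) < d). assert (Q := cond_pos d). lra.
Qed.

(* Cauchy-Schwarz with weight tau for [exp Y_q (exp Y_g - 1)]. *)
Lemma mgf_close q g n L eps tau : (n <= Nn n)%nat -> (0 < Nn n)%nat ->
  0 <= L -> 0 <= eps -> 0 < tau -> lip q L -> lip g eps ->
  Rabs (Ex n (fun l => exp (centered (fun x => q x + g x) n l)) - Ex n (fun l => exp (centered q n l)))
  <= / 2 * (tau * exp ((2 * L) ^ 2) + / tau * (exp ((2 * eps) ^ 2) - 1)).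
Proof.
  intros S1 S2 HL He Ht Hq Hg.
  assert (Hi : 0 < / tau) by now apply Rinv_0_lt_compat.
  assert (le := Ex_le n (Nn n) S1 S2 (alpha n) (beta n) (halpha n) (hbeta n)).
  assert (lips := mgf_lipschitz n (Nn n) S1 S2 (alpha n) (beta n) (halpha n) (hbeta n)).
  assert (dbl : forall h K, 0 <= K -> lip h K -> Ex n (fun l => exp (2 * centered h n l)) <= exp ((2 * K) ^ 2)).
  { intros h K HK Hh.
    replace (fun l => exp (2 * centered h n l)) with (fun l => exp (centered (fun x => 2 * h x) n l)).
    - apply (lips (fun x => 2 * h x)); [lra|]. intros x y Hx Hy.
      rewrite <- Rmult_minus_distr_l, Rabs_mult, (Rabs_pos_eq 2), Rmult_assoc by lra.
      apply Rmult_le_compat_l; [lra|now apply Hh].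
    - apply functional_extensionality. intros l. now rewrite centered_scal. }
  assert (B1 := dbl q L HL Hq). assert (B2 := dbl g eps He Hg).
  assert (B3 : 1 <= Ex n (fun l => exp (centered g n l))) by now apply (lips g eps).
  set (rhs := fun l => / 2 * (tau * exp (2 * centered q n l)
       + / tau * (exp (2 * centered g n l) + (-2 * exp (centered g n l) + 1)))).
  assert (Er : Ex n rhs = / 2 * (tau * Ex n (fun l => exp (2 * centered q n l))
       + / tau * (Ex n (fun l => exp (2 * centered g n l))
                  + (-2 * Ex n (fun l => exp (centered g n l)) + 1)))).
  { unfold rhs. rewrite Ex_scal, Ex_plus, !Ex_scal, !Ex_plus, Ex_scal.
    rewrite (Ex_1 n (Nn n) S1 S2 (alpha n) (beta n) (halpha n) (hbeta n)). reflexivity. }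
  assert (Br : Ex n rhs <= / 2 * (tau * exp ((2 * L) ^ 2) + / tau * (exp ((2 * eps) ^ 2) - 1))).
  { rewrite Er. apply Rmult_le_compat_l; [lra|].
    apply Rplus_le_compat; apply Rmult_le_compat_l; lra. }
  assert (P : forall l, Rabs (exp (centered (fun x => q x + g x) n l) - exp (centered q n l)) <= rhs l).
  { intros l. rewrite centered_plus, exp_plus. unfold rhs.
    set (x := exp (centered q n l)). set (y := exp (centered g n l)).
    replace (2 * centered q n l) with (centered q n l + centered q n l) by ring.
    replace (2 * centered g n l) with (centered g n l + centered g n l) by ring.
    rewrite !exp_plus. fold x y.
    assert (P1 : 0 <= / tau * (tau * x - (y - 1)) ^ 2) by (apply Rmult_le_pos; [lra|apply pow2_ge_0]).
    assert (P2 : 0 <= / tau * (tau * x + (y - 1)) ^ 2) by (apply Rmult_le_pos; [lra|apply pow2_ge_0]).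
    replace (/ tau * (tau * x - (y - 1)) ^ 2)
      with (tau * (x * x) + / tau * (y * y + (-2 * y + 1)) - 2 * (x * y - x)) in P1 by (field; lra).
    replace (/ tau * (tau * x + (y - 1)) ^ 2)
      with (tau * (x * x) + / tau * (y * y + (-2 * y + 1)) + 2 * (x * y - x)) in P2 by (field; lra).
    apply Rabs_le. lra. }
  assert (U1 : Ex n (fun l => exp (centered (fun x => q x + g x) n l) + -1 * exp (centered q n l)) <= Ex n rhs).
  { apply le. intros l _ _. specialize (P l). apply Rabs_le_between in P. lra. }
  assert (U2 : Ex n (fun l => exp (centered q n l) + -1 * exp (centered (fun x => q x + g x) n l)) <= Ex n rhs).
  { apply le. intros l _ _. specialize (P l). apply Rabs_le_between in P. lra. }
  rewrite Ex_plus, Ex_scal in U1, U2. apply Rabs_le. lra.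
Qed.

(** f is a polynomial plus a remainder with Lipschitz constant e. Three errors, each at most eps /
    3, are added: dropping the remainder, the limit for the polynomial, and the change of
    variance. *)
Lemma mgf_approximable f : approximable f ->
  is_lim_seq (fun n => Ex n (fun l => exp (centered f n l))) (exp (Series (var_term f a b) / 2)).
Proof.
  intros Hf. set (s := Series (var_term f a b)).
  destruct (approximable_lip f Hf) as [L0 [HL0 Hlip]].
  set (L := L0 + 1).
  apply is_lim_seq_spec. intros [eps Heps]. simpl.
  assert (C : continuity_pt exp (s / 2)) by apply derivable_continuous_pt, derivable_pt_exp.
  destruct (proj1 (continuity_pt_locally exp _) C (mkposreal (eps / 3) ltac:(lra))) as [[d Hd0] Hd]. simpl in Hd.
  (* [M1] dominates e + 1 + L^2 from [var_series_close]. [M2] comes from [mgf_close] with tau = e,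
     where (exp(4 e^2) - 1) / e is at most 4 e exp 4 since e <= 1. *)
  set (M1 := 3 + L ^ 2). set (M2 := exp ((2 * L) ^ 2) + 4 * exp 4).
  assert (HM1 : 0 < M1) by (assert (Q := pow2_ge_0 L); unfold M1; lra).
  assert (HM2 : 0 < M2) by (assert (Q := exp_pos ((2 * L) ^ 2)); assert (Q' := exp_pos 4); unfold M2; lra).
  set (e := Rmin 1 (Rmin (d / M1) (eps / 3 / M2))).
  assert (He : 0 < e) by (repeat apply Rmin_pos; try lra; apply Rdiv_lt_0_compat; lra).
  assert (He1 : e <= 1) by apply Rmin_l.
  assert (He2 : e * M1 <= d).
  { apply Rle_trans with (d / M1 * M1); [|right; field; lra]. apply Rmult_le_compat_r; [lra|].
    eapply Rle_trans; [apply Rmin_r|apply Rmin_l]. }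
  assert (He3 : e * M2 <= eps / 3).
  { apply Rle_trans with (eps / 3 / M2 * M2); [|right; field; lra]. apply Rmult_le_compat_r; [lra|].
    eapply Rle_trans; [apply Rmin_r|apply Rmin_r]. }
  destruct (proj2 Hf e He) as [p [D [_ Hr]]].
  assert (Hp : lip (pol p D) L).
  { assert (Hp := approx_lip f p D e L0 Hlip Hr). intros x y Hx Hy.
    eapply Rle_trans; [now apply Hp|]. apply Rmult_le_compat_r; [apply Rabs_pos|unfold L; lra]. }
  assert (HL : 0 <= L) by (unfold L; lra).
  assert (Sc := var_series_close f Hf p D e L He HL Hp Hr). fold s in Sc.
  assert (Sc' : Rabs (sig p D / 2 - s / 2) < d).
  { replace (sig p D / 2 - s / 2) with (- ((s - sig p D) / 2)) by field.
    rewrite Rabs_Ropp. unfold Rdiv. rewrite Rabs_mult, (Rabs_pos_eq (/ 2)) by lra.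
    replace ((1 + / e) * e ^ 2 + e * L ^ 2) with (e * (e + 1 + L ^ 2)) in Sc by (field; lra).
    assert (e * (e + 1 + L ^ 2) <= e * M1) by (apply Rmult_le_compat_l; unfold M1; lra). lra. }
  assert (Hs := Hd _ Sc').
  destruct (proj2 (is_lim_seq_spec _ _) (mgf_pol p D) (mkposreal (eps / 3) ltac:(lra))) as [n0 H0].
  simpl in H0. destruct size_eventually as [n1 H1].
  exists (n0 + n1)%nat. intros n Hn. specialize (H0 n ltac:(lia)).
  destruct (H1 n ltac:(lia)) as [S1 S2].
  assert (Ce' : / 2 * (e * exp ((2 * L) ^ 2) + / e * (exp ((2 * e) ^ 2) - 1)) <= / 2 * (e * M2)).
  { apply Rmult_le_compat_l; [lra|]. unfold M2. rewrite Rmult_plus_distr_l. apply Rplus_le_compat_l.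
    assert (X := Rabs_exp_minus_1_le ((2 * e) ^ 2)).
    rewrite (Rabs_pos_eq ((2 * e) ^ 2)) in X by apply pow2_ge_0.
    assert (X' := Rle_abs (exp ((2 * e) ^ 2) - 1)).
    assert (E4 : exp ((2 * e) ^ 2) <= exp 4) by (apply exp_le; simpl; nra).
    apply Rle_trans with (/ e * ((2 * e) ^ 2 * exp 4)).
    - apply Rmult_le_compat_l; [left; now apply Rinv_0_lt_compat|].
      eapply Rle_trans; [exact (Rle_trans _ _ _ X' X)|].
      apply Rmult_le_compat_l; [apply pow2_ge_0|exact E4].
    - right. field. lra. }
  assert (Cl := mgf_close (pol p D) (fun x => f x - pol p D x) n L e e S1 S2 HL (Rlt_le _ _ He) He Hp Hr).
  cbv beta in Cl.
  replace (fun x => pol p D x + (f x - pol p D x)) with f in Cl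
    by (apply functional_extensionality; intros x; ring).
  assert (Cl' := Rle_trans _ _ _ Cl Ce'). clear Cl.
  apply Rabs_lt_between in H0. apply Rabs_lt_between in Hs. apply Rabs_le_between in Cl'.
  apply Rabs_lt_between. lra.
Qed.

Lemma var_series_scal f s : approximable f ->
  Series (var_term (fun x => s * f x) a b) = s ^ 2 * Series (var_term f a b).
Proof.
  intros Hf. rewrite <- Series_scal_l. apply Series_ext. intros m.
  rewrite (var_term_fc f Hf), (var_term_fc _ (approximable_scal f s Hf)).
  rewrite (fhat_re_scal a b a_pos b_lo b_hi (fun x => f (clamp x)) s) by apply Hf. ring.
Qed.

(** The generating function of f at s is that of s f at 1, and the variance series scales by s^2.
    Indices are shifted by [n0] because monotonicity of the expectation is established only once n
    <= Nn n and Nn n > 0. *)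
Lemma clt_approximable f : approximable f ->
  forall g : R -> R, (exists M, forall x, Rabs (g x) <= M) -> (forall x, continuous g x) ->
  exists I : R, GI (Series (var_term f a b)) g I /\
    is_lim_seq (fun n => Ex n (fun l => g (centered f n l))) I.
Proof.
  intros Hf g Hb Hg. destruct size_eventually as [n0 H0].
  destruct (mgf_weak_convergence
    (fun n u => Ex (n + n0)%nat (fun l => u (centered f (n + n0)%nat l)))
    (Series (var_term f a b)) (var_series_nonneg f Hf)) with (g := g) as [_ [I [HI HL]]]; auto.
  - intros n u w c d. now rewrite Ex_plus, !Ex_scal.
  - intros n u w H. destruct (H0 (n + n0)%nat ltac:(lia)) as [S1 S2].
    apply (Ex_le (n + n0) _ S1 S2); auto.
  - intros s. apply (is_lim_seq_incr_n (fun n => Ex n (fun l => exp (s * centered f n l))) n0).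
    replace (s ^ 2 * Series (var_term f a b) / 2)
      with (Series (var_term (fun x => s * f x) a b) / 2) by (rewrite var_series_scal by exact Hf; field).
    apply is_lim_seq_ext with (2 := mgf_approximable _ (approximable_scal f s Hf)).
    intros n. f_equal. apply functional_extensionality. intros l.
    now rewrite centered_scal.
  - exists I. split; [exact HI|].
    now apply (is_lim_seq_incr_n (fun n => Ex n (fun l => g (centered f n l))) n0).
Qed.

End CentralLimit.

Theorem theorem6p1
  (A B t : R) (hA : 0 <= A) (hB : 0 <= B) (ht : 1 < t)
  (alpha beta : nat -> R) (Nn : nat -> nat)
  (halpha : forall n, -1 < alpha n) (hbeta : forall n, -1 < beta n)
  (lim_alpha : is_lim_seq (fun n => alpha n / INR n) A)
  (lim_beta : is_lim_seq (fun n => beta n / INR n) B)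
  (lim_N : is_lim_seq (fun n => INR (Nn n) / INR n) t)
  (f : R -> R) (hf : C1_on_01 f) :
  let a := a_par A B t in
  let b := b_par A B t in
  let sigma2 := Series (var_term f a b) in
  ex_series (var_term f a b) /\
  (* convergence in distribution of X_f - E X_f to N(0, sigma2):
     E[g(X_f - E X_f)] -> E[g(Z)] for every bounded continuous g *)
  forall g : R -> R,
    (exists M, forall x, Rabs (g x) <= M) ->
    (forall x, continuous g x) ->
    exists I : R,
      is_RInt_gen (gauss_integrand sigma2 g)
                  (Rbar_locally m_infty) (Rbar_locally p_infty) I /\
      is_lim_seq
        (fun n =>
           hahn_expect n (Nn n) (alpha n) (beta n)
             (fun l => g (lin_stat f (Nn n) l
                          - hahn_expect n (Nn n) (alpha n) (beta n) (lin_stat f (Nn n)))))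
        I.
Proof.
  intros a b sigma2.
  assert (Hf := C1_approximable f hf).
  split; [exact (proj1 (var_series A B t hA hB ht alpha beta Nn halpha hbeta
                          lim_alpha lim_beta lim_N f Hf))|].
  exact (clt_approximable A B t hA hB ht alpha beta Nn halpha hbeta
           lim_alpha lim_beta lim_N f Hf).
Qed.
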